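(* Let $(N^n,\tilde g)$ be a smooth Riemannian manifold with $n\ge3$, $f:M^2\to N^n$ a $C^\infty$-map, $p\in M^2$ a branch point of order $s$, and $(U,x)$, $(V,y)$ $C^\infty$-regular branch coordinates at $p$. If $y$ is a conformal diffeomorphism and $\iota$ is the index of $p$ (with respect to $(U,x)$, $(V,y)$), the following statements hold: (i) If $\iota\ge2s+1$, then the sectional curvature $Sec$ of the induced metric on $U-\{p\}$, the mean curvature vector $\mathcal H|_{U-\{p\}}$ and the Gauss-Kronecker curvature $K^\xi|_{U-\{p\}}$ have $C^{0,1}_{loc}$-extensions on $U$, where $\xi$ is any local smooth section of the normal bundle $\bot_f$ of $f$ over $U$. (ii) If $\iota<2s+1$, then $\lim_{q\to p}Sec(q)=\infty$ and $\lim_{q\to p}\sum_{j=1}^{n-2}K^{\xi_j'}(q)=\infty$ for any smooth orthonormal frame field $(\xi_1',\dots,\xi_{n-2}')$ for the normal bundle of $f$ over $U$.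
   Context: Conventions. $\mathbb N=\{1,2,\dots\}$. $\mathbb R^2=\mathbb C$ via $z=x_1+ix_2$; $\frac{\partial}{\partial z}=\frac12(\frac{\partial}{\partial x_1}-i\frac{\partial}{\partial x_2})$, $\frac{\partial}{\partial\bar z}=\frac12(\frac{\partial}{\partial x_1}+i\frac{\partial}{\partial x_2})$. $C^{0,1}_{loc}$ means locally Lipschitz. When coordinate systems $(U,x)$ at $p$, $(V,y)$ at $f(p)$ are taken, $f(U)\subset V$ is assumed and $\hat f=y\circ f\circ x^{-1}$. Branch points. $p$ is a branch point of order $s\in\mathbb N$ of the $C^1$-map $f$ if there are coordinate systems at $p$, $f(p)$ with $x(p)=0$, $y(f(p))=0$ such that $\sigma(z):=\hat f_1(z)+i\hat f_2(z)-z^{s+1}=o(|z|^{s+1})$, $\hat f_k(z)=o(|z|^{s+1})$ for $3\le k\le n$, and $\frac{\partial\sigma}{\partial x_j}(z),\frac{\partial\hat f_k}{\partial x_j}(z)=o(|z|^s)$ for $3\le k\le n$, $j=1,2$. $C^\infty$-regular branch coordinates at $p$: coordinate systems $(U,x)$, $(V,y)$ at $p$, $f(p)$ with $x(p)=0$, $y(f(p))=0$ such that, for $s$ the order of $p$, there are smooth maps $d:x(U)\to\mathbb C^n$, $l:x(U)\to\mathbb R^n$ with: (a) $\frac{\partial\hat f}{\partial z}(z)=(s+1)z^sd(z)$ and $\frac{\partial^2\hat f}{\partial\bar z\partial z}(z)=|z|^{2s}l(z)$ on $x(U)$; (b) $d_1=\frac12(1+d_1')$, $d_2=-\frac i2(1+d_2')$,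 $d_1'(0)=d_2'(0)=0$, $d_j(0)=0$ for $3\le j\le n$; (c) $\det\begin{pmatrix}2\mathrm{Re}\,d_1&-2\mathrm{Im}\,d_1\\2\mathrm{Re}\,d_2&-2\mathrm{Im}\,d_2\end{pmatrix}\neq0$ on $x(U)$; (d) $1+\frac12(d_1'+d_2')\ne0$ on $x(U)$ and $\sup_{x(U)}\dfrac{|\frac12(d_1'-d_2')|}{|1+\frac12(d_1'+d_2')|}<1$. In particular $p$ is the only singular point of $f$ in $U$. Index. For a smooth map $G$ defined near $0\in\mathbb C$ with values in $\mathbb C^k$ and $G(0)=0$, the $z$-order $ord_z(G)\in\mathbb N\cup\{\infty\}$ is the least $j\in\mathbb N$ with $\frac{\partial^jG}{\partial z^j}(0)\ne0$ ($\infty$ if there is none). The index of $p$ with respect to $(U,x)$, $(V,y)$ is $\iota=ord_z(\hat f_3,\dots,\hat f_n)-1$. Tangent and normal bundle over $U$. $T_f$ is the rank-2 smooth subbundle of $f^*TN^n|_U$ whose fiber at $x^{-1}(z)$ is spanned by $\sum_j\mathrm{Re}\,d_j(z)\frac{\partial}{\partial y_j}$ and $\sum_j\mathrm{Im}\,d_j(z)\frac{\partial}{\partial y_j}$ (at points $q\neq p$ it equals $f_*T_qM^2$). The normal bundle $\bot_f$ is its $\tilde g$-orthogonal complement in $f^*TN^n|_U$. Curvatures on $U-\{p\}$. $g$ is the induced metric, $\tilde\nabla$ the connection on $f^*TN^n$ induced by the Levi-Civita connection of $\tilde g$, $\alpha(X,Y)=(\tilde\nabla_Xf_*Y)^\perp$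 the second fundamental form, $A_\xi$ the shape operator defined by $g(A_\xi X,Y)=\tilde g(\alpha(X,Y),\xi)$, $K^\xi=\det A_\xi$, $\mathcal H=\frac12\mathrm{tr}_g\,\alpha$ (a section of $f^*TN^n$), and $Sec$ is the sectional (Gaussian) curvature of $g$. $y:V\to y(V)\subset\mathbb R^n$ is a conformal diffeomorphism if the pullback by $y$ of the Euclidean metric equals $\rho\,\tilde g$ for a positive smooth function $\rho$ on $V$.
   Formalization: In (ii) the limits ''= ∞'' are stated for absolute values, |Sec(q)| → +∞ and |Σ K^{ξ_j'}(q)| → +∞, since read as +∞ the claim fails: for f(z) = (z², Re z³) in R³ (s=1, ι=2) both tend to −∞. *)

(* Defs.v *)
From HB Require Import structures.
From mathcomp Require Import all_boot all_order all_algebra.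
From mathcomp Require Import all_classical all_reals all_analysis.
From mathcomp Require Export complex.

Set Implicit Arguments.
Unset Strict Implicit.
Unset Printing Implicit Defensive.

Import Order.TTheory GRing.Theory Num.Theory.
Import numFieldNormedType.Exports.

Local Open Scope classical_set_scope.
Local Open Scope ring_scope.
Local Open Scope complex_scope.

(** * Calculus on open subsets of R^m *)

Definition pd (R : realType) m (W : normedModType R) (i : 'I_m)
    (F : 'rV[R]_m -> W) (z : 'rV[R]_m) : W :=
  'D_(delta_mx 0 i) F z.

(* [D] is meant to be open. *)
Fixpoint Ck_on (R : realType) m (W : normedModType R) (k : nat)
    (D : set 'rV[R]_m) (F : 'rV[R]_m -> W) : Prop :=
  match k with
  | 0 => forall z, D z -> {for z, continuous F}
  | k'.+1 => (forall z, D z -> differentiable F z) /\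
             (forall i, Ck_on k' D (pd i F))
  end.

Definition smooth_on (R : realType) m (W : normedModType R)
    (D : set 'rV[R]_m) (F : 'rV[R]_m -> W) : Prop :=
  forall k, Ck_on k D F.

Definition locally_lipschitz (R : realType) m (W : normedModType R)
    (D : set 'rV[R]_m) (F : 'rV[R]_m -> W) : Prop :=
  forall z, D z -> exists2 B, nbhs z B & [lipschitz F w | w in B `&` D].

(** * Smooth manifolds and Riemannian metrics *)

(* [chart_map] and [chart_inv] are total functions; their values outside of
   [chart_dom] and of its image are irrelevant. *)
Record chart (R : realType) (T : topologicalType) (m : nat) := Chart {
  chart_dom : set T;
  chart_map :> T -> 'rV[R]_m;
  chart_inv : 'rV[R]_m -> T;
  chart_dom_open : open chart_dom;
  chart_img_open : open (chart_map @` chart_dom);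
  chart_mapK : forall q, chart_dom q -> chart_inv (chart_map q) = q;
  chart_map_continuous :
    forall q, chart_dom q -> {for q, continuous chart_map};
  chart_inv_continuous :
    forall z, (chart_map @` chart_dom) z -> {for z, continuous chart_inv}
}.

Definition chart_img (R : realType) (T : topologicalType) m
    (c : chart R T m) : set 'rV[R]_m := c @` chart_dom c.

Definition smooth_transition (R : realType) (T : topologicalType) m
    (c c' : chart R T m) : Prop :=
  smooth_on (c @` (chart_dom c `&` chart_dom c')) (c' \o chart_inv c).

Record manifold (R : realType) (m : nat) := Manifold {
  points :> topologicalType;
  atlas : set (chart R points m);
  atlas_cover : forall q : points, exists2 c, atlas c & chart_dom c q;
  atlas_smooth : forall c c', atlas c -> atlas c' -> smooth_transition c c';
  points_hausdorff : hausdorff_space points;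
  points_second_countable : @second_countable points
}.

(* The coordinate systems are the members of the maximal atlas. *)
Definition coordinate_system (R : realType) m (M : manifold R m)
    (c : chart R M m) : Prop :=
  forall c', atlas c' -> smooth_transition c c' /\ smooth_transition c' c.

(* The expression f^ = y o f o x^-1 of [f] in the charts [x], [y]. *)
Definition local_expr (R : realType) m n (M : manifold R m) (N : manifold R n)
    (f : M -> N) (x : chart R M m) (y : chart R N n) :
    'rV[R]_m -> 'rV[R]_n :=
  fun z => y (f (chart_inv x z)).

Definition smooth_map (R : realType) m n (M : manifold R m) (N : manifold R n)
    (f : M -> N) : Prop :=
  continuous f /\
  forall (x : chart R M m) (y : chart R N n),
    coordinate_system x -> coordinate_system y ->
    smooth_on (x @` (chart_dom x `&` f @^-1` chart_dom y)) (local_expr f x y).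

Definition inner (R : realType) n (G : 'M[R]_n) (u v : 'rV[R]_n) : R :=
  (u *m G *m v^T) 0 0.

(* A Riemannian metric is given by its matrices [gram c] of components in
   the coordinate systems, as functions on the images of the latter, subject
   to the transformation law of a covariant 2-tensor.  ('J acts on row
   vectors: its i-th row is the i-th partial derivative.) *)
Record riemannian_metric (R : realType) n (N : manifold R n) := Riemannian {
  gram : chart R N n -> 'rV[R]_n -> 'M[R]_n;
  gram_smooth : forall c, coordinate_system c ->
    smooth_on (chart_img c) (gram c);
  gram_sym : forall c, coordinate_system c ->
    forall u, chart_img c u -> (gram c u)^T = gram c u;
  gram_posdef : forall c, coordinate_system c ->
    forall u, chart_img c u -> forall v, v != 0 -> 0 < inner (gram c u) v v;
  gram_transform : forall c c', coordinate_system c -> coordinate_system c' ->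
    forall u, (c @` (chart_dom c `&` chart_dom c')) u ->
    let tau := c' \o chart_inv c in
    gram c u = 'J tau u *m gram c' (tau u) *m ('J tau u)^T
}.

(* The Euclidean metric has the identity matrix as components in the chart
   [y], so that its pullback by [y] equals [rho] times the metric iff the
   following holds. *)
Definition conformal_chart (R : realType) n (N : manifold R n)
    (gN : riemannian_metric N) (y : chart R N n) : Prop :=
  exists rho : N -> R,
    [/\ smooth_on (chart_img y) (rho \o chart_inv y : 'rV[R]_n -> R^o),
        forall q, chart_dom y q -> 0 < rho q &
        forall q, chart_dom y q -> 1%:M = rho q *: gram gN y (y q)].

(* The Christoffel symbol Gamma^k_ij of the Levi-Civita connection. *)
Definition christoffel (R : realType) n (G : 'rV[R]_n -> 'M[R]_n)
    (k i j : 'I_n) (u : 'rV[R]_n) : R :=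
  2^-1 * \sum_l invmx (G u) k l *
    (pd i (fun w => G w j l : R^o) u + pd j (fun w => G w i l : R^o) u
     - pd l (fun w => G w i j : R^o) u).

(** * Branch points and regular branch coordinates *)

Definition toC (R : realType) (z : 'rV[R]_2) : R[i] := z 0 0 +i* z 0 1.

Definition modC (R : realType) (z : R[i]) : R := ComplexField.Normc.normc z.

Definition pdC (R : realType) (i : 'I_2) (F : 'rV[R]_2 -> R[i])
    (z : 'rV[R]_2) : R[i] :=
  pd i (fun w => complex.Re (F w) : R^o) z +i* pd i (fun w => complex.Im (F w) : R^o) z.

Definition dz (R : realType) (F : 'rV[R]_2 -> R[i]) (z : 'rV[R]_2) : R[i] :=
  2^-1 * (pdC 0 F z - 'i%C * pdC 1 F z).

Definition dzbar (R : realType) (F : 'rV[R]_2 -> R[i]) (z : 'rV[R]_2) : R[i] :=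
  2^-1 * (pdC 0 F z + 'i%C * pdC 1 F z).

Definition coordC (R : realType) n (F : 'rV[R]_2 -> 'rV[R]_n) (k : 'I_n) :
    'rV[R]_2 -> R[i] := fun z => (F z 0 k)%:C.

(* Coordinate indices start at 0: the tangential coordinates y_1, y_2 have
   indices [first], [second], and y_3, ..., y_n are those with [2 <= k]. *)
Definition first n (hn : (3 <= n)%N) : 'I_n := Ordinal (ltnW (ltnW hn)).
Definition second n (hn : (3 <= n)%N) : 'I_n := Ordinal (ltnW hn).

Definition coordinates_at (R : realType) n (M : manifold R 2)
    (N : manifold R n) (f : M -> N) (p : M)
    (x : chart R M 2) (y : chart R N n) : Prop :=
  [/\ coordinate_system x /\ coordinate_system y,
      chart_dom x p,
      f @` chart_dom x `<=` chart_dom y,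
      x p = 0 &
      y (f p) = 0].

Definition branch_point (R : realType) n (hn : (3 <= n)%N) (M : manifold R 2)
    (N : manifold R n) (f : M -> N) (p : M) (s : nat) : Prop :=
  (1 <= s)%N /\
  exists (x : chart R M 2) (y : chart R N n),
    coordinates_at f p x y /\
    let fh := local_expr f x y in
    let sigma : 'rV[R]_2 -> R[i] := fun z =>
      (fh z 0 (first hn) +i* fh z 0 (second hn)) - toC z ^+ s.+1 in
    let small (r : nat) (F : 'rV[R]_2 -> R[i]) :=
      (fun z => modC (F z) : R^o) =o_ (0 : 'rV[R]_2)
      (fun z => modC (toC z) ^+ r : R^o) in
    [/\ small s.+1 sigma,
        forall k : 'I_n, (2 <= k)%N -> small s.+1 (coordC fh k),
        forall j : 'I_2, small s (pdC j sigma) &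
        forall (k : 'I_n) (j : 'I_2), (2 <= k)%N ->
          small s (pdC j (coordC fh k))].

Definition regular_branch_coordinates (R : realType) n (hn : (3 <= n)%N)
    (M : manifold R 2) (N : manifold R n) (f : M -> N) (p : M) (s : nat)
    (x : chart R M 2) (y : chart R N n)
    (d : 'rV[R]_2 -> 'rV[R[i]]_n) (l : 'rV[R]_2 -> 'rV[R]_n) : Prop :=
  let D := chart_img x in
  let fh := local_expr f x y in
  let d1 z := d z 0 (first hn) in
  let d2 z := d z 0 (second hn) in
  [/\ coordinates_at f p x y,
      [/\ smooth_on D (fun z => map_mx (@complex.Re R) (d z)),
          smooth_on D (fun z => map_mx (@complex.Im R) (d z)) &
          smooth_on D l],
      forall z, D z -> forall k,
        dz (coordC fh k) z = s.+1%:R * toC z ^+ s * d z 0 k /\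
        dzbar (dz (coordC fh k)) z =
          (modC (toC z) ^+ (2 * s) * l z 0 k)%:C,
      forall z, D z ->
        \det (block_mx (2 * complex.Re (d1 z))%:M (- (2 * complex.Im (d1 z)))%:M
                       (2 * complex.Re (d2 z))%:M (- (2 * complex.Im (d2 z)))%:M
              : 'M[R]_(1 + 1)) != 0 &
      exists d1' d2' : 'rV[R]_2 -> R[i],
        [/\ forall z, D z -> d1 z = 2^-1 * (1 + d1' z) /\
                             d2 z = - ('i%C / 2) * (1 + d2' z),
            d1' 0 = 0 /\ d2' 0 = 0,
            forall k : 'I_n, (2 <= k)%N -> d 0 0 k = 0,
            forall z, D z -> 1 + 2^-1 * (d1' z + d2' z) != 0 &
            (ereal_sup [set (modC (2^-1 * (d1' z - d2' z)) /
                             modC (1 + 2^-1 * (d1' z + d2' z)))%:E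
                       | z in D] < 1)%E]].

(* The least j >= 1 with a nonzero j-th z-derivative at 0; being the infimum
   of a set of integers, it is attained unless the set is empty, in which
   case it is +oo. *)
Definition zord (R : realType) (I : Type) (G : I -> 'rV[R]_2 -> R[i]) : \bar R :=
  ereal_inf [set (j%:R : R)%:E
            | j in [set j : nat | (1 <= j)%N /\
                                  exists k, iter j (@dz R) (G k) 0 <> 0]].

Definition branch_index (R : realType) n (M : manifold R 2) (N : manifold R n)
    (f : M -> N) (x : chart R M 2) (y : chart R N n) : \bar R :=
  (zord (fun k : {k : 'I_n | (2 <= k)%N} =>
           coordC (local_expr f x y) (sval k)) - 1)%E.

(** * Tangent and normal bundles over U *)

(* Vectors of f^*TN over U are represented by their components in the
   frame d/dy_1, ..., d/dy_n. *)
Definition tangent_fiber (R : realType) n (d : 'rV[R]_2 -> 'rV[R[i]]_n)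
    (z : 'rV[R]_2) : 'M[R]_(1 + 1, n) :=
  col_mx (map_mx (@complex.Re R) (d z)) (map_mx (@complex.Im R) (d z)).

Definition normal_fiber (R : realType) n (G : 'rV[R]_n -> 'M[R]_n)
    (fh : 'rV[R]_2 -> 'rV[R]_n) (d : 'rV[R]_2 -> 'rV[R[i]]_n)
    (z : 'rV[R]_2) : set 'rV[R]_n :=
  [set v | forall u : 'rV[R]_n,
     (u <= tangent_fiber d z)%MS -> inner (G (fh z)) v u = 0].

Definition smooth_normal_section (R : realType) n (M : manifold R 2)
    (N : manifold R n) (gN : riemannian_metric N) (f : M -> N)
    (x : chart R M 2) (y : chart R N n) (d : 'rV[R]_2 -> 'rV[R[i]]_n)
    (A : set M) (xi : M -> 'rV[R]_n) : Prop :=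
  smooth_on (x @` A) (xi \o chart_inv x) /\
  forall q, A q -> normal_fiber (gram gN y) (local_expr f x y) d (x q) (xi q).

Definition smooth_normal_frame (R : realType) n (M : manifold R 2)
    (N : manifold R n) (gN : riemannian_metric N) (f : M -> N)
    (x : chart R M 2) (y : chart R N n) (d : 'rV[R]_2 -> 'rV[R[i]]_n)
    (A : set M) (xi : 'I_(n - 2) -> M -> 'rV[R]_n) : Prop :=
  (forall j, smooth_normal_section gN f x y d A (xi j)) /\
  forall q, A q -> forall i j,
    inner (gram gN y (y (f q))) (xi i q) (xi j q) = (i == j)%:R.

(** * Curvatures *)

Section Curvatures.
Variables (R : realType) (n : nat).
(* [G]: the metric of the target in the chart y; [fh]: the map in x, y. *)
Variables (G : 'rV[R]_n -> 'M[R]_n) (fh : 'rV[R]_2 -> 'rV[R]_n).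
Implicit Types z : 'rV[R]_2.

Definition induced_metric z : 'M[R]_2 :=
  \matrix_(i, j) inner (G (fh z)) (pd i fh z) (pd j fh z).

(* Covariant derivative in the direction d/dx_i of a section of f^*TN. *)
Definition pullback_nabla (i : 'I_2) (Y : 'rV[R]_2 -> 'rV[R]_n) z : 'rV[R]_n :=
  pd i Y z + \row_k (\sum_a \sum_b
    christoffel G k a b (fh z) * pd i fh z 0 a * Y z 0 b).

Definition normal_part z (v : 'rV[R]_n) : 'rV[R]_n :=
  v - \sum_i \sum_j (invmx (induced_metric z) i j *
                     inner (G (fh z)) v (pd i fh z)) *: pd j fh z.

Definition second_fundamental_form (i j : 'I_2) z : 'rV[R]_n :=
  normal_part z (pullback_nabla i (pd j fh) z).

Definition mean_curvature z : 'rV[R]_n :=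
  2^-1 *: \sum_i \sum_j
    invmx (induced_metric z) i j *: second_fundamental_form i j z.

(* The matrix, acting on columns of components in d/dx_1, d/dx_2, of the
   operator A_xi defined by g(A_xi X, Y) = <alpha(X, Y), xi>. *)
Definition shape_operator z (xi : 'rV[R]_n) : 'M[R]_2 :=
  invmx (induced_metric z) *m
  \matrix_(i, j) inner (G (fh z)) (second_fundamental_form i j z) xi.

Definition gauss_kronecker z (xi : 'rV[R]_n) : R := \det (shape_operator z xi).

End Curvatures.

(* R(d_i, d_j) d_k = sum_l (riemann_tensor g l i j k) d_l. *)
Definition riemann_tensor (R : realType) m (g : 'rV[R]_m -> 'M[R]_m)
    (l i j k : 'I_m) (z : 'rV[R]_m) : R :=
  pd i (christoffel g l j k : 'rV[R]_m -> R^o) z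
  - pd j (christoffel g l i k : 'rV[R]_m -> R^o) z
  + \sum_a (christoffel g a j k z * christoffel g l i a z
            - christoffel g a i k z * christoffel g l j a z).

Definition sectional_curvature (R : realType) (g : 'rV[R]_2 -> 'M[R]_2)
    (z : 'rV[R]_2) : R :=
  (\sum_l riemann_tensor g l 0 1 1 z * g z l 0) / \det (g z).

(* [F], considered on A - {p}, has a locally Lipschitz extension to A,
   where A is an open subset of the domain of the chart [x]. *)
Definition C01loc_extension (R : realType) m (M : manifold R m)
    (V : normedModType R) (x : chart R M m) (p : M) (A : set M)
    (F : M -> V) : Prop :=
  exists2 E : M -> V,
    forall q, A q -> q <> p -> E q = F q &
    locally_lipschitz (x @` A) (E \o chart_inv x).

(* Main.v *)
Require Import Defs.
From mathcomp Require Import all_boot all_order all_algebra.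
From mathcomp Require Import all_classical all_reals all_analysis.
From mathcomp Require Import ring lra zify.
Set Implicit Arguments.
Unset Strict Implicit.
Unset Printing Implicit Defensive.
Import Order.TTheory GRing.Theory Num.Theory.
Import numFieldNormedType.Exports.
Local Open Scope classical_set_scope.
Local Open Scope ring_scope.

(* Write f^ for the map in the given coordinates, d = e1 + i e2, and let P be the
   Euclidean projection onto the normal space.  Since y is conformal, P is also the
   projection for the metric of N, all Christoffel symbols of N involve only the
   conformal factor, and the normal part of the second derivatives of f^ is governed
   by P l and by z^s P (dz d).  The tangential part of dz d disappears under P, so that
   dz d may be replaced by the oblique projection z^s u whose first two components
   vanish: P (dz d) = z^s P u for z <> 0.  The powers of z then cancel in all
   curvatures, which become rational functions of the smooth data and of u, with
   denominators that do not vanish at the branch point; moreover the terms of highest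
   order in u are negative multiples of |P u1|^2 + |P u2|^2, where u = u1 + i u2.

   The identity dzbar d = conj(z)^s l / (s+1) shows that the growth of d_k (k >= 3) at 0
   is that of the first nonvanishing z-derivative, up to order s+1.  If the index is at
   least 2s+1, then d_k and dz d_k - c z^s have vanishing order that makes u locally
   Lipschitz; otherwise some u_k grows at least like 1/|z|, and so does P u, because P is
   injective, with locally bounded inverse, on the vectors whose first two components
   vanish. *)

(** * Calculus on open sets *)

(** The index concerns each coordinate [k >= 2] of the map separately, whereas the orthogonal
    projection mixes all coordinates and hides their vanishing orders. This is what the oblique
    projection is for: Cramer's rule in the first two coordinates gives smooth coefficients X, Y,
    and the k-th component of dz d - X e1 - Y e2 contains, besides X and Y, only d_k, its conjugate
    and dz d_k.

    Since dz f^_k = (s+1) z^s d_k, orders shift by s+1, and index at least 2s+1 says that the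
    z-derivatives of d_k of order at most s vanish at 0. Hence d_k = O(|z|^(s+1)), the best that the
    factor conj(z)^s in dzbar d allows. Below the threshold some dz d_k starts with a monomial a
    z^m, m < s.

    The powers of z cancel because the first and second fundamental forms and the Hessian of log
    lam, with lam the conformal factor, all have the shape Re (z^(2s) t dz^2) + |z|^(2s) m |dz|^2.
    Relative traces and quotients of determinants of such forms are free of z. The determinant is a
    multiple of m^2 - |t|^2, whence the negative sign of the terms of highest order in u. *)

Lemma is_derive_line (R : realType) (V : normedModType R) (F : V -> R^o)
    (a v : V) (t : R) :
  derivable F (a + t *: v) v ->
  is_derive t 1 (fun t => F (a + t *: v) : R^o) ('D_v F (a + t *: v)).
Proof.
have E : (fun h => h^-1 *: (((fun t : R => F (a + t *: v) : R^o) \o shift t) (h *: (1:R^o)) - F (a + t *: v))) =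
  (fun h => h^-1 *: ((F \o shift (a + t *: v)) (h *: v) - F (a + t *: v))).
  apply/funext => h /=; congr (_ *: (F _ - _)).
  by rewrite scalerDl [_ *: 1]mulr1 addrCA.
by move=> dF; split; rewrite /derivable /derive E.
Qed.

Lemma MVT_line (R : realType) (V : normedModType R) (F : V -> R^o) (a v : V) :
  (forall t : R, t \in `[0, 1] -> derivable F (a + t *: v) v) ->
  exists2 t, t \in `]0, 1[ & F (a + v) - F a = 'D_v F (a + t *: v).
Proof.
move=> dF.
have D (t : R) : t \in `[0, 1] -> is_derive t 1 (fun t => F (a + t *: v) : R^o)
  ('D_v F (a + t *: v)) by move=> /dF; exact: is_derive_line.
have C : {within `[0, 1], continuous (fun t : R => F (a + t *: v) : R)}.
  apply: derivable_within_continuous => t t01.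
  exact: (@ex_derive _ _ _ _ _ _ _ (D t t01)).
have [c c01] := @MVT R (fun t : R => F (a + t *: v) : R)
  (fun t : R => 'D_v F (a + t *: v)) 0 1 ltr01
  (fun t h => D t (subset_itv_oo_cc h)) C.
by rewrite scale1r scale0r addr0 subr0 mulr1 => E; exists c.
Qed.

Lemma near_continuous (R : realType) (V W : normedModType R)
    (F G : V -> W) z :
  (\forall w \near z, F w = G w) -> {for z, continuous F} -> {for z, continuous G}.
Proof.
move=> FG cF; rewrite /prop_for /continuous_at -(nbhs_singleton FG).
by apply: cvg_trans cF; exact: near_eq_cvg.
Qed.

Lemma near_differentiable (R : realType) (V W : normedModType R)
    (F G : V -> W) z :
  (\forall w \near z, F w = G w) -> differentiable F z -> differentiable G z.
Proof.
move=> FG dF; have [cF eF] := (diff_locallyP _ _).1 dF.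
have eG : G \o shift z = cst (G z) + 'd F z +o_ 0 id.
  move: eF => /eqaddoP eF; apply/eqaddoP => e e0.
  have nF : \forall w \near (0 : V), F (w + z) = G (w + z).
    by move: FG; rewrite (near_shift 0 z); apply: filterS => w /=; rewrite subr0.
  apply: filterS2 nF (eF e e0) => w /= Fw.
  by rewrite !fctE /= Fw (nbhs_singleton FG).
by apply/diff_locallyP; rewrite (diff_unique cF eG).
Qed.

Section PartialDerivatives.
Variables (R : realType) (m : nat).
Implicit Types (W : normedModType R) (D : set 'rV[R]_m) (z v : 'rV[R]_m).

Lemma derive_pd W (F : 'rV[R]_m -> W) z v : differentiable F z ->
  'D_v F z = \sum_i v 0 i *: pd i F z.
Proof.
move=> dF; rewrite deriveE // {1}(row_sum_delta v) linear_sum.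
by apply: eq_bigr => i _; rewrite linearZ /= /pd deriveE.
Qed.

Lemma normr_coord_le (a b : nat) (A : 'M[R]_(a, b)) i j : `|A i j| <= `|A|.
Proof.
rewrite [leRHS]/Num.Def.normr/= mx_normrE.
exact: (le_bigmax _ _ (i, j)).
Qed.

(** The factor [m] comes from the sup norm: each of the [m] terms of [derive_pd] is at most [C]
    times the norm of [b - a]. *)
Lemma mvi_segment (F : 'rV[R]_m -> R^o) (a b : 'rV[R]_m) C :
  (forall t : R, t \in `[0, 1] -> differentiable F (a + t *: (b - a))) ->
  (forall t : R, t \in `[0, 1] -> forall i, `|pd i F (a + t *: (b - a))| <= C) ->
  `|F b - F a| <= m%:R * C * `|b - a|.
Proof.
move=> dF bF.
have [t t01] := @MVT_line R _ F a (b - a)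
  (fun t h => diff_derivable (dF t h)).
have t01' : t \in `[0, 1] by exact: subset_itv_oo_cc t01.
rewrite subrKC => ->; rewrite derive_pd; last exact: dF.
rewrite (le_trans (ler_norm_sum _ _ _)) //.
rewrite -mulrA -[m in m%:R]card_ord -sum1_card natr_sum mulr_suml.
apply: ler_sum => i _; rewrite mul1r mulrC normrM ler_pM //.
  exact: normr_coord_le.
exact: bF.
Qed.

Lemma ball_segment W (z a b : W) r (t : R) : `|z - a| < r -> `|z - b| < r ->
  t \in `[0, 1] -> `|z - (a + t *: (b - a))| < r.
Proof.
move=> za zb; rewrite in_itv /= => /andP[t0 t1].
have -> : z - (a + t *: (b - a)) = (1 - t) *: (z - a) + t *: (z - b).
  have {1}-> : b - a = (z - a) - (z - b) by rewrite opprB [RHS]addrC subrKA.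
  by rewrite scalerBr opprD addrA opprB scalerBl scale1r [RHS]addrAC -[RHS]addrA.
apply: le_lt_trans (ler_normD _ _) _; rewrite !normrZ.
rewrite (ger0_norm t0) ger0_norm ?subr_ge0 //.
(* For t = 0 the strict inequality has to come from [a], otherwise it comes from [b]. *)
move: t0; rewrite le_eqVlt => /predU1P[<-|t0]; first by rewrite subr0 mul0r mul1r addr0.
have : (1 - t) * `|z - a| <= (1 - t) * r by apply: ler_wpM2l; rewrite ?subr_ge0 // ltW.
have : t * `|z - b| < t * r by rewrite ltr_pM2l.
lra.
Qed.

Lemma mvi_ball (F : 'rV[R]_m -> R^o) (z a b : 'rV[R]_m) r C :
  (forall w, `|z - w| < r -> differentiable F w) ->
  (forall w, `|z - w| < r -> forall i, `|pd i F w| <= C) ->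
  `|z - a| < r -> `|z - b| < r -> `|F b - F a| <= m%:R * C * `|b - a|.
Proof.
move=> dF bF za zb; apply: mvi_segment => t t01; first exact/dF/ball_segment.
by apply: bF; exact: ball_segment.
Qed.

Lemma pd_near W (F G : 'rV[R]_m -> W) z i :
  (\forall w \near z, F w = G w) -> pd i F z = pd i G z.
Proof. exact: near_eq_derive. Qed.

Lemma open_near D z : open D -> D z -> \forall w \near z, D w.
Proof. by move=> oD Dz; rewrite openE in oD; exact: oD. Qed.

Lemma open_ball D z : open D -> D z ->
  exists2 r : R, 0 < r & forall w, `|z - w| < r -> D w.
Proof.
move=> oD Dz; have := open_near oD Dz.
by move=> /nbhs_ballP[r /= r0 rD]; exists r => // w zw; apply: rD; rewrite -ball_normE.
Qed.

Lemma pd_on W D (F G : 'rV[R]_m -> W) i : open D ->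
  (forall w, D w -> F w = G w) -> forall w, D w -> pd i F w = pd i G w.
Proof.
move=> oD FG w Dw; apply: pd_near; have := open_near oD Dw.
exact: filterS.
Qed.

(** Formulas for partial derivatives hold on [D] only. This lemma lets the inductions on [k] replace
    a derivative by its formula; openness of [D] is what carries the equality over to
    derivatives. *)
Lemma Ck_on_ext W k D (F G : 'rV[R]_m -> W) : open D ->
  (forall w, D w -> F w = G w) -> Ck_on k D F -> Ck_on k D G.
Proof.
move=> oD; elim: k F G => [|k IH] F G FG /=.
  move=> cF z Dz; have nz : \forall w \near z, F w = G w.
    by have := open_near oD Dz; exact: filterS.
  exact: near_continuous nz (cF z Dz).
move=> [dF pF]; split=> [z Dz|i]; last first.
  by apply: (IH (pd i F)) => // w Dw; apply: (@pd_on _ D).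
have nz : \forall w \near z, F w = G w.
  by have := open_near oD Dz; exact: filterS.
exact: near_differentiable nz (dF z Dz).
Qed.

Lemma Ck_on_subset W k D D' (F : 'rV[R]_m -> W) :
  D' `<=` D -> Ck_on k D F -> Ck_on k D' F.
Proof.
move=> sD; elim: k F => [|k IH] F /= => [cF z /sD /cF //|[dF pF]].
by split=> [z /sD /dF //|i]; exact: IH.
Qed.

Lemma Ck_onW W k D (F : 'rV[R]_m -> W) : Ck_on k.+1 D F -> Ck_on k D F.
Proof.
elim: k F => [|k IH] F [dF pF].
  by move=> z /dF; exact: differentiable_continuous.
by split=> // i; apply: IH; exact: pF.
Qed.

Lemma Ck_on_cst W k D (c : W) : Ck_on k D (fun=> c).
Proof.
elim: k c => [|k IH] c /=; first by move=> z _; exact: cst_continuous.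
split=> [z _|i]; first exact: differentiable_cst.
rewrite (_ : pd i _ = fun=> 0); first exact: IH.
by apply/funext => z; rewrite /pd derive_cst.
Qed.

Lemma pdD W (F G : 'rV[R]_m -> W) z i :
  differentiable F z -> differentiable G z ->
  pd i (fun w => F w + G w) z = pd i F z + pd i G z.
Proof. by move=> dF dG; apply: deriveD; exact: diff_derivable. Qed.

Lemma pdN W (F : 'rV[R]_m -> W) z i :
  differentiable F z -> pd i (fun w => - F w) z = - pd i F z.
Proof. by move=> dF; apply: deriveN; exact: diff_derivable. Qed.

Lemma pdB W (F G : 'rV[R]_m -> W) z i :
  differentiable F z -> differentiable G z ->
  pd i (fun w => F w - G w) z = pd i F z - pd i G z.
Proof. by move=> dF dG; apply: deriveB; exact: diff_derivable. Qed.

Lemma pdM (F G : 'rV[R]_m -> R^o) z i :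
  differentiable F z -> differentiable G z ->
  pd i (fun w => F w * G w : R^o) z = pd i F z * G z + F z * pd i G z.
Proof.
move=> dF dG; rewrite addrC [pd i F z * _]mulrC.
by apply: deriveM; exact: diff_derivable.
Qed.

Lemma pd_cst W (c : W) z i : pd i (fun=> c) z = 0.
Proof. exact: derive_cst. Qed.

Lemma pd_sum W n (F : 'I_n -> 'rV[R]_m -> W) z i :
  (forall j, differentiable (F j) z) ->
  pd i (fun w => \sum_j F j w) z = \sum_j pd i (F j) z.
Proof.
move=> dF; rewrite /pd -derive_sum; last by move=> j; exact: diff_derivable.
by congr (derive _ _ _); apply/funext => w; rewrite fct_sumE.
Qed.

Lemma diff_sum W n (F : 'I_n -> 'rV[R]_m -> W) z :
  (forall j, differentiable (F j) z) ->
  differentiable (fun w => \sum_j F j w) z.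
Proof.
move=> dF; have -> : (fun w => \sum_j F j w) = \sum_j F j.
  by apply/funext => w; rewrite fct_sumE.
exact: differentiable_sum.
Qed.

Lemma Ck_onD W k D (F G : 'rV[R]_m -> W) : open D ->
  Ck_on k D F -> Ck_on k D G -> Ck_on k D (fun w => F w + G w).
Proof.
move=> oD; elim: k F G => [|k IH] F G /=.
  by move=> cF cG z Dz; apply: continuousD; [exact: cF|exact: cG].
move=> [dF pF] [dG pG]; split=> [z Dz|i].
  by apply: differentiableD; [exact: dF|exact: dG].
apply: (@Ck_on_ext _ _ _ (fun w => pd i F w + pd i G w)) => // [w Dw|].
  by rewrite pdD; [|exact: dF|exact: dG].
exact: IH.
Qed.

Lemma Ck_onN W k D (F : 'rV[R]_m -> W) : open D ->
  Ck_on k D F -> Ck_on k D (fun w => - F w).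
Proof.
move=> oD; elim: k F => [|k IH] F /=.
  by move=> cF z Dz; apply: continuousN; exact: cF.
move=> [dF pF]; split=> [z Dz|i]; first by apply: differentiableN; exact: dF.
apply: (@Ck_on_ext _ _ _ (fun w => - pd i F w)) => // [w Dw|].
  by rewrite pdN; [|exact: dF].
exact: IH.
Qed.

Lemma Ck_onM k D (F G : 'rV[R]_m -> R^o) : open D ->
  Ck_on k D F -> Ck_on k D G -> Ck_on k D (fun w => F w * G w : R^o).
Proof.
move=> oD; elim: k F G => [|k IH] F G.
  by move=> cF cG z Dz; apply: continuousM; [exact: cF|exact: cG].
move=> CF CG; have [dF pF] := CF; have [dG pG] := CG.
split=> [z Dz|i]; first by apply: differentiableM; [exact: dF|exact: dG].
apply: (@Ck_on_ext _ _ _ (fun w => pd i F w * G w + F w * pd i G w : R^o)) => //.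
  by move=> w Dw; rewrite pdM; [|exact: dF|exact: dG].
apply: Ck_onD => //; apply: IH.
- exact: pF.
- exact: Ck_onW CG.
- exact: Ck_onW CF.
- exact: pG.
Qed.

Lemma diff_coord a b (F : 'rV[R]_m -> 'M[R]_(a, b)) z i j :
  differentiable F z -> differentiable (fun w => F w i j : R^o) z.
Proof.
move=> dF; apply: (@differentiable_comp _ _ _ _ F (fun N : 'M[R]_(a, b) => N i j : R^o)) => //.
exact: differentiable_coord.
Qed.

Lemma pd_coord a b (F : 'rV[R]_m -> 'M[R]_(a, b)) z i j k :
  differentiable F z -> pd k (fun w => F w i j : R^o) z = pd k F z i j.
Proof.
by move=> dF; rewrite /pd derive_mx ?mxE //; exact: diff_derivable.
Qed.

Lemma Ck_on_coord k a b D (F : 'rV[R]_m -> 'M[R]_(a, b)) i j : open D ->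
  Ck_on k D F -> Ck_on k D (fun w => F w i j : R^o).
Proof.
move=> oD; elim: k F => [|k IH] F /=.
  move=> cF z Dz.
  apply: (@continuous_comp _ _ _ F (fun N : 'M[R]_(a, b) => N i j : R^o)).
    exact: cF.
  exact: coord_continuous.
move=> [dF pF]; split=> [z Dz|l]; first exact/diff_coord/dF.
apply: (@Ck_on_ext _ _ _ (fun w => pd l F w i j : R^o)) => // [w Dw|].
  by rewrite pd_coord; [|exact: dF].
exact: IH.
Qed.

Lemma pd_var z (i j : 'I_m) :
  pd i (fun w : 'rV[R]_m => w 0 j : R^o) z = (i == j)%:R.
Proof.
rewrite (@pd_coord 1 m id); last by [].
by rewrite /pd derive_id mxE eqxx eq_sym.
Qed.

Lemma diff_var z (j : 'I_m) : differentiable (fun w : 'rV[R]_m => w 0 j : R^o) z.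
Proof. exact: differentiable_coord. Qed.

Lemma Ck_on_var k D (j : 'I_m) : open D ->
  Ck_on k D (fun w : 'rV[R]_m => w 0 j : R^o).
Proof.
move=> oD; case: k => [z _|k]; first exact: coord_continuous.
split=> [z _|i]; first exact: diff_var.
apply: (@Ck_on_ext _ _ _ (fun=> (i == j)%:R : R^o)) => // [w _|].
  by rewrite pd_var.
exact: Ck_on_cst.
Qed.

End PartialDerivatives.

Lemma continuous_ball (R : realType) (V W : normedModType R) (F : V -> W) z (e : R) :
  0 < e -> {for z, continuous F} ->
  exists2 r : R, 0 < r & forall w, `|z - w| < r -> `|F z - F w| < e.
Proof.
move=> e0 cF.
move/cvgrPdist_lt: cF => /(_ _ e0) /nbhs_ballP[r /= r0 rF].
by exists r => // w zw; apply: rF; rewrite -ball_normE.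
Qed.

Lemma continuous_bounded_near (R : realType) (V W : normedModType R) (F : V -> W) z :
  {for z, continuous F} ->
  exists2 C : R, 0 < C & \forall w \near z, `|F w| <= C.
Proof.
move=> cF; exists (`|F z| + 1); first by rewrite ltr_wpDl.
move/cvgrPdist_le: cF => /(_ _ ltr01); apply: filterS => w Fw.
rewrite -(subKr (F z) (F w)) (le_trans (ler_normB _ _)) // lerD2l //.
Qed.

(** * Symmetry of second derivatives *)

Section Schwarz.
Variables (R : realType) (m : nat).
Implicit Types (z : 'rV[R]_m) (f : 'rV[R]_m -> R^o).

Let e i : 'rV[R]_m := delta_mx 0 i.

(** Two mean value theorems: one for the increment of [f] in direction [j], as a function of the
    step in direction [i], then one for [pd i f] along direction [j]. *)
Lemma second_difference f z (i j : 'I_m) (t : R) :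
  (forall a b : R, 0 <= a <= 1 -> 0 <= b <= 1 ->
     let w := z + a *: (t *: e i) + b *: (t *: e j) in
     differentiable f w /\ differentiable (pd i f) w) ->
  exists a b : R, [/\ 0 <= a <= 1, 0 <= b <= 1 &
    f (z + t *: e i + t *: e j) - f (z + t *: e i) - f (z + t *: e j) + f z
     = t ^+ 2 * pd j (pd i f) (z + a *: (t *: e i) + b *: (t *: e j))].
Proof.
move=> df.
have I01 (a : R) : a \in `[0, 1] -> 0 <= a <= 1 by rewrite in_itv.
have I0 : 0 <= (0 : R) <= 1 by rewrite lexx ler01.
have I1 : 0 <= (1 : R) <= 1 by rewrite lexx ler01.
pose h (a : R) : R^o := f (z + t *: e j + a *: (t *: e i)) - f (z + a *: (t *: e i)).
have dh (a : R) : a \in `[0, 1] -> is_derive a 1 h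
    ('D_(t *: e i) f (z + t *: e j + a *: (t *: e i)) -
     'D_(t *: e i) f (z + a *: (t *: e i))).
  move=> /I01 a01; apply: is_deriveB; apply: is_derive_line; apply: diff_derivable.
    by have [] := df a 1 a01 I1; rewrite scale1r addrAC.
  by have [] := df a 0 a01 I0; rewrite scale0r addr0.
have [|a /I01 a01 Ea] := MVT_segment ler01 (fun a ha => dh a (subset_itv_oo_cc ha)).
  apply: derivable_within_continuous => a a01.
  exact: (@ex_derive _ _ _ _ _ _ _ (dh a a01)).
have [|b /subset_itv_oo_cc /I01 b01 Eb] :=
    @MVT_line R _ (pd i f) (z + a *: (t *: e i)) (t *: e j).
  by move=> b /I01 b01; apply: diff_derivable; have [] := df a b a01 b01.
exists a, b; split => //.
have Dt g w k : differentiable g w -> 'D_(t *: e k) g w = t * pd k g w.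
  by move=> dg; rewrite /pd !deriveE // linearZ.
have [da _] := df a 0 a01 I0; have [da1 _] := df a 1 a01 I1.
have [_ dab] := df a b a01 b01.
move: Ea; rewrite /h !scale1r !scale0r !addr0 subr0 mulr1.
rewrite !Dt; last 2 first.
- by move: da; rewrite scale0r addr0.
- by move: da1; rewrite scale1r addrAC.
rewrite -mulrBr [z + _ + a *: _]addrAC Eb Dt // [z + t *: e j + _]addrAC.
rewrite expr2 -mulrA => <-.
by rewrite opprB !addrA addrAC.
Qed.

(** The second difference is symmetric in [i] and [j], so the two mixed derivatives share a value
    taken at points arbitrarily close to [z]; continuity does the rest. *)
Lemma pd_swap f (D : set 'rV[R]_m) z i j : open D -> Ck_on 2 D f -> D z ->
  pd i (pd j f) z = pd j (pd i f) z.
Proof.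
move=> oD Cf Dz.
have [r0 r00 rD] := open_ball oD Dz.
have [df pf] := Cf.
have cA : {for z, continuous (pd i (pd j f))} by have [_ /(_ i) /(_ _ Dz)] := pf j.
have cB : {for z, continuous (pd j (pd i f))} by have [_ /(_ j) /(_ _ Dz)] := pf i.
apply/eqP; rewrite -subr_eq0 -normr_le0; apply/ler_addgt0Pr => eps eps0.
rewrite add0r.
have e20 : 0 < eps / 2 by rewrite divr_gt0.
have [r1 r10 rA] := continuous_ball e20 cA.
have [r2 r20 rB] := continuous_ball e20 cB.
pose r := Num.min r0 (Num.min r1 r2).
have rpos : 0 < r by rewrite !lt_min r00 r10 r20.
(* In the sup norm the intermediate points are at most 2t away from [z], hence within the radius
   3t. *)
have [t t0 tr] : exists2 t : R, 0 < t & t * 3 = r.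
  by exists (r / 3); rewrite ?divr_gt0 // mulfVK.
have ne k : `|e k| <= 1.
  rewrite [leLHS]/Num.Def.normr/= mx_normrE; apply/bigmax_le => //= -[x y] _.
  by rewrite mxE; case: (_ && _); rewrite ?normr1 ?normr0.
have near k l (a b : R) : 0 <= a <= 1 -> 0 <= b <= 1 ->
    `|z - (z + a *: (t *: e k) + b *: (t *: e l))| < r.
  move=> /andP[a0 a1] /andP[b0 b1].
  rewrite -!addrA opprD addNKr normrN.
  apply: le_lt_trans (ler_normD _ _) _; rewrite !normrZ (ger0_norm a0) (ger0_norm b0) (ger0_norm (ltW t0)).
  have H (c : R) q : 0 <= c -> c <= 1 -> c * (t * `|e q|) <= t.
    move=> c0 c1; rewrite -[leRHS]mul1r; apply: ler_pM => //.
      by rewrite mulr_ge0 // ltW.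
    by rewrite ger_pMr.
  have := H a k a0 a1; have := H b l b0 b1; move: rpos; rewrite -tr; lra.
have inD k l (a b : R) : 0 <= a <= 1 -> 0 <= b <= 1 ->
    D (z + a *: (t *: e k) + b *: (t *: e l)).
  move=> a01 b01; apply: rD; apply: lt_le_trans (near k l a b a01 b01) _.
  by rewrite ge_min lexx.
have [|a [b [a01 b01 Eab]]] := @second_difference f z i j t.
  by move=> a b a01 b01 w; split; [apply: df | have [] := pf i];
     [|move=> + _; apply]; exact: inD.
have [|c [d [c01 d01 Ecd]]] := @second_difference f z j i t.
  by move=> a' b' a01' b01' w; split; [apply: df | have [] := pf j];
     [|move=> + _; apply]; exact: inD.
have EE : pd j (pd i f) (z + a *: (t *: e i) + b *: (t *: e j)) =
          pd i (pd j f) (z + c *: (t *: e j) + d *: (t *: e i)).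
  apply: (@mulfI _ (t ^+ 2)); first by rewrite expf_neq0 // gt_eqF.
  apply: etrans (esym Eab) (etrans _ Ecd).
  rewrite (addrAC z (t *: e j)); congr (_ + _); exact: addrAC.
have h1 : `|pd j (pd i f) z - pd j (pd i f) (z + a *: (t *: e i) + b *: (t *: e j))| < eps / 2.
  apply: rB; apply: lt_le_trans (near i j a b a01 b01) _.
  by rewrite !ge_min lexx !orbT.
have h2 : `|pd i (pd j f) z - pd i (pd j f) (z + c *: (t *: e j) + d *: (t *: e i))| < eps / 2.
  apply: rA; apply: lt_le_trans (near j i c d c01 d01) _.
  by rewrite !ge_min lexx !orbT.
rewrite EE in h1.
apply: le_trans (ler_distD (pd i (pd j f) (z + c *: (t *: e j) + d *: (t *: e i))) _ _) _.
rewrite [leRHS]splitr.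
apply: lerD; first exact: ltW h2.
by rewrite distrC; exact: ltW h1.
Qed.

End Schwarz.

(** * Functions that are Lipschitz near a point *)

Section LocallyLipschitz.
Variables (R : realType) (V : normedModType R).
Implicit Types (W : normedModType R) (z : V).

(** A pointwise variant of [locally_lipschitz] without a domain, so that it propagates through
    formulas; [chart_extension] makes the way back. *)
Definition lipschitz_at W (F : V -> W) z := exists2 B, nbhs z B &
  exists2 k : R, 0 <= k & forall a b, B a -> B b -> `|F a - F b| <= k * `|a - b|.

Lemma lipschitz_at_continuous W (F : V -> W) z :
  lipschitz_at F z -> {for z, continuous F}.
Proof.
move=> [B nB [k k0 kB]]; apply/cvgrPdist_le => /= e e0.
have k10 : 0 < k + 1 by rewrite ltr_wpDl.
have [r /= r0 rB] := (nbhs_ballP _ _).1 nB.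
apply/nbhs_ballP; exists (Num.min r (e / (k + 1))) => /=.
  by rewrite lt_min r0 divr_gt0.
move=> w; rewrite -ball_normE /= lt_min => /andP[zw].
rewrite ltr_pdivlMr // => zwe.
apply: le_trans (kB z w _ _) _; first exact: nbhs_singleton.
  by apply: rB; rewrite -ball_normE.
apply: le_trans (ltW zwe); rewrite mulrC ler_wpM2l //; lra.
Qed.

Lemma lipschitz_at_cst W (c : W) z : lipschitz_at (fun=> c) z.
Proof.
exists setT; first exact: filterT.
by exists 0 => // a b _ _; rewrite subrr normr0 mul0r.
Qed.

Lemma lipschitz_atD W (F G : V -> W) z :
  lipschitz_at F z -> lipschitz_at G z -> lipschitz_at (fun w => F w + G w) z.
Proof.
move=> [A nA [k k0 kA]] [B nB [k' k'0 kB]].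
exists (A `&` B); first exact: filterI.
exists (k + k'); first exact: addr_ge0.
move=> a b [Aa Ba] [Ab Bb]; rewrite opprD addrACA mulrDl.
by rewrite (le_trans (ler_normD _ _)) // lerD ?kA ?kB.
Qed.

Lemma lipschitz_atN W (F : V -> W) z :
  lipschitz_at F z -> lipschitz_at (fun w => - F w) z.
Proof.
move=> [A nA [k k0 kA]]; exists A => //; exists k => // a b Aa Ab.
by rewrite -opprD normrN kA.
Qed.

Lemma lipschitz_atB W (F G : V -> W) z :
  lipschitz_at F z -> lipschitz_at G z -> lipschitz_at (fun w => F w - G w) z.
Proof. by move=> lF lG; apply: lipschitz_atD => //; exact: lipschitz_atN. Qed.

Lemma lipschitz_atZ W (f : V -> R^o) (F : V -> W) z :
  lipschitz_at f z -> lipschitz_at F z -> lipschitz_at (fun w => f w *: F w) z.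
Proof.
move=> lf lF.
have [C C0 Cf] := continuous_bounded_near (lipschitz_at_continuous lf).
have [C' C0' CF] := continuous_bounded_near (lipschitz_at_continuous lF).
move: lf lF => [A nA [k k0 kA]] [B nB [k' k'0 kB]].
exists (A `&` B `&` [set w | `|f w| <= C] `&` [set w | `|F w| <= C']).
  by apply: filterI => //; apply: filterI => //; exact: filterI.
exists (C * k' + k * C'); first by rewrite addr_ge0 // mulr_ge0 // ltW.
move=> a b [[[Aa Ba] /= fa] Fa] [[[Ab Bb] fb] /= Fb].
have -> : f a *: F a - f b *: F b = f a *: (F a - F b) + (f a - f b) *: F b.
  by rewrite scalerBr scalerBl addrA subrK.
apply: le_trans (ler_normD _ _) _; rewrite !normrZ mulrDl; apply: lerD.
  by rewrite -mulrA; apply: ler_pM => //; exact: kB.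
by rewrite mulrAC; apply: ler_pM => //; exact: kA.
Qed.

Lemma lipschitz_atM (f g : V -> R^o) z :
  lipschitz_at f z -> lipschitz_at g z -> lipschitz_at (fun w => f w * g w : R^o) z.
Proof. exact: lipschitz_atZ. Qed.

Lemma lipschitz_atV (f : V -> R^o) z : f z != 0 ->
  lipschitz_at f z -> lipschitz_at (fun w => (f w)^-1 : R^o) z.
Proof.
move=> fz0 lf; have cf := lipschitz_at_continuous lf.
have c0 : 0 < `|f z| / 2 by rewrite divr_gt0 // normr_gt0.
have nf : \forall w \near z, `|f z| / 2 <= `|f w|.
  move/cvgrPdist_le: cf => /(_ _ c0); apply: filterS => w fw.
  move: (le_trans (lerB_dist (f z) (f w)) fw).
  by move: (`|f z|) (`|f w|) => x y; lra.
move: lf => [A nA [k k0 kA]].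
exists (A `&` [set w | `|f z| / 2 <= `|f w|]); first exact: filterI.
exists ((`|f z| / 2) ^- 2 * k).
  by rewrite mulr_ge0 // invr_ge0 exprn_ge0 // ltW.
move=> a b [Aa /= na] [Ab /= nb].
have a0 : f a != 0 by rewrite -normr_gt0; exact: lt_le_trans na.
have b0 : f b != 0 by rewrite -normr_gt0; exact: lt_le_trans nb.
have -> : (f a)^-1 - (f b)^-1 = (f a * f b)^-1 * (f b - f a).
  by rewrite mulrBr invfM mulfVK // mulrAC mulVf // mul1r.
rewrite normrM normfV normrM -mulrA; apply: ler_pM.
- by rewrite invr_ge0 mulr_ge0.
- exact: normr_ge0.
- rewrite lef_pV2 ?posrE ?mulr_gt0 ?exprn_gt0 ?normr_gt0 // expr2.
  by apply: ler_pM => //; exact: ltW.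
- by rewrite distrC; exact: kA.
Qed.

Lemma lipschitz_at_sum W n (F : 'I_n -> V -> W) z :
  (forall j, lipschitz_at (F j) z) -> lipschitz_at (fun w => \sum_j F j w) z.
Proof.
elim: n F => [|n IH] F lF.
  rewrite (_ : (fun _ => _) = fun=> 0); first exact: lipschitz_at_cst.
  by apply/funext => w; rewrite big_ord0.
rewrite (_ : (fun _ => _) = fun w => F ord0 w + \sum_j F (lift ord0 j) w).
  by apply: lipschitz_atD => //; exact: IH.
by apply/funext => w; rewrite big_ord_recl.
Qed.

Lemma lipschitz_at_coord a b (F : V -> 'M[R]_(a, b)) z i j :
  lipschitz_at F z -> lipschitz_at (fun w => F w i j : R^o) z.
Proof.
move=> [A nA [k k0 kA]]; exists A => //; exists k => // w w' Aw Aw'.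
apply: le_trans (kA w w' Aw Aw').
by have := normr_coord_le (F w - F w') i j; rewrite !mxE.
Qed.

(** The matrix norm is the maximum over finitely many entries: intersect their neighbourhoods and
    take the largest constant. *)
Lemma lipschitz_at_mx a b (F : V -> 'M[R]_(a, b)) z :
  (forall i j, lipschitz_at (fun w => F w i j : R^o) z) -> lipschitz_at F z.
Proof.
move=> lF.
have H (ij : 'I_a * 'I_b) : exists K : set V * R, [/\ nbhs z K.1, 0 <= K.2 &
    forall w w', K.1 w -> K.1 w' ->
      `|F w ij.1 ij.2 - F w' ij.1 ij.2| <= K.2 * `|w - w'|].
  by have [A nA [k k0 kA]] := lF ij.1 ij.2; exists (A, k).
have [K KP] := choice H.
pose k := \big[Num.max/0]_ij (K ij).2.
have nK : \forall w \near z, forall ij, (K ij).1 w.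
  by apply: filter_forall => ij; have [] := KP ij.
exists [set w | forall ij, (K ij).1 w] => //.
have k0 : 0 <= k.
  by rewrite /k; elim/big_ind: _ => // [x y x0 y0|ij _];
    [rewrite le_max x0|have [] := KP ij].
exists k => // w w' Kw Kw'.
rewrite [leLHS]/Num.Def.normr/= mx_normrE; apply/bigmax_le; first exact: mulr_ge0.
move=> ij _; rewrite !mxE; have [_ _ Kij] := KP ij.
apply: le_trans (Kij w w' (Kw ij) (Kw' ij)) _.
by apply: ler_wpM2r => //; exact: (le_bigmax _ (fun ij => (K ij).2) ij).
Qed.

End LocallyLipschitz.

Lemma lipschitz_at_comp (R : realType) (V V' W : normedModType R)
    (F : V -> V') (G : V' -> W) z :
  lipschitz_at F z -> lipschitz_at G (F z) -> lipschitz_at (fun w => G (F w)) z.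
Proof.
move=> lF [B nB [k' k'0 kB]]; have cF := lipschitz_at_continuous lF.
move: lF => [A nA [k k0 kA]].
exists (A `&` (F @^-1` B)); first by apply: filterI => //; exact: cF nB.
exists (k' * k); first exact: mulr_ge0.
move=> a b [Aa Ba] [Ab Bb]; apply: le_trans (kB _ _ Ba Bb) _.
by rewrite -mulrA; apply: ler_wpM2l => //; exact: kA.
Qed.

Lemma C1_lipschitz (R : realType) m (F : 'rV[R]_m -> R^o) (D : set 'rV[R]_m) z :
  open D -> D z -> Ck_on 1 D F -> lipschitz_at F z.
Proof.
move=> oD Dz [dF cF].
have [r0 r00 rD] := open_ball oD Dz.
have H (i : 'I_m) : exists r : R, 0 < r /\
    forall w, `|z - w| < r -> `|pd i F w| <= `|pd i F z| + 1.
  have [r r1 rF] := continuous_ball ltr01 (cF i z Dz).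
  exists r; split=> // w /rF Fw.
  rewrite -(subKr (pd i F z) (pd i F w)) (le_trans (ler_normB _ _)) // lerD2l //.
  exact: ltW.
have [r rP] := choice H.
(* One bound and one radius that serve all partial derivatives, so that [mvi_ball] applies on a
   single ball. *)
pose C := \big[Num.max/0]_i (`|pd i F z| + 1).
pose rho := \big[Num.min/r0]_i r i.
have rho0 : 0 < rho.
  rewrite /rho; elim/big_ind: _ => // [x y x0 y0|i _]; first by rewrite lt_min x0.
  by have [] := rP i.
have C0 : 0 <= C.
  rewrite /C; elim/big_ind: _ => // x y x0 y0; by rewrite le_max x0.
exists (ball z rho); first exact: nbhsx_ballx.
exists (m%:R * C); first exact: mulr_ge0.
move=> a b; rewrite -ball_normE /= => za zb.
apply: (@mvi_ball _ _ F z b a rho C) => // w zw.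
  apply: dF; apply: rD; apply: lt_le_trans zw _; exact: bigmin_le_id.
move=> i; have [_ /(_ w)] := rP i.
move=> /(_ (lt_le_trans zw (bigmin_le _ _ _))) h.
exact: le_trans h (le_bigmax _ (fun i => `|pd i F z| + 1) i).
Qed.

Local Open Scope complex_scope.

(** * Wirtinger derivatives *)

Section WirtingerRing.
Variables (K : comNzRingType) (h i f g a0 a1 b0 b1 c : K).

Lemma wirtingerD : h * (a0 + b0 + i * (a1 + b1)) =
  h * (a0 + i * a1) + h * (b0 + i * b1).
Proof. ring. Qed.

Lemma wirtingerDN : h * (a0 + b0 - i * (a1 + b1)) =
  h * (a0 - i * a1) + h * (b0 - i * b1).
Proof. ring. Qed.

Lemma wirtingerM : h * (a0 * g + f * b0 + i * (a1 * g + f * b1)) =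
  h * (a0 + i * a1) * g + f * (h * (b0 + i * b1)).
Proof. ring. Qed.

Lemma wirtingerMN : h * (a0 * g + f * b0 - i * (a1 * g + f * b1)) =
  h * (a0 - i * a1) * g + f * (h * (b0 - i * b1)).
Proof. ring. Qed.

(** [c] stands for both mixed second derivatives, which [pd_swap] identifies; nothing else is behind
    the commutation of dz and dzbar. *)
Lemma wirtinger_comm :
  h * (h * (a0 - i * c) + i * (h * (c - i * b1))) =
  h * (h * (a0 + i * c) - i * (h * (c + i * b1))).
Proof. ring. Qed.

End WirtingerRing.

Section ComplexCalculus.
Variable R : realType.
Implicit Types (F G : 'rV[R]_2 -> R[i]) (z : 'rV[R]_2) (D : set 'rV[R]_2).
Local Notation Re := (@complex.Re R).
Local Notation Im := (@complex.Im R).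
Local Notation ReF F := (fun w => Re (F w) : R^o).
Local Notation ImF F := (fun w => Im (F w) : R^o).

Lemma cReD (x y : R[i]) : Re (x + y) = Re x + Re y. Proof. by case: x; case: y. Qed.
Lemma cImD (x y : R[i]) : Im (x + y) = Im x + Im y. Proof. by case: x; case: y. Qed.
Lemma cReN (x : R[i]) : Re (- x) = - Re x. Proof. by case: x. Qed.
Lemma cImN (x : R[i]) : Im (- x) = - Im x. Proof. by case: x. Qed.
Lemma cReM (x y : R[i]) : Re (x * y) = Re x * Re y - Im x * Im y.
Proof. by case: x; case: y. Qed.
Lemma cImM (x y : R[i]) : Im (x * y) = Re x * Im y + Im x * Re y.
Proof. by case: x; case: y. Qed.

Lemma cReJ (x : R[i]) : Re (conjc x) = Re x. Proof. by case: x. Qed.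
Lemma cImJ (x : R[i]) : Im (conjc x) = - Im x. Proof. by case: x. Qed.

Lemma conjcM (x y : R[i]) : conjc (x * y) = conjc x * conjc y. Proof. exact: rmorphM. Qed.
Lemma conjcD (x y : R[i]) : conjc (x + y) = conjc x + conjc y. Proof. exact: rmorphD. Qed.

(** Regularity of complex functions is that of their real and imaginary parts, in accordance with
    [pdC], so that the real calculus applies to each part. *)
Definition cdiff F z := differentiable (ReF F) z /\ differentiable (ImF F) z.
Definition csmooth D F := smooth_on D (ReF F) /\ smooth_on D (ImF F).

Lemma csmooth_diff D F z : D z -> csmooth D F -> cdiff F z.
Proof. by move=> Dz [sR sI]; split; [have [+ _] := sR 1%N|have [+ _] := sI 1%N]; apply. Qed.

Lemma cdiffD F G z : cdiff F z -> cdiff G z -> cdiff (fun w => F w + G w) z.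
Proof.
move=> [aF bF] [aG bG]; split.
  by under eq_fun do rewrite cReD; exact: differentiableD.
by under eq_fun do rewrite cImD; exact: differentiableD.
Qed.

Lemma cdiffM F G z : cdiff F z -> cdiff G z -> cdiff (fun w => F w * G w) z.
Proof.
move=> [aF bF] [aG bG]; split.
  by under eq_fun do rewrite cReM; apply: differentiableB; exact: differentiableM.
by under eq_fun do rewrite cImM; apply: differentiableD; exact: differentiableM.
Qed.

Lemma cdiff_cst (c : R[i]) z : cdiff (fun=> c) z.
Proof. by split; exact: differentiable_cst. Qed.

Lemma pdC_D i F G z : cdiff F z -> cdiff G z ->
  pdC i (fun w => F w + G w) z = pdC i F z + pdC i G z.
Proof.
move=> [aF bF] [aG bG]; rewrite /pdC.
under [X in pd _ X]eq_fun do rewrite cReD.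
under [X in _ +i* pd _ X _]eq_fun do rewrite cImD.
by rewrite (pdD _ aF aG) (pdD _ bF bG).
Qed.

Lemma pdC_M i F G z : cdiff F z -> cdiff G z ->
  pdC i (fun w => F w * G w) z = pdC i F z * G z + F z * pdC i G z.
Proof.
move=> [aF bF] [aG bG]; rewrite /pdC.
under [X in pd _ X]eq_fun do rewrite cReM.
under [X in _ +i* pd _ X _]eq_fun do rewrite cImM.
rewrite pdB; [|exact: differentiableM..].
rewrite pdD; [|exact: differentiableM..].
rewrite (pdM _ aF aG) (pdM _ bF bG) (pdM _ aF bG) (pdM _ bF aG).
by apply/eqP; rewrite eq_complex !cReD !cImD !cReM !cImM /=; apply/andP; split; apply/eqP; ring.
Qed.

Lemma pdC_cst i (c : R[i]) z : pdC i (fun=> c) z = 0.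
Proof. by rewrite /pdC !pd_cst. Qed.

Lemma pdC_comb i (b c : R[i]) F G z : cdiff F z -> cdiff G z ->
  pdC i (fun w => b * (F w + c * G w)) z = b * (pdC i F z + c * pdC i G z).
Proof.
move=> dF dG; have dcG := cdiffM (cdiff_cst c z) dG.
rewrite (pdC_M i (cdiff_cst b z) (cdiffD dF dcG)) pdC_cst mul0r add0r.
by rewrite (pdC_D i dF dcG) (pdC_M i (cdiff_cst c z) dG) pdC_cst mul0r add0r.
Qed.

Lemma pdC_on D F G i z : open D -> (forall w, D w -> F w = G w) -> D z ->
  pdC i F z = pdC i G z.
Proof.
move=> oD FG Dz; rewrite /pdC; congr (_ +i* _);
  by apply: (@pd_on _ _ _ D) => // w Dw; rewrite FG.
Qed.

Lemma dz_on D F G z : open D -> (forall w, D w -> F w = G w) -> D z ->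
  dz F z = dz G z.
Proof. by move=> oD FG Dz; rewrite /dz !(pdC_on _ oD FG Dz). Qed.

Lemma dzbar_on D F G z : open D -> (forall w, D w -> F w = G w) -> D z ->
  dzbar F z = dzbar G z.
Proof. by move=> oD FG Dz; rewrite /dzbar !(pdC_on _ oD FG Dz). Qed.

Lemma iter_dz_on D F G k z : open D -> (forall w, D w -> F w = G w) -> D z ->
  iter k (@dz R) F z = iter k (@dz R) G z.
Proof.
by move=> oD FG; elim: k z => [|k IH] z Dz /=; [exact: FG|exact: (dz_on oD IH)].
Qed.

Lemma dzD F G z : cdiff F z -> cdiff G z ->
  dz (fun w => F w + G w) z = dz F z + dz G z.
Proof. by move=> dF dG; rewrite /dz !pdC_D //; exact: wirtingerDN. Qed.

Lemma dzbarD F G z : cdiff F z -> cdiff G z ->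
  dzbar (fun w => F w + G w) z = dzbar F z + dzbar G z.
Proof. by move=> dF dG; rewrite /dzbar !pdC_D //; exact: wirtingerD. Qed.

Lemma dzM F G z : cdiff F z -> cdiff G z ->
  dz (fun w => F w * G w) z = dz F z * G z + F z * dz G z.
Proof. by move=> dF dG; rewrite /dz !pdC_M //; exact: wirtingerMN. Qed.

Lemma dzbarM F G z : cdiff F z -> cdiff G z ->
  dzbar (fun w => F w * G w) z = dzbar F z * G z + F z * dzbar G z.
Proof. by move=> dF dG; rewrite /dzbar !pdC_M //; exact: wirtingerM. Qed.

Lemma dz_cst (c : R[i]) z : dz (fun=> c) z = 0.
Proof. by rewrite /dz !pdC_cst mulr0 subr0 mulr0. Qed.

Lemma dzbar_cst (c : R[i]) z : dzbar (fun=> c) z = 0.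
Proof. by rewrite /dzbar !pdC_cst mulr0 addr0 mulr0. Qed.

Lemma dzZ (c : R[i]) F z : cdiff F z -> dz (fun w => c * F w) z = c * dz F z.
Proof. by move=> dF; rewrite dzM ?dz_cst ?mul0r ?add0r //; exact: cdiff_cst. Qed.

Lemma dzbarZ (c : R[i]) F z : cdiff F z -> dzbar (fun w => c * F w) z = c * dzbar F z.
Proof. by move=> dF; rewrite dzbarM ?dzbar_cst ?mul0r ?add0r //; exact: cdiff_cst. Qed.

Lemma csmooth_ext D F G : open D -> (forall w, D w -> F w = G w) ->
  csmooth D F -> csmooth D G.
Proof.
by move=> oD FG [sR sI]; split=> k; [have := sR k|have := sI k];
  apply: Ck_on_ext => // w Dw; rewrite FG.
Qed.

Lemma csmooth_cst D (c : R[i]) : csmooth D (fun=> c).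
Proof. by split=> k; exact: Ck_on_cst. Qed.

Lemma csmoothD D F G : open D -> csmooth D F -> csmooth D G ->
  csmooth D (fun w => F w + G w).
Proof.
move=> oD [aF bF] [aG bG]; split=> k.
  by under eq_fun do rewrite cReD; exact: Ck_onD.
by under eq_fun do rewrite cImD; exact: Ck_onD.
Qed.

Lemma csmoothM D F G : open D -> csmooth D F -> csmooth D G ->
  csmooth D (fun w => F w * G w).
Proof.
move=> oD [aF bF] [aG bG]; split=> k.
  under eq_fun do rewrite cReM.
  by apply: Ck_onD => //; [exact: Ck_onM|apply: Ck_onN => //; exact: Ck_onM].
by under eq_fun do rewrite cImM; apply: Ck_onD => //; exact: Ck_onM.
Qed.

Lemma csmoothN D F : open D -> csmooth D F -> csmooth D (fun w => - F w).
Proof.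
move=> oD [aF bF]; split=> k.
  by under eq_fun do rewrite cReN; exact: Ck_onN.
by under eq_fun do rewrite cImN; exact: Ck_onN.
Qed.

Lemma csmooth_real D (f : 'rV[R]_2 -> R^o) : smooth_on D f ->
  csmooth D (fun w => (f w)%:C).
Proof. by move=> sf; split => // k; exact: Ck_on_cst. Qed.

Lemma csmooth_pdC D F i : csmooth D F -> csmooth D (pdC i F).
Proof. by move=> [aF bF]; split=> k; [have [_] := aF k.+1|have [_] := bF k.+1]; apply. Qed.

Lemma csmooth_dz D F : open D -> csmooth D F -> csmooth D (dz F).
Proof.
move=> oD sF; apply: csmoothM => //; first exact: csmooth_cst.
apply: csmoothD => //; first exact: csmooth_pdC.
apply: csmoothN => //; apply: csmoothM => //; first exact: csmooth_cst.
exact: csmooth_pdC.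
Qed.

Lemma csmooth_dzbar D F : open D -> csmooth D F -> csmooth D (dzbar F).
Proof.
move=> oD sF; apply: csmoothM => //; first exact: csmooth_cst.
apply: csmoothD => //; first exact: csmooth_pdC.
by apply: csmoothM => //; [exact: csmooth_cst|exact: csmooth_pdC].
Qed.

Lemma csmooth_iter_dz D F k : open D -> csmooth D F -> csmooth D (iter k (@dz R) F).
Proof. by move=> oD sF; elim: k => //= k IH; exact: csmooth_dz. Qed.

Lemma dz_dzbar D F z : open D -> D z -> csmooth D F ->
  dzbar (dz F) z = dz (dzbar F) z.
Proof.
move=> oD Dz sF.
have s0 := csmooth_pdC 0 sF; have s1 := csmooth_pdC 1 sF.
have d0 := csmooth_diff Dz s0; have d1 := csmooth_diff Dz s1.
have dc c := cdiff_cst c z.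
have swap : pdC 0 (pdC 1 F) z = pdC 1 (pdC 0 F) z.
  have e k j : pdC k (pdC j F) z =
    pd k (pd j (ReF F)) z +i* pd k (pd j (ImF F)) z by [].
  case: sF => aF bF; rewrite !e.
  by rewrite (pd_swap 0 1 oD (aF 2%N) Dz) (pd_swap 0 1 oD (bF 2%N) Dz).
have E k : pdC k (dz F) z = 2^-1 * (pdC k (pdC 0 F) z - 'i%C * pdC k (pdC 1 F) z).
  have -> : dz F = fun w => 2^-1 * (pdC 0 F w + (- 'i%C) * pdC 1 F w).
    by apply/funext => w; rewrite mulNr.
  by rewrite (pdC_comb _ _ _ d0 d1) mulNr.
have E' k : pdC k (dzbar F) z = 2^-1 * (pdC k (pdC 0 F) z + 'i%C * pdC k (pdC 1 F) z).
  exact: (@pdC_comb k 2^-1 'i%C (pdC 0 F) (pdC 1 F) z d0 d1).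
rewrite {1}/dzbar [RHS]/dz !E !E' swap; exact: wirtinger_comm.
Qed.

Lemma csmooth_toC D : open D -> csmooth D (@toC R).
Proof. by move=> oD; split=> k; exact: Ck_on_var. Qed.

Lemma cdiff_toC z : cdiff (@toC R) z.
Proof. by split; exact: diff_var. Qed.

Lemma pdC_toC i z : pdC i (@toC R) z = (i == 0)%:R +i* (i == 1)%:R.
Proof. by rewrite /pdC !pd_var. Qed.

Lemma dz_toC z : dz (@toC R) z = 1.
Proof.
rewrite /dz !pdC_toC.
have -> : ((0 == 0 :> 'I_2)%:R +i* (0 == 1 :> 'I_2)%:R) -
          'i%C * ((1 == 0 :> 'I_2)%:R +i* (1 == 1 :> 'I_2)%:R) = 2 :> R[i].
  by apply/eqP; rewrite eq_complex /=; apply/andP; split; apply/eqP; ring.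
by rewrite mulVf // pnatr_eq0.
Qed.

Lemma dzbar_toC z : dzbar (@toC R) z = 0.
Proof.
rewrite /dzbar !pdC_toC.
have -> : ((0 == 0 :> 'I_2)%:R +i* (0 == 1 :> 'I_2)%:R) +
          'i%C * ((1 == 0 :> 'I_2)%:R +i* (1 == 1 :> 'I_2)%:R) = 0 :> R[i].
  by apply/eqP; rewrite eq_complex /=; apply/andP; split; apply/eqP; ring.
by rewrite mulr0.
Qed.

Lemma cdiff_toCX s z : cdiff (fun w => toC w ^+ s) z.
Proof.
elim: s => [|s IH]; first exact: cdiff_cst.
by under eq_fun do rewrite exprS; apply: cdiffM => //; exact: cdiff_toC.
Qed.

Lemma csmooth_toCX D s : open D -> csmooth D (fun w => toC w ^+ s).
Proof.
move=> oD; elim: s => [|s IH]; first exact: csmooth_cst.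
by under eq_fun do rewrite exprS; apply: csmoothM => //; exact: csmooth_toC.
Qed.

Lemma dz_toCX s z : dz (fun w => toC w ^+ s) z = s%:R * toC z ^+ s.-1.
Proof.
elim: s => [|s IH]; first by rewrite dz_cst mul0r.
under [X in dz X]eq_fun do rewrite exprS.
rewrite dzM; [|exact: cdiff_toC|exact: cdiff_toCX].
rewrite dz_toC IH mul1r mulrCA -natr1 mulrDl mul1r addrC; congr (_ + _).
by case: s {IH} => [|s]; rewrite ?mul0r //= -exprS.
Qed.

Lemma dzbar_toCX s z : dzbar (fun w => toC w ^+ s) z = 0.
Proof.
elim: s => [|s IH]; first by rewrite dzbar_cst.
under [X in dzbar X]eq_fun do rewrite exprS.
rewrite dzbarM; [|exact: cdiff_toC|exact: cdiff_toCX].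
by rewrite dzbar_toC IH mulr0 mul0r addr0.
Qed.

Lemma cdiff_conj F z : cdiff F z -> cdiff (fun w => conjc (F w)) z.
Proof.
move=> [aF bF]; split.
  by under eq_fun do rewrite cReJ.
by under eq_fun do rewrite cImJ; exact: differentiableN.
Qed.

Lemma csmooth_conj D F : open D -> csmooth D F -> csmooth D (fun w => conjc (F w)).
Proof.
move=> oD [aF bF]; split=> k.
  by under eq_fun do rewrite cReJ.
by under eq_fun do rewrite cImJ; exact: Ck_onN.
Qed.

Lemma pdC_conj i F z : cdiff F z -> pdC i (fun w => conjc (F w)) z = conjc (pdC i F z).
Proof.
move=> [aF bF]; rewrite /pdC /=; congr (_ +i* _).
  by congr (pd i _ z); apply/funext => w; case: (F w).
rewrite -pdN //; congr (pd i _ z); apply/funext => w; by case: (F w).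
Qed.

Lemma dz_conj F z : cdiff F z -> dz (fun w => conjc (F w)) z = conjc (dzbar F z).
Proof.
move=> dF; rewrite /dz !pdC_conj //.
have -> : conjc (dzbar F z) = conjc 2^-1 * (conjc (pdC 0 F z) + conjc 'i%C * conjc (pdC 1 F z)).
  by rewrite -conjcM -conjcD -conjcM.
rewrite conjc_inv conjc_nat; congr (_ * (_ + _)); rewrite -mulNr; congr (_ * _).
by apply/eqP; rewrite eq_complex /= oppr0 !eqxx.
Qed.

End ComplexCalculus.

(** * Modulus of complex numbers and sup norm of the plane *)

Section Modulus.
Variable R : realType.
Implicit Types (x y : R[i]) (z : 'rV[R]_2).
Local Notation Re := (@complex.Re R).
Local Notation Im := (@complex.Im R).

Lemma modC_ge0 x : 0 <= modC x.
Proof. by case: x => a b; exact: sqrtr_ge0. Qed.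

Lemma modC_Re x : `|Re x| <= modC x.
Proof.
case: x => a b /=; rewrite -sqrtr_sqr ler_sqrt ?addr_ge0 ?sqr_ge0 //.
by rewrite lerDl sqr_ge0.
Qed.

Lemma modC_Im x : `|Im x| <= modC x.
Proof.
case: x => a b /=; rewrite -sqrtr_sqr ler_sqrt ?addr_ge0 ?sqr_ge0 //.
by rewrite lerDr sqr_ge0.
Qed.

Lemma modC_le x : modC x <= `|Re x| + `|Im x|.
Proof.
case: x => a b /=; rewrite -[leRHS]ger0_norm ?addr_ge0 // -sqrtr_sqr.
rewrite ler_sqrt ?sqr_ge0 // sqrrD !real_normK ?num_real //.
by rewrite addrAC lerDl mulrn_wge0 // mulr_ge0.
Qed.

Lemma modCM x y : modC (x * y) = modC x * modC y.
Proof. exact: ComplexField.Normc.normcM. Qed.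

Lemma modCV x : modC x^-1 = (modC x)^-1.
Proof. exact: ComplexField.Normc.normcV. Qed.

Lemma modC0 : modC (0 : R[i]) = 0.
Proof. exact: ComplexField.Normc.normc0. Qed.

Lemma modC1 : modC (1 : R[i]) = 1.
Proof. exact: ComplexField.Normc.normc1. Qed.

Lemma modC_eq0 x : (modC x == 0) = (x == 0).
Proof.
apply/eqP/eqP => [/ComplexField.Normc.eq0_normc //|->]; exact: modC0.
Qed.

Lemma modC_gt0 x : (0 < modC x) = (x != 0).
Proof. by rewrite lt_neqAle modC_ge0 andbT eq_sym modC_eq0. Qed.

Lemma modCD x y : modC (x + y) <= modC x + modC y.
Proof. exact: le_normcD. Qed.

Lemma modCN x : modC (- x) = modC x.
Proof. exact: normcN. Qed.

Lemma modCX x k : modC (x ^+ k) = modC x ^+ k.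
Proof. by elim: k => [|k IH]; rewrite ?modC1 // !exprS modCM IH. Qed.

Lemma modC_conj x : modC (conjc x) = modC x.
Proof. by case: x => a b; rewrite /modC /= sqrrN. Qed.

Lemma modC_sqr x : modC x ^+ 2 = Re x ^+ 2 + Im x ^+ 2.
Proof. by case: x => a b; rewrite sqr_sqrtr // addr_ge0 ?sqr_ge0. Qed.

Lemma ord2 (j : 'I_2) : j = 0 \/ j = 1.
Proof. by case: j => -[|[|//]] ?; [left|right]; exact: val_inj. Qed.

(** Neighbourhoods are measured in the sup norm, powers of z by the modulus. This lemma and
    [modC_normr] translate, at the cost of the factors 2 seen below. *)
Lemma normr_modC z : `|z| <= modC (toC z).
Proof.
rewrite [leLHS]/Num.Def.normr/= mx_normrE; apply/bigmax_le.
  exact: sqrtr_ge0.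
move=> [i j] _ /=; rewrite ord1; case: (ord2 j) => ->.
  exact: (modC_Re (toC z)).
exact: (modC_Im (toC z)).
Qed.

Lemma modC_normr z : modC (toC z) <= 2 * `|z|.
Proof.
apply: le_trans (modC_le _) _; rewrite mulr_natl mulr2n lerD //; exact: normr_coord_le.
Qed.

Lemma toC_eq0 z : (toC z == 0) = (z == 0).
Proof.
apply/idP/idP => [|/eqP ->]; last by rewrite /toC !mxE.
rewrite -modC_eq0 => /eqP z0.
by rewrite -normr_le0 -z0; exact: normr_modC.
Qed.

(** By induction from x^(k+1) - y^(k+1) = x (x^k - y^k) + (x - y) y^k. For k = 0 the truncated
    exponent is harmless, its coefficient being 0. *)
Lemma modC_subX x y M k : modC x <= M -> modC y <= M ->
  modC (x ^+ k - y ^+ k) <= k%:R * M ^+ k.-1 * modC (x - y).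
Proof.
move=> xM yM; have M0 : 0 <= M := le_trans (modC_ge0 x) xM.
elim: k => [|k IH]; first by rewrite subrr modC0 !mul0r.
have -> : x ^+ k.+1 - y ^+ k.+1 = x * (x ^+ k - y ^+ k) + (x - y) * y ^+ k.
  by rewrite mulrBr mulrBl -!exprS addrA subrK.
apply: le_trans (modCD _ _) _; rewrite !modCM modCX /=.
have E : k%:R * M ^+ k = M * (k%:R * M ^+ k.-1).
  by case: k {IH} => [|k] /=; rewrite ?mul0r ?mulr0 // exprS; rewrite mulrCA.
rewrite -natr1 mulrDl mul1r mulrDl E; apply: lerD.
  by rewrite -mulrA; apply: ler_pM; rewrite ?modC_ge0.
rewrite mulrC; apply: ler_wpM2r; first exact: modC_ge0.
by rewrite lerXn2r ?nnegrE ?modC_ge0.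
Qed.

End Modulus.

(** * Vanishing orders at 0 and division by powers of z *)

Lemma wirtinger_sum (K : comNzRingType) (h i a b : K) :
  h * (a - i * b) + h * (a + i * b) = h * 2 * a.
Proof. ring. Qed.

Lemma wirtinger_diff (K : comNzRingType) (h i a b : K) :
  i * (h * (a - i * b) - h * (a + i * b)) = - (i * i * (h * 2 * b)).
Proof. ring. Qed.

Lemma quot_sub (K : fieldType) (u v x y : K) : x != 0 -> y != 0 ->
  u / x - v / y = (u - v) / x + v * (y - x) / (x * y).
Proof. by move=> x0 y0; field; rewrite x0 y0. Qed.

Section Flatness.
Variable R : realType.
Implicit Types (F G L : 'rV[R]_2 -> R[i]) (z : 'rV[R]_2) (D : set 'rV[R]_2).
Local Notation Re := (@complex.Re R).
Local Notation Im := (@complex.Im R).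
Local Notation ReF F := (fun w => Re (F w) : R^o).
Local Notation ImF F := (fun w => Im (F w) : R^o).

(** This is F = O(|z|^k) at 0. The radius is at most 1 so that a higher order implies the lower ones
    ([flatW]). *)
Definition flat k F := exists2 r : R, 0 < r <= 1 & exists2 C : R, 0 <= C &
  forall z, `|z| < r -> modC (F z) <= C * `|z| ^+ k.

Lemma flat_near k F G (r : R) : 0 < r -> (forall z, `|z| < r -> F z = G z) ->
  flat k F -> flat k G.
Proof.
move=> r0 FG [r' /andP[r'0 r'1] [C C0 CF]].
exists (Num.min r r'); first by rewrite lt_min r0 r'0 ge_min r'1 orbT.
exists C => // z; rewrite lt_min => /andP[zr zr'].
by rewrite -FG //; exact: CF.
Qed.

Lemma flatW k k' F : (k' <= k)%N -> flat k F -> flat k' F.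
Proof.
move=> kk [r /andP[r0 r1] [C C0 CF]]; exists r; first by rewrite r0.
exists C => // z zr; apply: le_trans (CF z zr) _; apply: ler_wpM2l => //.
by apply: ler_wiXn2l => //; apply: ltW; exact: lt_le_trans r1.
Qed.

Lemma flatD k F G : flat k F -> flat k G -> flat k (fun w => F w + G w).
Proof.
move=> [r /andP[r0 r1] [C C0 CF]] [r' /andP[r'0 r'1] [C' C'0 CG]].
exists (Num.min r r'); first by rewrite lt_min r0 r'0 ge_min r1.
exists (C + C'); first exact: addr_ge0.
move=> z; rewrite lt_min => /andP[zr zr'].
by apply: le_trans (modCD _ _) _; rewrite mulrDl lerD ?CF ?CG.
Qed.

Lemma flatM k k' F G : flat k F -> flat k' G -> flat (k + k') (fun w => F w * G w).
Proof.
move=> [r /andP[r0 r1] [C C0 CF]] [r' /andP[r'0 r'1] [C' C'0 CG]].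
exists (Num.min r r'); first by rewrite lt_min r0 r'0 ge_min r1.
exists (C * C'); first exact: mulr_ge0.
move=> z; rewrite lt_min => /andP[zr zr'].
by rewrite modCM exprD mulrACA; apply: ler_pM; rewrite ?modC_ge0 ?CF ?CG.
Qed.

Lemma flat_conj k F : flat k F -> flat k (fun w => conjc (F w)).
Proof.
by move=> [r r0 [C C0 CF]]; exists r => //; exists C => // z zr; rewrite modC_conj CF.
Qed.

Lemma flat_toCX s : flat s (fun w => toC w ^+ s).
Proof.
exists 1; first by rewrite ltr01 lexx.
exists (2 ^+ s); first by rewrite exprn_ge0.
move=> z _; rewrite modCX -exprMn; apply: lerXn2r; rewrite ?nnegrE ?modC_ge0 ?mulr_ge0 //.
exact: modC_normr.
Qed.

Lemma flat_cont F : {for 0, continuous (ReF F)} -> {for 0, continuous (ImF F)} ->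
  flat 0 F.
Proof.
move=> /(continuous_ball ltr01)[r r0 rF] /(continuous_ball ltr01)[r' r'0 rF'].
exists (Num.min 1 (Num.min r r')); first by rewrite !lt_min r0 r'0 ltr01 ge_min lexx.
exists (`|Re (F 0)| + 1 + (`|Im (F 0)| + 1)); first by rewrite !addr_ge0.
move=> z; rewrite !lt_min => /and3P[_ zr zr']; rewrite expr0 mulr1.
apply: le_trans (modC_le _) _; apply: lerD.
  rewrite -(subKr (Re (F 0)) (Re (F z))) (le_trans (ler_normB _ _)) // lerD2l.
  by apply/ltW/rF; rewrite sub0r normrN.
rewrite -(subKr (Im (F 0)) (Im (F z))) (le_trans (ler_normB _ _)) // lerD2l.
by apply/ltW/rF'; rewrite sub0r normrN.
Qed.

Lemma csmooth_flat D F : open D -> D 0 -> csmooth D F -> flat 0 F.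
Proof.
by move=> oD D0 [sR sI]; apply: flat_cont; [exact: (sR 0%N)|exact: (sI 0%N)].
Qed.

(** The two real derivatives are dz + dzbar and i (dz - dzbar). *)
Lemma pdC_dz i F z :
  modC (pdC i F z) <= modC (dz F z) + modC (dzbar F z).
Proof.
have i2 : 'i%C * 'i%C = -1 :> R[i] by exact: sqr_i.
have h2 : (2 : R[i])^-1 * 2 = 1 by rewrite mulVf // pnatr_eq0.
case: (ord2 i) => ->.
  rewrite (_ : pdC 0 F z = dz F z + dzbar F z); first exact: modCD.
  rewrite /dz /dzbar; move: (pdC 0 F z) (pdC 1 F z) => a b.
  by rewrite wirtinger_sum h2 mul1r.
have -> : pdC 1 F z = 'i%C * (dz F z - dzbar F z).
  rewrite /dz /dzbar; move: (pdC 0 F z) (pdC 1 F z) => a b.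
  by rewrite wirtinger_diff i2 h2 mul1r mulN1r opprK.
rewrite modCM (_ : modC 'i%C = 1) ?mul1r; last first.
  by rewrite /modC /= expr0n /= add0r expr1n sqrtr1.
by apply: le_trans (modCD _ _) _; rewrite modCN.
Qed.

(** The segment from [a] to [b] stays in the ball of radius |a|, where both Wirtinger derivatives
    are bounded by multiples of |a|^k. The condition |b| <= |a| is harmless in applications, as the
    two points can be exchanged. *)
Lemma flat_lipschitz D F k : open D -> D 0 -> csmooth D F ->
  flat k (dz F) -> flat k (dzbar F) ->
  exists2 r : R, 0 < r <= 1 & exists2 C : R, 0 <= C &
    forall a b, `|a| < r -> `|b| <= `|a| ->
      modC (F b - F a) <= C * `|a| ^+ k * `|b - a|.
Proof.
move=> oD D0 sF [r1 /andP[r10 r11] [C1 C10 F1]] [r2 /andP[r20 r21] [C2 C20 F2]].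
have [r3 r30 rD] := open_ball oD D0.
exists (Num.min r1 (Num.min r2 r3)); first by rewrite !lt_min r10 r20 r30 ge_min r11.
(* A factor 2 is the dimension in [mvi_segment], the other one accounts for real and imaginary
   part. *)
exists (4 * (C1 + C2)); first by rewrite mulr_ge0 // addr_ge0.
move=> a b; rewrite !lt_min => /and3P[ar1 ar2 ar3] ba.
have seg (t : R) : t \in `[0, 1] -> `|a + t *: (b - a)| <= `|a|.
  rewrite in_itv /= => /andP[t0 t1].
  have -> : a + t *: (b - a) = (1 - t) *: a + t *: b.
    by rewrite scalerBr scalerBl scale1r addrA addrAC.
  apply: le_trans (ler_normD _ _) _; rewrite !normrZ (ger0_norm t0) ger0_norm ?subr_ge0 //.
  have : t * `|b| <= t * `|a| by rewrite ler_wpM2l.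
  by move: (`|a|) (`|b|) => x y; lra.
have bnd (t : R) : t \in `[0, 1] -> forall i,
    modC (pdC i F (a + t *: (b - a))) <= (C1 + C2) * `|a| ^+ k.
  move=> t01 i; apply: le_trans (pdC_dz _ _ _) _; rewrite mulrDl.
  have st := seg t t01.
  have sk : `|a + t *: (b - a)| ^+ k <= `|a| ^+ k by apply: lerXn2r; rewrite ?nnegrE.
  apply: lerD.
    by apply: le_trans (F1 _ (le_lt_trans st ar1)) _; exact: ler_wpM2l.
  by apply: le_trans (F2 _ (le_lt_trans st ar2)) _; exact: ler_wpM2l.
have inD (t : R) : t \in `[0, 1] -> D (a + t *: (b - a)).
  by move=> t01; apply: rD; rewrite sub0r normrN; exact: le_lt_trans (seg t t01) ar3.
have hR : `|Re (F b) - Re (F a)| <= 2%:R * ((C1 + C2) * `|a| ^+ k) * `|b - a|.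
  apply: (@mvi_segment _ _ (ReF F)) => t t01.
    by have [] := csmooth_diff (inD t t01) sF.
  by move=> i; apply: le_trans (bnd t t01 i); exact: (modC_Re (pdC i F _)).
have hI : `|Im (F b) - Im (F a)| <= 2%:R * ((C1 + C2) * `|a| ^+ k) * `|b - a|.
  apply: (@mvi_segment _ _ (ImF F)) => t t01.
    by have [] := csmooth_diff (inD t t01) sF.
  by move=> i; apply: le_trans (bnd t t01 i); exact: (modC_Im (pdC i F _)).
apply: le_trans (modC_le _) _; rewrite cReD cReN cImD cImN.
apply: le_trans (lerD hR hI) _.
move: (`|a| ^+ k) (`|b - a|) => x y; rewrite le_eqVlt; apply/orP; left.
by apply/eqP; ring.
Qed.

(** The case [b = 0] of [flat_lipschitz]: one integration gains one order. *)
Lemma flat_step D F k : open D -> D 0 -> csmooth D F -> F 0 = 0 ->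
  flat k (dz F) -> flat k (dzbar F) -> flat k.+1 F.
Proof.
move=> oD D0 sF F0 f1 f2.
have [r r0 [C C0 CF]] := flat_lipschitz oD D0 sF f1 f2.
exists r => //; exists C => // z zr.
by have := CF z 0 zr; rewrite normr0 F0 !sub0r normrN modCN exprSr mulrA; apply.
Qed.

(** dz commutes with dzbar and treats conj(z)^s as a constant. *)
Lemma iter_dzbar D G L s j z : open D -> csmooth D G -> csmooth D L ->
  (forall w, D w -> dzbar G w = conjc (toC w) ^+ s * L w) -> D z ->
  dzbar (iter j (@dz R) G) z = conjc (toC z) ^+ s * iter j (@dz R) L z.
Proof.
move=> oD sG sL GL; elim: j z => [|j IH] z Dz /=; first exact: GL.
have sj := csmooth_iter_dz j oD sG; have sLj := csmooth_iter_dz j oD sL.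
rewrite (dz_dzbar oD Dz sj) (dz_on oD IH Dz).
have cX w : conjc (toC w) ^+ s = conjc (toC w ^+ s) by rewrite rmorphXn.
under [X in dz X]eq_fun do rewrite cX.
have dX := cdiff_toCX s z.
rewrite (dzM (cdiff_conj dX) (csmooth_diff Dz sLj)).
by rewrite dz_conj // dzbar_toCX conjc0 mul0r add0r cX.
Qed.

(* As dzbar G = O(|z|^s), the vanishing of pure z-derivatives suffices. *)
Lemma flat_iter D G L s m : open D -> D 0 -> csmooth D G -> csmooth D L ->
  (forall w, D w -> dzbar G w = conjc (toC w) ^+ s * L w) ->
  (m <= s.+1)%N -> (forall j, (j < m)%N -> iter j (@dz R) G 0 = 0) ->
  forall j, (j <= m)%N -> flat (m - j) (iter j (@dz R) G).
Proof.
move=> oD D0 sG sL GL ms G0 j jm.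
rewrite -(subKn jm); move: (m - j)%N (leq_subr j m) => i {j jm}.
elim: i => [|i IH] im.
  rewrite subn0 subnn; exact: csmooth_flat oD D0 (csmooth_iter_dz m oD sG).
rewrite subKn //.
apply: (flat_step oD D0) => //; first exact: csmooth_iter_dz.
- by apply: G0; lia.
- have := IH (ltnW im); rewrite subKn ?(ltnW im) //.
  by rewrite (_ : (m - i)%N = (m - i.+1).+1) //; lia.
- have [r r0 rD] := open_ball oD D0.
  apply: (flat_near r0 (F := fun w => conjc (toC w ^+ s) * iter (m - i.+1) (@dz R) L w)).
    move=> z zr; rewrite (@iter_dzbar D G L s) // ?rmorphXn //.
    by apply: rD; rewrite sub0r normrN.
  (* Here [m <= s.+1] enters: the order asked of the dzbar derivative is i < m, and conj(z)^s
     provides [s]. *)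
  apply: (@flatW (s + 0)); first lia.
  apply: flatM; first exact/flat_conj/flat_toCX.
  exact: csmooth_flat oD D0 (csmooth_iter_dz _ oD sL).
Qed.

Lemma iter_dz_toCM D g j z : open D -> D z -> csmooth D g ->
  iter j (@dz R) (fun w => toC w * g w) z =
  toC z * iter j (@dz R) g z + j%:R * iter j.-1 (@dz R) g z.
Proof.
move=> oD Dz sg; elim: j z Dz => [|j IH] z Dz; first by rewrite mul0r addr0.
rewrite iterS (dz_on oD IH Dz).
have dg k : cdiff (iter k (@dz R) g) z by apply: (csmooth_diff Dz); exact: csmooth_iter_dz.
rewrite dzD; [|exact: cdiffM (cdiff_toC z) (dg j)|exact: cdiffM (cdiff_cst _ z) (dg j.-1)].
rewrite (dzM (cdiff_toC z) (dg j)) dz_toC mul1r (dzZ _ (dg j.-1)) /=.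
rewrite -addrA addrC -addrA; congr (_ + _).
case: j {IH dg} => [|j]; first by rewrite mul0r add0r mul1r.
by rewrite -[j.+2%:R]natr1 mulrDl mul1r.
Qed.

(** At 0 only the terms of Leibniz's rule in which z^s is differentiated exactly [s] times survive.
    For [j < s] the falling factorial is 0, so the truncated difference [j - s] does no harm. *)
Lemma iter_dz_toCXM D g s j : open D -> D 0 -> csmooth D g ->
  iter j (@dz R) (fun w => toC w ^+ s * g w) 0 =
  (j ^_ s)%:R * iter (j - s) (@dz R) g 0.
Proof.
move=> oD D0 sg; elim: s j => [|s IH] j.
  under [X in iter _ _ X _]eq_fun do rewrite mul1r.
  by rewrite ffactn0 subn0 mul1r.
under [X in iter _ _ X _]eq_fun do rewrite exprS -mulrA.
rewrite (iter_dz_toCM j oD D0); last by apply: csmoothM => //; exact: csmooth_toCX.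
rewrite (_ : toC 0 = 0) ?mul0r ?add0r; last by apply/eqP; rewrite toC_eq0.
by rewrite IH mulrA -natrM ffactnS (_ : (j.-1 - s = j - s.+1)%N) //; lia.
Qed.

Lemma iter_dzD D F G j z : open D -> D z -> csmooth D F -> csmooth D G ->
  iter j (@dz R) (fun w => F w + G w) z = iter j (@dz R) F z + iter j (@dz R) G z.
Proof.
move=> oD Dz sF sG; elim: j z Dz => [|j IH] z Dz //=.
by rewrite (dz_on oD IH Dz) dzD //; apply: (csmooth_diff Dz); exact: csmooth_iter_dz.
Qed.

(** The coefficient is the Taylor coefficient of z^m. Subtracting a holomorphic monomial leaves
    dzbar unchanged and annihilates one more z-derivative, so [flat_iter] applies with m + 1, which
    [m <= s] permits. *)
Lemma flat_leading D G L s m : open D -> D 0 -> csmooth D G -> csmooth D L ->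
  (forall w, D w -> dzbar G w = conjc (toC w) ^+ s * L w) ->
  (m <= s)%N -> (forall j, (j < m)%N -> iter j (@dz R) G 0 = 0) ->
  exists2 c : R[i], c * m`!%:R = iter m (@dz R) G 0 &
    let H w := G w - c * toC w ^+ m in
    [/\ flat m.+1 H, flat m (dz H) & csmooth D H /\
      forall w, D w -> dzbar H w = conjc (toC w) ^+ s * L w].
Proof.
move=> oD D0 sG sL GL ms G0.
have [c cE] : exists c, c * m`!%:R = iter m (@dz R) G 0.
  exists (iter m (@dz R) G 0 / m`!%:R).
  by rewrite mulfVK // pnatr_eq0 -lt0n fact_gt0.
exists c => // H.
have sX : csmooth D (fun w => toC w ^+ m * - c).
  by apply: csmoothM => //; [exact: csmooth_toCX|exact: csmooth_cst].
have HE : H = fun w => G w + toC w ^+ m * - c.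
  by apply/funext => w; rewrite /H mulrN [c * _]mulrC.
have sH : csmooth D H by rewrite HE; exact: csmoothD.
have HL w : D w -> dzbar H w = conjc (toC w) ^+ s * L w.
  move=> Dw; rewrite HE dzbarD; [|exact: csmooth_diff Dw sG|exact: csmooth_diff Dw sX].
  rewrite GL // dzbarM; [|exact: cdiff_toCX|exact: cdiff_cst].
  by rewrite dzbar_toCX dzbar_cst mul0r mulr0 !addr0.
have H0 j : (j < m.+1)%N -> iter j (@dz R) H 0 = 0.
  move=> jm; rewrite HE (iter_dzD j oD D0 sG sX).
  rewrite (@iter_dz_toCXM D (fun=> - c)) //; last exact: csmooth_cst.
  move: jm; rewrite ltnS leq_eqVlt => /predU1P[->|jm].
    by rewrite subnn /= ffactnn mulrN [_%:R * c]mulrC cE subrr.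
  by rewrite G0 // ffact_small // mul0r addr0.
have f j := @flat_iter D H L s m.+1 oD D0 sH sL HL ms H0 j.
split; [exact: (f 0%N)| |by []].
by have := f 1%N isT; rewrite subSS subn0.
Qed.

Definition clipschitz_at F z := lipschitz_at (ReF F) z /\ lipschitz_at (ImF F) z.

(* Division by zero makes the quotient vanish at 0, which is the right value. *)
Lemma clipschitz_quot D F s : open D -> D 0 -> csmooth D F -> F 0 = 0 ->
  flat s (dz F) -> flat s (dzbar F) ->
  clipschitz_at (fun w => F w / toC w ^+ s) 0.
Proof.
move=> oD D0 sF F0 f1 f2.
have [r /andP[r0 r1] [C C0 CF]] := flat_lipschitz oD D0 sF f1 f2.
(* In [quot_sub] the first term costs C and the second one C s 2^s; the constant is generous by a
   factor 2. *)
pose K := C * (s%:R * 2 ^+ s * 2 + 1).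
have S0 : 0 <= s%:R * 2 ^+ s * 2 :> R by rewrite !mulr_ge0 // exprn_ge0.
have K0 : 0 <= K by rewrite mulr_ge0 // addr_ge0.
suff H a b : `|a| < r -> `|b| < r ->
    modC (F a / toC a ^+ s - F b / toC b ^+ s) <= K * `|a - b|.
  have nr : nbhs (0 : 'rV[R]_2) (ball (0 : 'rV[R]_2) r) by exact: nbhsx_ballx.
  split; exists (ball (0 : 'rV[R]_2) r) => //; exists K => // a b;
    rewrite -ball_normE /= !sub0r !normrN => ar br; apply: le_trans (H a b ar br).
    by rewrite -cReN -cReD; exact: modC_Re.
  by rewrite -cImN -cImD; exact: modC_Im.
move=> ar br; wlog ba : a b ar br / `|b| <= `|a|.
  move=> W; have [ba|/ltW ab] := leP `|b| `|a|; first exact: W.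
  by rewrite -opprB modCN distrC; exact: W.
have CK : C <= K by rewrite ler_peMr // lerDr.
have [a0|a0] := eqVneq a 0.
  have b0 : b = 0 by apply/eqP; rewrite -normr_le0 -(normr0 'rV[R]_2) -a0.
  by rewrite a0 b0 !subrr modC0 mulr_ge0.
have al0 : 0 < modC (toC a) by rewrite modC_gt0 toC_eq0.
have aa := normr_modC a.
have T1 : modC (F a - F b) / modC (toC a) ^+ s <= C * `|a - b|.
  rewrite ler_pdivrMr ?exprn_gt0 // -opprB modCN distrC.
  apply: le_trans (CF a b ar ba) _; rewrite mulrAC.
  apply: ler_wpM2l; first exact: mulr_ge0.
  by apply: lerXn2r; rewrite ?nnegrE // ltW.
have [b0|b0] := eqVneq b 0.
  move: T1; rewrite b0 F0 !mul0r !subr0 modCM modCV modCX => T1.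
  by apply: le_trans T1 _; exact: ler_wpM2r.
have be0 : 0 < modC (toC b) by rewrite modC_gt0 toC_eq0.
have -> : F a / toC a ^+ s - F b / toC b ^+ s = (F a - F b) / toC a ^+ s +
    F b * (toC b ^+ s - toC a ^+ s) / (toC a ^+ s * toC b ^+ s).
  have : toC a ^+ s != 0 by rewrite expf_neq0 // toC_eq0.
  have : toC b ^+ s != 0 by rewrite expf_neq0 // toC_eq0.
  by move=> y0 x0; exact: quot_sub.
apply: le_trans (modCD _ _) _; rewrite modCM modCV modCX.
rewrite /K [C * (_ + 1)]mulrDr mulr1 [leRHS]mulrDl [leRHS]addrC; apply: lerD => //.
rewrite !modCM modCV modCM !modCX ler_pdivrMr ?mulr_gt0 ?exprn_gt0 //.
(* From |F b| <= C |b|^(s+1), with one factor |b| traded for |a|: together with |a|^(s-1) from the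
   difference of powers it matches the denominator |a|^s |b|^s. *)
have Fb : modC (F b) <= C * modC (toC b) ^+ s * modC (toC a).
  have := CF b 0 br; rewrite normr0 F0 !sub0r normrN modCN => /(_ (normr_ge0 _)) h.
  apply: le_trans h _; apply: ler_pM; rewrite ?mulr_ge0 ?exprn_ge0 //.
    by apply: ler_wpM2l => //; apply: lerXn2r; rewrite ?nnegrE ?(ltW be0) // normr_modC.
  exact: le_trans ba aa.
have SX : modC (toC b ^+ s - toC a ^+ s) <=
    s%:R * (2 * modC (toC a)) ^+ s.-1 * (2 * `|a - b|).
  have h : toC b - toC a = toC (b - a) by rewrite /toC !mxE.
  apply: le_trans (@modC_subX _ _ _ (2 * modC (toC a)) s _ _) _.
  - apply: le_trans (modC_normr b) _; rewrite ler_wpM2l //; exact: le_trans ba aa.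
  - by rewrite ler_peMl ?(ltW al0) // ler1n.
  - rewrite h; apply: ler_wpM2l; last by rewrite distrC modC_normr.
    by rewrite mulr_ge0 // exprn_ge0 // mulr_ge0 // ltW.
apply: le_trans (ler_pM (modC_ge0 _) (modC_ge0 _) Fb SX) _.
move: (modC (toC a)) (modC (toC b)) al0 be0 (`|a - b|) (normr_ge0 (a - b))
  => al be al0 be0 t t0.
rewrite le_eqVlt; case: s {f1 f2 CF K S0 K0 CK T1 Fb SX} => [|s] /=.
  by rewrite !mul0r !mulr0 !mul0r eqxx.
have -> : C * be ^+ s.+1 * al * (s.+1%:R * (2 * al) ^+ s * (2 * t)) =
   C * (s.+1%:R * 2 ^+ s.+1 * 1) * t * (al ^+ s.+1 * be ^+ s.+1).
  by rewrite exprMn !exprS; ring.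
rewrite -le_eqVlt; apply: ler_wpM2r; first by rewrite mulr_ge0 // exprn_ge0 // ltW.
apply: ler_wpM2r => //; apply: ler_wpM2l => //; apply: ler_wpM2l; last by rewrite ler1n.
by rewrite mulr_ge0 // exprn_ge0.
Qed.

End Flatness.

(** * Algebra of frames and conformal metrics *)

Section GaussAlgebra.
Variable R : realFieldType.
Variables (lam lam0 lam1 lam00 lam01 lam11 E F G nu : R).
Variables (x00 x01 x11 y00 y01 y11 : R).

Let t00_0 := x00 * E + y00 * F. Let t00_1 := x00 * F + y00 * G.
Let t01_0 := x01 * E + y01 * F. Let t01_1 := x01 * F + y01 * G.
Let t11_0 := x11 * E + y11 * F. Let t11_1 := x11 * F + y11 * G.

Let g00_0 := lam0 * E + lam * (2 * t00_0).
Let g00_1 := lam1 * E + lam * (2 * t01_0).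
Let g11_0 := lam0 * G + lam * (2 * t01_1).
Let g11_1 := lam1 * G + lam * (2 * t11_1).
Let g01_0 := lam0 * F + lam * (t00_1 + t01_0).
Let g01_1 := lam1 * F + lam * (t01_1 + t11_0).

Let c0_00 := g00_0 / 2. Let c1_00 := g01_0 - g00_1 / 2.
Let c0_01 := g00_1 / 2. Let c1_01 := g11_0 / 2.
Let c0_11 := g01_1 - g11_0 / 2. Let c1_11 := g11_1 / 2.

Let kap := nu + (x00 * x11 - x01 ^+ 2) * E +
  (x00 * y11 + y00 * x11 - 2 * x01 * y01) * F + (y00 * y11 - y01 ^+ 2) * G.

Let W00 := (lam00 - x00 * lam0 - y00 * lam1) / lam - lam0 ^+ 2 / lam ^+ 2.
Let W01 := (lam01 - x01 * lam0 - y01 * lam1) / lam - lam0 * lam1 / lam ^+ 2.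
Let W11 := (lam11 - x11 * lam0 - y11 * lam1) / lam - lam1 ^+ 2 / lam ^+ 2.

(* The Gauss equation for a target metric [lam] times the Euclidean one: [x_ij] and
   [y_ij] are the tangential components of the second derivatives of the immersion,
   [nu] is the determinant of their normal parts. *)
Lemma gauss_conformal_algebra : lam != 0 -> E * G - F ^+ 2 != 0 ->
  (lam01 * F + lam1 * (t00_1 + t01_0) + lam0 * (t01_1 + t11_0)
   - (lam00 * G + 2 * lam0 * (2 * t01_1)) / 2
   - (lam11 * E + 2 * lam1 * (2 * t01_0)) / 2 + lam * kap
   + (G * (c0_01 ^+ 2 - c0_00 * c0_11)
      - F * (2 * c0_01 * c1_01 - c0_00 * c1_11 - c1_00 * c0_11)
      + E * (c1_01 ^+ 2 - c1_00 * c1_11)) / (lam * (E * G - F ^+ 2)))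
   / (lam ^+ 2 * (E * G - F ^+ 2)) =
  lam^-1 * (nu / (E * G - F ^+ 2) -
    (G * W00 - 2 * F * W01 + E * W11) / (2 * (E * G - F ^+ 2))).
Proof.
move=> l0 D0; rewrite /W00 /W01 /W11 /kap /c0_00 /c1_00 /c0_01 /c1_01 /c0_11 /c1_11
  /g00_0 /g00_1 /g11_0 /g11_1 /g01_0 /g01_1 /t00_0 /t00_1 /t01_0 /t01_1 /t11_0 /t11_1.
by field; rewrite l0 D0.
Qed.

End GaussAlgebra.

Section ConformalFrame.
Variable R : realFieldType.
Variables (a b c p q r : R).

Let n2 := a ^+ 2 + b ^+ 2.
Let re2 := a ^+ 2 - b ^+ 2.
Let im2 := 2 * a * b.

(* With [a + ib] = z^s, hence [re2 + i im2] = z^(2s): the matrix of the quadratic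
   form 2 Re (z^(2s) (t1 + i t2) (dz)^2) + 2 |z|^(2s) m |dz|^2.  Near the branch
   point the metric and the second fundamental form both have this shape. *)
Definition sym00 (t1 t2 m : R) := 2 * (re2 * t1 - im2 * t2 + n2 * m).
Definition sym11 (t1 t2 m : R) := 2 * (- (re2 * t1 - im2 * t2) + n2 * m).
Definition sym01 (t1 t2 m : R) := - 2 * (re2 * t2 + im2 * t1).

Let E := 4 * c ^+ 2 * (a ^+ 2 * p - 2 * a * b * q + b ^+ 2 * r).
Let F := 4 * c ^+ 2 * (- a * b * p - (a ^+ 2 - b ^+ 2) * q + a * b * r).
Let G := 4 * c ^+ 2 * (b ^+ 2 * p + 2 * a * b * q + a ^+ 2 * r).

(** [p], [q], [r] are meant as the Gram entries of e1, e2, and [E], [F], [G] as those of 2c (a e1 -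
    b e2) and -2c (b e1 + a e2). The change of frame has determinant -4 c^2 n2, which enters
    squared. *)
Lemma sym_det : E * G - F ^+ 2 = 16 * c ^+ 4 * n2 ^+ 2 * (p * r - q ^+ 2).
Proof. rewrite /E /F /G /n2; ring. Qed.

(** Numerator and determinant both have degree 4 in [a], [b] and contain n2^2, which cancels. In the
    determinant version that follows, the trace-free part [t1], [t2] enters with a minus sign: this
    sign decides the blow-up. *)
Lemma sym_trace t1 t2 m : c != 0 -> n2 != 0 -> p * r - q ^+ 2 != 0 ->
  (G * sym00 t1 t2 m - 2 * F * sym01 t1 t2 m + E * sym11 t1 t2 m) /
    (E * G - F ^+ 2) =
  ((p + r) * m - (p - r) * t1 - 2 * q * t2) / (2 * c ^+ 2 * (p * r - q ^+ 2)).
Proof.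
move=> c0 n0 d0; rewrite sym_det /E /F /G /sym00 /sym01 /sym11 /re2 /im2.
by move: n0; rewrite /n2 => n0; field; rewrite c0 n0 d0.
Qed.

Lemma sym_det_quot t1 t2 m : c != 0 -> n2 != 0 -> p * r - q ^+ 2 != 0 ->
  (sym00 t1 t2 m * sym11 t1 t2 m - sym01 t1 t2 m ^+ 2) / (E * G - F ^+ 2) =
  (m ^+ 2 - (t1 ^+ 2 + t2 ^+ 2)) / (4 * c ^+ 4 * (p * r - q ^+ 2)).
Proof.
move=> c0 n0 d0; rewrite sym_det /sym00 /sym01 /sym11 /re2 /im2.
by move: n0; rewrite /n2 => n0; field; rewrite c0 n0 d0.
Qed.

End ConformalFrame.

(** * Euclidean product, normal projection and 2 x 2 inverses *)

Section DotProduct.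
Variables (R : comNzRingType) (n : nat).
Implicit Types u v w : 'rV[R]_n.

Definition dot u v : R := \sum_k u 0 k * v 0 k.

Lemma dotC u v : dot u v = dot v u.
Proof. by apply: eq_bigr => k _; rewrite mulrC. Qed.

Lemma dotDl u v w : dot (u + v) w = dot u w + dot v w.
Proof. by rewrite -big_split; apply: eq_bigr => k _; rewrite mxE mulrDl. Qed.

Lemma dotZl a u w : dot (a *: u) w = a * dot u w.
Proof. by rewrite mulr_sumr; apply: eq_bigr => k _; rewrite mxE mulrA. Qed.

Lemma dotNl u w : dot (- u) w = - dot u w.
Proof. by rewrite -scaleN1r dotZl mulN1r. Qed.

Lemma dotBl u v w : dot (u - v) w = dot u w - dot v w.
Proof. by rewrite dotDl dotNl. Qed.

Lemma dotDr u v w : dot w (u + v) = dot w u + dot w v.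
Proof. by rewrite dotC dotDl !(dotC w). Qed.

Lemma dotZr a u w : dot w (a *: u) = a * dot w u.
Proof. by rewrite dotC dotZl (dotC w). Qed.

Lemma dotNr u w : dot w (- u) = - dot w u.
Proof. by rewrite dotC dotNl (dotC w). Qed.

Lemma dotBr u v w : dot w (u - v) = dot w u - dot w v.
Proof. by rewrite dotDr dotNr. Qed.

Definition dotE := (dotDl, dotDr, dotBl, dotBr, dotZl, dotZr, dotNl, dotNr).

Lemma sum2 (F : 'I_2 -> R) : \sum_i F i = F 0 + F 1.
Proof.
rewrite big_ord_recl big_ord1; congr (_ + F _); exact: val_inj.
Qed.

End DotProduct.

Section Projection.
Variables (R : fieldType) (n : nat) (e1 e2 : 'rV[R]_n).
Implicit Types u v w : 'rV[R]_n.

Definition gram_det := dot e1 e1 * dot e2 e2 - dot e1 e2 ^+ 2.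

(* The projection onto the orthogonal complement of the span of [e1] and [e2];
   junk if [gram_det = 0]. *)
Definition perp v : 'rV[R]_n :=
  v - ((dot e2 e2 * dot v e1 - dot e1 e2 * dot v e2) / gram_det) *: e1
    - ((dot e1 e1 * dot v e2 - dot e1 e2 * dot v e1) / gram_det) *: e2.

Lemma perpD u v : perp (u + v) = perp u + perp v.
Proof.
apply/rowP => k; rewrite /perp !mxE !dotDl; ring.
Qed.

Lemma perpZ a v : perp (a *: v) = a *: perp v.
Proof. apply/rowP => k; rewrite /perp !mxE !dotZl; ring. Qed.

Lemma perpN v : perp (- v) = - perp v.
Proof. by rewrite -scaleN1r perpZ scaleN1r. Qed.

Lemma perpB u v : perp (u - v) = perp u - perp v.
Proof. by rewrite perpD perpN. Qed.

Hypothesis gram_neq0 : gram_det != 0.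

Lemma dot_perp1 v : dot (perp v) e1 = 0.
Proof.
rewrite /perp !dotBl !dotZl (dotC e2 e1).
by move: gram_neq0; rewrite /gram_det => g0; field.
Qed.

Lemma dot_perp2 v : dot (perp v) e2 = 0.
Proof.
rewrite /perp !dotBl !dotZl.
by move: gram_neq0; rewrite /gram_det => g0; field.
Qed.

Lemma perp_normal v : dot v e1 = 0 -> dot v e2 = 0 -> perp v = v.
Proof. by move=> v1 v2; rewrite /perp v1 v2 !mulr0 !subr0 !mul0r !scale0r !subr0. Qed.

Lemma perp_e1 : perp e1 = 0.
Proof.
apply/rowP => k; rewrite /perp !mxE.
by move: gram_neq0; rewrite /gram_det => g0; field.
Qed.

Lemma perp_e2 : perp e2 = 0.
Proof.
apply/rowP => k; rewrite /perp !mxE (dotC e2 e1).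
by move: gram_neq0; rewrite /gram_det => g0; field.
Qed.

(** Identifies the projection from any decomposition into normal and tangential part; this is how
    the projections of two frames of one plane are compared. *)
Lemma perp_unique v w x y : v = w + x *: e1 + y *: e2 ->
  dot w e1 = 0 -> dot w e2 = 0 -> perp v = w.
Proof.
move=> -> w1 w2.
by rewrite !perpD !perpZ perp_e1 perp_e2 !scaler0 !addr0 perp_normal.
Qed.

Lemma dot_perp_normal v w : dot w e1 = 0 -> dot w e2 = 0 ->
  dot (perp v) w = dot v w.
Proof.
by move=> w1 w2; rewrite /perp !dotBl !dotZl !(dotC _ w) w1 w2 !mulr0 !subr0.
Qed.

End Projection.

Section Inverse2.
Variable R : fieldType.

Lemma det2 (A : 'M[R]_2) : \det A = A 0 0 * A 1 1 - A 0 1 * A 1 0.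
Proof.
rewrite (expand_det_row _ 0) sum2 /cofactor !det_mx11 !mxE /= expr0 mul1r expr1.
rewrite mulN1r mulrN; congr (A _ _ * A _ _ - A _ _ * A _ _); exact: val_inj.
Qed.

Lemma invmx2 (A : 'M[R]_2) : \det A != 0 ->
  [/\ invmx A 0 0 = A 1 1 / \det A, invmx A 0 1 = - A 0 1 / \det A,
      invmx A 1 0 = - A 1 0 / \det A & invmx A 1 1 = A 0 0 / \det A].
Proof.
move=> d0; have uA : A \in unitmx by rewrite unitmxE unitfE.
pose B : 'M[R]_2 := \matrix_(i, j)
  ((if i == j then A (1 - i) (1 - i) else - A i j) / \det A).
have sub : (1 - 0 = 1 :> 'I_2) /\ (1 - 1 = 0 :> 'I_2) by split; exact: val_inj.
have AB : A *m B = 1%:M.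
  apply/matrixP => i j; rewrite !mxE sum2 !mxE.
  have o2 (k : 'I_2) : k = 0 \/ k = 1.
    by case: k => -[|[|//]] ?; [left|right]; exact: val_inj.
  have d0' := d0; rewrite det2 in d0'.
  by case: (o2 i) => ->; case: (o2 j) => ->; rewrite /= ?sub.1 ?sub.2 det2 ?mulr1n ?mulr0n; field.
have -> : invmx A = B by rewrite -[LHS]mulmx1 -AB mulKmx.
by rewrite !mxE /= sub.1 sub.2.
Qed.

End Inverse2.

(** * Curvatures of an immersion into a conformally flat space *)

(** Here [c] denotes the Christoffel symbols of the first kind and [G] those of the second. The last
    two hypotheses are derivatives of the lowering relation g00 G0 + g01 G1 = c0. The lowered
    curvature contains the derivatives of [G] only in these combinations, so the inverse metric need
    not be differentiated. *)
Lemma sectional_algebra (R : realFieldType)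
    (g00 g01 g11 p01 p00 p11 c000 c100 c001 c101 c011 c111 : R)
    (G011 G111 G001 G101 d0G011 d0G111 d1G001 d1G101 : R)
    (G000 G100 d0g0 d0g1 d1g0 d1g1 : R) :
  let dt := g00 * g11 - g01 ^+ 2 in
  dt != 0 ->
  d0g0 = 2 * c000 -> d0g1 = c001 + c100 ->
  d1g0 = 2 * c001 -> d1g1 = c011 + c101 ->
  G000 = (g11 * c000 - g01 * c100) / dt -> G100 = (- g01 * c000 + g00 * c100) / dt ->
  G001 = (g11 * c001 - g01 * c101) / dt -> G101 = (- g01 * c001 + g00 * c101) / dt ->
  G011 = (g11 * c011 - g01 * c111) / dt -> G111 = (- g01 * c011 + g00 * c111) / dt ->
  d0g0 * G011 + g00 * d0G011 + (d0g1 * G111 + g01 * d0G111) = p01 - p00 / 2 ->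
  d1g0 * G001 + g00 * d1G001 + (d1g1 * G101 + g01 * d1G101) = p11 / 2 ->
  ((d0G011 - d1G001 + ((G011 * G000 - G001 * G001) + (G111 * G001 - G101 * G011))) * g00 +
   (d0G111 - d1G101 + ((G011 * G100 - G001 * G101) + (G111 * G101 - G101 * G111))) * g01) / dt
  = (p01 - p00 / 2 - p11 / 2 +
      (g11 * (c001 ^+ 2 - c000 * c011)
       - g01 * (2 * c001 * c101 - c000 * c111 - c100 * c011)
       + g00 * (c101 ^+ 2 - c100 * c111)) / dt) / dt.
Proof.
move=> dt dt0 -> -> -> -> e000 e100 e001 e101 e011 e111 H0 H1; congr (_ / _).
rewrite -H0 -H1 e000 e100 e001 e101 e011 e111.
by rewrite /dt; move: dt0; rewrite /dt => dt0; field.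
Qed.

Lemma christoffel_algebra (K : fieldType) (h a b d X Y : K) :
  h * (a / d * X + - b / d * Y) = (a * (h * X) - b * (h * Y)) / d.
Proof. ring. Qed.

Lemma opp_christoffel_algebra (K : fieldType) (h a b d X Y : K) :
  h * (- b / d * X + a / d * Y) = (- b * (h * X) + a * (h * Y)) / d.
Proof. ring. Qed.

Lemma half_double_sub (K : realFieldType) (x y : K) :
  2^-1 * (x + x - y) = x - y / 2.
Proof. by field. Qed.

Lemma half_cancel (K : realFieldType) (x y : K) :
  x = 2^-1 * (x + y - x) + 2^-1 * (x + x - y).
Proof. by field. Qed.

Lemma half_cancel' (K : realFieldType) (x y : K) :
  x = 2^-1 * (x + x - y) + 2^-1 * (y + x - x).
Proof. by field. Qed.

Section SectionalCurvature.
Variables (R : realType) (g : 'rV[R]_2 -> 'M[R]_2) (D : set 'rV[R]_2).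
Hypothesis oD : open D.
Hypothesis g_sym : forall w, D w -> g w 0 1 = g w 1 0.
Hypothesis g_diff : forall i j w, D w -> differentiable (fun w => g w i j : R^o) w.
Hypothesis g_diff2 : forall k i j w, D w ->
  differentiable (pd k (fun w => g w i j : R^o)) w.
Hypothesis g_det : forall w, D w -> \det (g w) != 0.

(** Christoffel symbols of the first kind; [m] is the lowered index. *)
Definition christ1 m j k (u : 'rV[R]_2) : R^o :=
  2^-1 * (pd j (fun w => g w k m : R^o) u + pd k (fun w => g w j m : R^o) u
          - pd m (fun w => g w j k : R^o) u).

Let dg := g_diff.
Let dpg := g_diff2.

Lemma diff_christ1 m j k w : D w -> differentiable (christ1 m j k) w.
Proof.
move=> Dw; apply: differentiableM; first exact: differentiable_cst.
by apply: differentiableB; [apply: differentiableD|]; exact: dpg.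
Qed.

Lemma christoffelE j k w : D w -> let dt := g w 0 0 * g w 1 1 - g w 0 1 ^+ 2 in
  [/\ dt = \det (g w), dt != 0,
    christoffel g 0 j k w = (g w 1 1 * christ1 0 j k w - g w 0 1 * christ1 1 j k w) / dt &
    christoffel g 1 j k w = (- g w 0 1 * christ1 0 j k w + g w 0 0 * christ1 1 j k w) / dt].
Proof.
move=> Dw dt; have E : dt = \det (g w) by rewrite /dt det2 -g_sym // expr2.
have [i00 i01 i10 i11] := invmx2 (g_det Dw).
rewrite /christoffel !sum2 i00 i01 i10 i11 -E -g_sym //; split => //.
- by rewrite E g_det.
- exact: christoffel_algebra.
- exact: opp_christoffel_algebra.
Qed.

Lemma diff_christoffel l j k w : D w ->
  differentiable (christoffel g l j k : 'rV[R]_2 -> R^o) w.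
Proof.
move=> Dw.
have dc m := diff_christ1 m j k Dw.
have dd : differentiable (fun u => (g u 0 0 * g u 1 1 - g u 0 1 ^+ 2)^-1 : R^o) w.
  apply: differentiableV; last by have [_ + _ _] := christoffelE j k Dw.
  apply: differentiableB; first by apply: differentiableM; exact: dg.
  by under eq_fun do rewrite expr2; apply: differentiableM; exact: dg.
case: (ord2 l) => ->.
  apply: (@near_differentiable _ _ _ (fun u =>
    (g u 1 1 * christ1 0 j k u - g u 0 1 * christ1 1 j k u) *
    (g u 0 0 * g u 1 1 - g u 0 1 ^+ 2)^-1 : R^o)).
    apply: filterS (open_near oD Dw) => u Du.
    by have [_ _ -> _] := christoffelE j k Du.
  apply: differentiableM => //; apply: differentiableB; apply: differentiableM => //; exact: dg.
apply: (@near_differentiable _ _ _ (fun u =>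
  (- g u 0 1 * christ1 0 j k u + g u 0 0 * christ1 1 j k u) *
  (g u 0 0 * g u 1 1 - g u 0 1 ^+ 2)^-1 : R^o)).
  apply: filterS (open_near oD Dw) => u Du.
  by have [_ _ _ ->] := christoffelE j k Du.
apply: differentiableM => //; apply: differentiableD; apply: differentiableM => //; try exact: dg.
by apply: differentiableN; exact: dg.
Qed.

Lemma christoffel_lower j k w : D w ->
  g w 0 0 * christoffel g 0 j k w + g w 0 1 * christoffel g 1 j k w =
  christ1 0 j k w.
Proof.
move=> Dw; have [_ d0 -> ->] := christoffelE j k Dw.
by move: (christ1 _ _ _ _) (christ1 _ _ _ _) => x y; field.
Qed.

(** A form of Brioschi's formula: three second derivatives of the metric, the rest being products of
    first ones. *)
Lemma sectional_metric z : D z -> let dt := g z 0 0 * g z 1 1 - g z 0 1 ^+ 2 in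
  let c m j k : R := christ1 m j k z in
  sectional_curvature g z =
   (pd 0 (pd 1 (fun w => g w 0 1 : R^o)) z - pd 0 (pd 0 (fun w => g w 1 1 : R^o)) z / 2
    - pd 1 (pd 1 (fun w => g w 0 0 : R^o)) z / 2 +
      (g z 1 1 * (c 0 0 1 ^+ 2 - c 0 0 0 * c 0 1 1)
       - g z 0 1 * (2 * c 0 0 1 * c 1 0 1 - c 0 0 0 * c 1 1 1 - c 1 0 0 * c 0 1 1)
       + g z 0 0 * (c 1 0 1 ^+ 2 - c 1 0 0 * c 1 1 1)) / dt) / dt.
Proof.
move=> Dz dt c.
have symf k : pd k (fun w => g w 1 0 : R^o) z = pd k (fun w => g w 0 1 : R^o) z.
  by apply: (@pd_on _ _ _ D) => // w Dw; rewrite g_sym.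
have dG l j k := diff_christoffel l j k Dz.
have lowered i j k : pd i (fun w => g w 0 0 : R^o) z * christoffel g 0 j k z +
   g z 0 0 * pd i (christoffel g 0 j k : 'rV[R]_2 -> R^o) z +
   (pd i (fun w => g w 0 1 : R^o) z * christoffel g 1 j k z +
   g z 0 1 * pd i (christoffel g 1 j k : 'rV[R]_2 -> R^o) z) = pd i (christ1 0 j k) z.
  have -> : pd i (christ1 0 j k) z =
    pd i (fun w => g w 0 0 * christoffel g 0 j k w + g w 0 1 * christoffel g 1 j k w : R^o) z.
    by apply: (@pd_on _ _ _ D) => // w Dw; rewrite christoffel_lower.
  rewrite pdD; [|by apply: differentiableM; [exact: dg|exact: dG]..].
  by rewrite (pdM i (@dg 0 0 _ Dz) (dG 0 j k)) (pdM i (@dg 0 1 _ Dz) (dG 1 j k)).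
have dc i : pd i (pd 1 (fun w => g w 0 1 : R^o)) z = pd i (pd 1 (fun w => g w 1 0 : R^o)) z.
  by apply: (@pd_on _ _ _ D) => // w Dw; apply: (@pd_on _ _ _ D) => // u Du; rewrite g_sym.
have C011 : pd 0 (christ1 0 1 1) z =
   pd 0 (pd 1 (fun w => g w 0 1 : R^o)) z - pd 0 (pd 0 (fun w => g w 1 1 : R^o)) z / 2.
  rewrite /christ1 pdM; [|exact: differentiable_cst|]; last first.
    by apply: differentiableB; [apply: differentiableD|]; exact: dpg.
  rewrite pd_cst mul0r add0r pdB; [|by apply: differentiableD; exact: dpg|exact: dpg].
  rewrite pdD; [|exact: dpg..].
  rewrite -dc; move: (pd 0 (pd 1 _) z) (pd 0 (pd 0 _) z) => x y.
  exact: half_double_sub.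
have C001 : pd 1 (christ1 0 0 1) z = pd 1 (pd 1 (fun w => g w 0 0 : R^o)) z / 2.
  have -> : pd 1 (christ1 0 0 1) z = pd 1 (fun u => 2^-1 * pd 1 (fun w => g w 0 0 : R^o) u : R^o) z.
    apply: (@pd_on _ _ _ D) => // w Dw; rewrite /christ1.
    have -> : pd 0 (fun w => g w 1 0 : R^o) w = pd 0 (fun w => g w 0 1 : R^o) w.
      by apply: (@pd_on _ _ _ D) => // u Du; rewrite g_sym.
    by rewrite addrAC subrr add0r.
  rewrite pdM; [|exact: differentiable_cst|exact: dpg].
  by rewrite pd_cst mul0r add0r mulrC.
have L0 := lowered 0 1 1; rewrite C011 in L0.
have L1 := lowered 1 0 1; rewrite C001 in L1.
have [dE d0 e000 e100] := christoffelE 0 0 Dz.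
have [_ _ e001 e101] := christoffelE 0 1 Dz.
have [_ _ e011 e111] := christoffelE 1 1 Dz.
have sym10 l : christoffel g l 1 0 z = christoffel g l 0 1 z.
  have c10 m : christ1 m 1 0 z = christ1 m 0 1 z.
    by rewrite /christ1 [pd 1 _ z + _]addrC symf.
  have [_ _ f0 f1] := christoffelE 1 0 Dz.
  by case: (ord2 l) => ->; rewrite ?f0 ?f1 ?e001 ?e101 !c10.
have half (x : R) : 2 * (2^-1 * x) = x by rewrite mulrA divff ?mul1r // pnatr_eq0.
rewrite /sectional_curvature /riemann_tensor !sum2 -dE -g_sym // !sym10.
apply: (sectional_algebra d0 _ _ _ _ e000 e100 e001 e101 e011 e111 L0 L1).
- by rewrite half addrK.
- by rewrite /c /christ1 symf; exact: half_cancel.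
- by rewrite half symf addrAC subrr add0r.
- by rewrite /c /christ1 symf; exact: half_cancel'.
Qed.

End SectionalCurvature.

(** * Chain rule and conformally flat targets *)

Lemma pd_comp (R : realType) m n (f : 'rV[R]_m -> 'rV[R]_n)
    (F : 'rV[R]_n -> R^o) z i :
  differentiable f z -> differentiable F (f z) ->
  pd i (fun w => F (f w) : R^o) z = \sum_k pd k F (f z) * pd i f z 0 k.
Proof.
move=> df dF; rewrite /pd deriveE; last exact: differentiable_comp.
rewrite (_ : (fun w => F (f w) : R^o) = F \o f) // diff_comp //= -!deriveE //.
by rewrite derive_pd //; apply: eq_bigr => k _; rewrite mulrC.
Qed.

Definition bil (R : pzRingType) n (H : 'M[R]_n) (u v : 'rV[R]_n) : R :=
  \sum_i \sum_j H i j * u 0 i * v 0 j.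

Lemma bilDl (R : comNzRingType) n (H : 'M[R]_n) (u u' v : 'rV[R]_n) :
  bil H (u + u') v = bil H u v + bil H u' v.
Proof.
rewrite -big_split; apply: eq_bigr => i _; rewrite -big_split; apply: eq_bigr => j _.
by rewrite !mxE mulrDr mulrDl.
Qed.

Lemma bilZl (R : comNzRingType) n (H : 'M[R]_n) a (u v : 'rV[R]_n) :
  bil H (a *: u) v = a * bil H u v.
Proof.
rewrite mulr_sumr; apply: eq_bigr => i _; rewrite mulr_sumr; apply: eq_bigr => j _.
by rewrite !mxE !mulrA; congr (_ * _ * _); rewrite mulrC.
Qed.

Lemma bilC (R : comNzRingType) n (H : 'M[R]_n) (u v : 'rV[R]_n) :
  (forall i j, H i j = H j i) -> bil H u v = bil H v u.
Proof.
move=> Hs; rewrite /bil exchange_big; apply: eq_bigr => i _; apply: eq_bigr => j _.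
by rewrite Hs mulrAC.
Qed.

Section ConformalTarget.
Variables (R : realType) (n : nat) (i0 : 'I_n).
Variables (V : set 'rV[R]_n) (G : 'rV[R]_n -> 'M[R]_n).
Local Notation Lam := (fun w => G w i0 i0 : R^o).
Hypothesis oV : open V.
Hypothesis sG : smooth_on V G.
Hypothesis G_conf : forall w, V w -> G w = G w i0 i0 *: 1%:M.
Hypothesis Lam_gt0 : forall w, V w -> 0 < Lam w.

Lemma smooth_Lam : smooth_on V Lam.
Proof. by move=> k; exact: Ck_on_coord. Qed.

Definition gradL w : 'rV[R]_n := \row_k pd k Lam w.
Definition hessL w : 'M[R]_n := \matrix_(i, j) pd i (pd j Lam) w.

Lemma hessL_sym w i j : V w -> hessL w i j = hessL w j i.
Proof. by move=> Vw; rewrite !mxE; apply: (@pd_swap _ _ _ V) => //; exact: smooth_Lam. Qed.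

Lemma inner_conf w u v : V w -> inner (G w) u v = Lam w * dot u v.
Proof.
move=> Vw; rewrite /inner G_conf // -scalemxAr mulmx1 -scalemxAl !mxE; congr (_ * _).
  by rewrite eqxx mulr1.
by apply: eq_bigr => k _; rewrite mxE.
Qed.

Lemma christoffel_conf k i j w : V w ->
  christoffel G k i j w = (2 * Lam w)^-1 *
   (gradL w 0 i * (j == k)%:R + gradL w 0 j * (i == k)%:R - gradL w 0 k * (i == j)%:R).
Proof.
move=> Vw; have L0 : Lam w != 0 by rewrite gt_eqF // Lam_gt0.
have pG a b c : pd a (fun w => G w b c : R^o) w = gradL w 0 a * (b == c)%:R.
  have -> : pd a (fun w => G w b c : R^o) w =
      pd a (fun u => Lam u * (b == c)%:R : R^o) w.
    by apply: (@pd_on _ _ _ V) => // u Vu; rewrite G_conf // !mxE eqxx mulr1.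
  rewrite pdM; [|by have [+ _] := smooth_Lam 1%N; apply|exact: differentiable_cst].
  by rewrite pd_cst mulr0 addr0 mxE.
rewrite /christoffel invfM -mulrA; congr (_ * _).
have -> : invmx (G w) = (Lam w)^-1 *: 1%:M.
  by rewrite {1}G_conf // !scalemx1 invmx_scalar.
rewrite (bigD1 k) //= big1 ?addr0 => [|a ak].
  by rewrite !pG !mxE eqxx mulr1.
by rewrite !mxE eq_sym (negbTE ak) mulr0 mul0r.
Qed.

(** The contribution of the Christoffel symbols to a covariant derivative. For [u], [v] tangent to
    the surface the first two terms are tangent as well, so only the gradient term reaches the
    second fundamental form. *)
Lemma christoffel_row w (u v : 'rV[R]_n) : V w ->
  \row_k (\sum_a \sum_b christoffel G k a b w * u 0 a * v 0 b) =
  (2 * Lam w)^-1 *: (dot (gradL w) u *: v + dot (gradL w) v *: u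
                     - dot u v *: gradL w).
Proof.
move=> Vw; apply/rowP => k; rewrite !mxE.
have delta (F : 'I_n -> R) c : \sum_b F b * (b == c)%:R = F c.
  rewrite (bigD1 c) //= eqxx mulr1 big1 ?addr0 // => b /negbTE ->; exact: mulr0.
under eq_bigr => a _ do under eq_bigr => b _ do rewrite christoffel_conf //.
set h := _^-1.
have -> : \sum_a \sum_b h * (gradL w 0 a * (b == k)%:R + gradL w 0 b * (a == k)%:R
      - gradL w 0 k * (a == b)%:R) * u 0 a * v 0 b =
  \sum_a (h * (gradL w 0 a * u 0 a * v 0 k + dot (gradL w) v * (u 0 a * (a == k)%:R)
   - gradL w 0 k * (u 0 a * v 0 a))).
  apply: eq_bigr => a _.
  transitivity (\sum_b h * (gradL w 0 a * u 0 a * v 0 b * (b == k)%:R +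
     gradL w 0 b * v 0 b * (u 0 a * (a == k)%:R) - gradL w 0 k * u 0 a * v 0 b * (b == a)%:R)).
    apply: eq_bigr => b _; rewrite (eq_sym a b); ring.
  rewrite -mulr_sumr sumrB big_split /= !delta -mulr_suml; congr (h * (_ + _ - _)).
  by rewrite mulrA.
rewrite -mulr_sumr sumrB big_split /= -mulr_suml -!mulr_sumr delta.
by rewrite [dot u v * _]mulrC [gradL w 0 k]mxE.
Qed.

Section Pullback.
Variables (m : nat) (D : set 'rV[R]_m) (f : 'rV[R]_m -> 'rV[R]_n).
Hypothesis oD : open D.
Hypothesis sf : smooth_on D f.
Hypothesis fV : forall z, D z -> V (f z).

Let df z : D z -> differentiable f z.
Proof. by move=> Dz; have [+ _] := sf 1%N; apply. Qed.
Let dpf i z : D z -> differentiable (pd i f) z.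
Proof. by move=> Dz; have [_ /(_ i) [+ _]] := sf 2%N; apply. Qed.

Definition lam z : R^o := G (f z) i0 i0.

Lemma diff_lam z : D z -> differentiable lam z.
Proof.
move=> Dz; apply: (@differentiable_comp _ _ _ _ f Lam); first exact: df.
by have [+ _] := smooth_Lam 1%N; apply; exact: fV.
Qed.

Lemma pd_lam i z : D z -> pd i lam z = dot (gradL (f z)) (pd i f z).
Proof.
move=> Dz; have dL : differentiable Lam (f z).
  by have [+ _] := smooth_Lam 1%N; apply; exact: fV.
apply: etrans (pd_comp i (df Dz) dL) _.
by apply: eq_bigr => k _; rewrite !mxE.
Qed.

Let dgrad k z : D z -> differentiable (fun z => pd k Lam (f z) : R^o) z.
Proof.
move=> Dz; apply: (@differentiable_comp _ _ _ _ f (pd k Lam)); first exact: df.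
by have [_ /(_ k) [+ _]] := smooth_Lam 2%N; apply; exact: fV.
Qed.

Lemma diff_pd_lam i z : D z -> differentiable (pd i lam) z.
Proof.
move=> Dz; apply: (@near_differentiable _ _ _
   (fun z => \sum_k pd k Lam (f z) * pd i f z 0 k : R^o)).
  apply: filterS (open_near oD Dz) => w Dw; rewrite pd_lam //.
  by apply: eq_bigr => k _; rewrite mxE.
apply: diff_sum => k; apply: differentiableM; first exact: dgrad.
exact/diff_coord/dpf.
Qed.

Lemma pd_pd_lam i j z : D z -> pd i (pd j lam) z =
  bil (hessL (f z)) (pd i f z) (pd j f z) + dot (gradL (f z)) (pd i (pd j f) z).
Proof.
move=> Dz.
have -> : pd i (pd j lam) z = pd i (fun z => \sum_k pd k Lam (f z) * pd j f z 0 k : R^o) z.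
  apply: (@pd_on _ _ _ D) => // w Dw; rewrite pd_lam //.
  by apply: eq_bigr => k _; rewrite mxE.
rewrite pd_sum; last first.
  by move=> k; apply: differentiableM; [exact: dgrad|exact/diff_coord/dpf].
rewrite /bil exchange_big -big_split; apply: eq_bigr => k _ /=.
rewrite pdM; [|exact: dgrad|exact/diff_coord/dpf].
rewrite (pd_coord 0 k i (dpf j Dz)).
rewrite [gradL _ _ _]mxE; congr (_ + _).
have dL : differentiable (pd k Lam) (f z).
  by have [_ /(_ k) [+ _]] := smooth_Lam 2%N; apply; exact: fV.
rewrite (pd_comp i (df Dz) dL).
by rewrite mulr_suml; apply: eq_bigr => a _; rewrite mxE.
Qed.

End Pullback.
End ConformalTarget.

Section DotOrder.
Variables (R : realDomainType) (n : nat).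
Implicit Types u v w : 'rV[R]_n.

Lemma dot_ge0 v : 0 <= dot v v.
Proof. by apply: sumr_ge0 => k _; rewrite -expr2 sqr_ge0. Qed.

Lemma sqr_le_dot v k : v 0 k ^+ 2 <= dot v v.
Proof.
rewrite /dot (bigD1 k) //= -expr2 lerDl.
by apply: sumr_ge0 => i _; rewrite -expr2 sqr_ge0.
Qed.

Lemma dot_eq0 v : (dot v v == 0) = (v == 0).
Proof.
apply/eqP/eqP => [v0|->]; last by rewrite /dot big1 // => k _; rewrite mxE mul0r.
apply/rowP => k; rewrite mxE; apply/eqP; rewrite -sqrf_eq0.
by rewrite eq_le sqr_ge0 andbT -v0 sqr_le_dot.
Qed.

(** The vector [w] is |v|^2 times the part of [u] orthogonal to [v], and |w|^2 is |v|^2 times the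
    Gram determinant. A nonzero 2 x 2 minor excludes w = 0. *)
Lemma gram_det_gt0 (u v : 'rV[R]_n) i j :
  u 0 i * v 0 j - u 0 j * v 0 i != 0 ->
  0 < dot u u * dot v v - dot u v ^+ 2.
Proof.
move=> J0; have v0 : 0 < dot v v.
  rewrite lt_neqAle dot_ge0 andbT eq_sym dot_eq0; apply: contraNneq J0 => ->.
  by rewrite !mxE !mulr0 subrr.
pose w := dot v v *: u - dot u v *: v.
have w0 : w != 0.
  apply: contraNneq J0 => /rowP w0.
  have h k : dot v v * u 0 k = dot u v * v 0 k.
    by apply/eqP; rewrite -subr_eq0; have := w0 k; rewrite !mxE => ->.
  apply/eqP; apply: (mulfI (lt0r_neq0 v0)).
  by rewrite mulr0 mulrBr !mulrA !h mulrAC subrr.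
rewrite -(pmulr_rgt0 _ v0).
have -> : dot v v * (dot u u * dot v v - dot u v ^+ 2) = dot w w.
  by rewrite /w !dotE (dotC v u); ring.
by rewrite lt_neqAle dot_ge0 andbT eq_sym dot_eq0.
Qed.

End DotOrder.

(** * Second derivatives of real functions in Wirtinger form *)

Lemma wirtinger_second_algebra (K : realFieldType) (x y w : K) :
  [/\ x = 2 * (2^-1 * (2^-1 * x + - 2^-1 * y)) + 2 * (2^-1 * (2^-1 * x - - 2^-1 * y)),
      y = - (2 * (2^-1 * (2^-1 * x + - 2^-1 * y))) + 2 * (2^-1 * (2^-1 * x - - 2^-1 * y)) &
      w = - (2 * (2^-1 * (- 2^-1 * w - 2^-1 * w)))].
Proof. by split; field. Qed.

Section WirtingerReal.
Variable R : realType.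
Implicit Types (F : 'rV[R]_2 -> R[i]) (f : 'rV[R]_2 -> R^o) (z : 'rV[R]_2).
Local Notation Re := (@complex.Re R).
Local Notation Im := (@complex.Im R).

Lemma half_complex : (2^-1 : R[i]) = (2^-1)%:C.
Proof. by rewrite fmorphV rmorph_nat. Qed.

Lemma cReZ (a : R) (x : R[i]) : Re (a%:C * x) = a * Re x.
Proof. by case: x => b b'; rewrite /= mul0r subr0. Qed.

Lemma cImZ (a : R) (x : R[i]) : Im (a%:C * x) = a * Im x.
Proof. by case: x => b b'; rewrite /= mul0r addr0. Qed.

Lemma cRe_i (x : R[i]) : Re ('i%C * x) = - Im x.
Proof. by case: x => b b'; rewrite /= mul0r mul1r sub0r. Qed.

Lemma cIm_i (x : R[i]) : Im ('i%C * x) = Re x.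
Proof. by case: x => b b'; rewrite /= mul0r mul1r add0r. Qed.

Lemma cRe_comb (a : R) (x y u v : R[i]) : Re (a%:C * (x * y + u * v)) =
  a * (Re x * Re y - Im x * Im y + (Re u * Re v - Im u * Im v)).
Proof. by rewrite cReZ cReD !cReM. Qed.

Lemma cIm_comb (a : R) (x y u v : R[i]) : Im (a%:C * (x * y + u * v)) =
  a * (Re x * Im y + Im x * Re y + (Re u * Im v + Im u * Re v)).
Proof. by rewrite cImZ cImD !cImM. Qed.

Lemma Re_dz F z : Re (dz F z) = 2^-1 *
  (pd 0 (fun w => Re (F w) : R^o) z + pd 1 (fun w => Im (F w) : R^o) z).
Proof. by rewrite /dz half_complex cReZ cReD cReN cRe_i opprK. Qed.

Lemma Im_dz F z : Im (dz F z) = 2^-1 *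
  (pd 0 (fun w => Im (F w) : R^o) z - pd 1 (fun w => Re (F w) : R^o) z).
Proof. by rewrite /dz half_complex cImZ cImD cImN cIm_i. Qed.

Lemma Re_dzbar F z : Re (dzbar F z) = 2^-1 *
  (pd 0 (fun w => Re (F w) : R^o) z - pd 1 (fun w => Im (F w) : R^o) z).
Proof. by rewrite /dzbar half_complex cReZ cReD cRe_i. Qed.

Lemma Re_dz_real f z : Re (dz (fun w => (f w)%:C) z) = 2^-1 * pd 0 f z.
Proof. by rewrite Re_dz /= pd_cst addr0. Qed.

Lemma Im_dz_real f z : Im (dz (fun w => (f w)%:C) z) = - (2^-1 * pd 1 f z).
Proof. by rewrite Im_dz /= pd_cst sub0r mulrN. Qed.

(** Solves dz dz f = (f_00 - f_11 - 2i f_01) / 4 and dzbar dz f = (f_00 + f_11) / 4 for the real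
    derivatives. The second is real, being a quarter of the Laplacian. *)
Lemma wirtinger_second (D : set 'rV[R]_2) f z : open D -> Ck_on 2 D f -> D z ->
  let A := dz (dz (fun w => (f w)%:C)) z in
  let B := Re (dzbar (dz (fun w => (f w)%:C)) z) in
  [/\ pd 0 (pd 0 f) z = 2 * Re A + 2 * B, pd 1 (pd 1 f) z = - (2 * Re A) + 2 * B,
      pd 0 (pd 1 f) z = - (2 * Im A) & pd 1 (pd 0 f) z = - (2 * Im A)].
Proof.
move=> oD Cf Dz A B; have sw := pd_swap 0 1 oD Cf Dz.
have [_ pf] := Cf.
have dp i : differentiable (pd i f) z by have [+ _] := pf i; apply.
have ER : (fun w => Re (dz (fun w => (f w)%:C) w) : R^o) = fun w => 2^-1 * pd 0 f w.
  by apply/funext => w; rewrite Re_dz_real.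
have EI : (fun w => Im (dz (fun w => (f w)%:C) w) : R^o) = fun w => - 2^-1 * pd 1 f w.
  by apply/funext => w; rewrite Im_dz_real mulNr.
have pc i j (a : R) : pd i (fun w => a * pd j f w : R^o) z = a * pd i (pd j f) z.
  rewrite (pdM _ (differentiable_cst _ _) (dp j)).
  by rewrite pd_cst mul0r add0r.
have RA : Re A = 2^-1 * (2^-1 * pd 0 (pd 0 f) z + - 2^-1 * pd 1 (pd 1 f) z).
  by rewrite /A Re_dz ER EI !pc.
have IA : Im A = 2^-1 * (- 2^-1 * pd 0 (pd 1 f) z - 2^-1 * pd 1 (pd 0 f) z).
  by rewrite /A Im_dz ER EI !pc.
have RB : B = 2^-1 * (2^-1 * pd 0 (pd 0 f) z - - 2^-1 * pd 1 (pd 1 f) z).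
  rewrite /B Re_dzbar ER EI !pc.
  reflexivity.
rewrite sw in IA *.
clearbody A B.
have [h1 h2 h3] := wirtinger_second_algebra (pd 0 (pd 0 f) z) (pd 1 (pd 1 f) z) (pd 1 (pd 0 f) z).
rewrite RA IA RB.
by split.
Qed.

End WirtingerReal.

(** * Derivatives of the map through d and l, and the oblique projection *)

Section BranchData.
Variables (R : realType) (n : nat) (hn : (3 <= n)%N) (s : nat).
Variables (D : set 'rV[R]_2) (fh : 'rV[R]_2 -> 'rV[R]_n).
Variables (d : 'rV[R]_2 -> 'rV[R[i]]_n) (l : 'rV[R]_2 -> 'rV[R]_n).
Local Notation Re := (@complex.Re R).
Local Notation Im := (@complex.Im R).
Local Notation k1 := (first hn).
Local Notation k2 := (second hn).

Hypothesis oD : open D.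
Hypothesis D0 : D 0.
Hypothesis sfh : smooth_on D fh.
Hypothesis sdR : smooth_on D (fun z => map_mx Re (d z)).
Hypothesis sdI : smooth_on D (fun z => map_mx Im (d z)).
Hypothesis sl : smooth_on D l.
Hypothesis dz_fh : forall z, D z -> forall k,
  dz (coordC fh k) z = s.+1%:R * toC z ^+ s * d z 0 k.
Hypothesis dzbar_dz_fh : forall z, D z -> forall k,
  dzbar (dz (coordC fh k)) z = (modC (toC z) ^+ (2 * s) * l z 0 k)%:C.

Definition e1 z : 'rV[R]_n := map_mx Re (d z).
Definition e2 z : 'rV[R]_n := map_mx Im (d z).
Definition zr z : R := Re (toC z ^+ s).
Definition zi z : R := Im (toC z ^+ s).
Local Notation c := (s.+1%:R : R).

Lemma csmooth_d k : csmooth D (fun z => d z 0 k).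
Proof.
split=> j.
  apply: (@Ck_on_ext _ _ _ _ _ (fun z => map_mx Re (d z) 0 k : R^o)) => //.
    by move=> w _; rewrite mxE.
  by apply: Ck_on_coord; [|exact: sdR].
apply: (@Ck_on_ext _ _ _ _ _ (fun z => map_mx Im (d z) 0 k : R^o)) => //.
  by move=> w _; rewrite mxE.
by apply: Ck_on_coord; [|exact: sdI].
Qed.

Lemma natC_complex m : (m%:R : R[i]) = (m%:R)%:C.
Proof. by rewrite rmorph_nat. Qed.

Lemma pd0_fh z : D z -> pd 0 fh z = (2 * c) *: (zr z *: e1 z - zi z *: e2 z).
Proof.
move=> Dz; apply/rowP => k; have dfh : differentiable fh z.
  by have [+ _] := sfh 1%N; apply.
have := Re_dz_real (fun w => fh w 0 k) z.
rewrite -/(coordC fh k) (dz_fh Dz) -mulrA natC_complex cReZ cReM.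
rewrite (pd_coord 0 k 0 dfh) !mxE => h.
by rewrite -mulrA h mulrA divff ?mul1r // pnatr_eq0.
Qed.

Lemma pd1_fh z : D z -> pd 1 fh z = (- (2 * c)) *: (zi z *: e1 z + zr z *: e2 z).
Proof.
move=> Dz; apply/rowP => k; have dfh : differentiable fh z.
  by have [+ _] := sfh 1%N; apply.
have := Im_dz_real (fun w => fh w 0 k) z.
rewrite -/(coordC fh k) (dz_fh Dz) -mulrA natC_complex cImZ cImM.
rewrite (pd_coord 0 k 1 dfh) !mxE => h.
have {h} h : c * (zr z * Im (d z 0 k) + zi z * Re (d z 0 k)) = - (2^-1 * pd 1 fh z 0 k) by [].
rewrite addrC mulNr -mulrA h mulrN opprK mulrA divff ?mul1r // pnatr_eq0.
Qed.

Definition v1 z : 'rV[R]_n := \row_k Re (dz (fun w => d w 0 k) z).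
Definition v2 z : 'rV[R]_n := \row_k Im (dz (fun w => d w 0 k) z).

(** Differentiating (s+1) z^s d gives (s+1) (s z^(s-1) d + z^s dz d). The witness [t] is s z^(s-1);
    it multiplies [e1] and [e2], so its term is removed by [perp]. *)
Lemma second_fh z : D z -> let n2 := zr z ^+ 2 + zi z ^+ 2 in
  exists2 t : R * R,
   let A1 := c *: (t.1 *: e1 z - t.2 *: e2 z + (zr z *: v1 z - zi z *: v2 z)) in
   let A2 := c *: (t.1 *: e2 z + t.2 *: e1 z + (zr z *: v2 z + zi z *: v1 z)) in
   [/\ pd 0 (pd 0 fh) z = 2 *: A1 + (2 * n2) *: l z,
       pd 1 (pd 1 fh) z = - (2 *: A1) + (2 * n2) *: l z,
       pd 0 (pd 1 fh) z = - (2 *: A2) & pd 1 (pd 0 fh) z = - (2 *: A2)] & True.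
Proof.
move=> Dz n2; exists (Re (s%:R * toC z ^+ s.-1), Im (s%:R * toC z ^+ s.-1)) => //.
move=> A1 A2.
have C2 k : Ck_on 2 D (fun w => fh w 0 k : R^o) by apply: Ck_on_coord.
have pp i j k : pd i (pd j fh) z 0 k = pd i (pd j (fun w => fh w 0 k : R^o)) z.
  have dpf : differentiable (pd j fh) z by have [_ /(_ j) [+ _]] := sfh 2%N; apply.
  rewrite -(pd_coord 0 k i dpf); apply: (@pd_on _ _ _ D) => // w Dw.
  by rewrite pd_coord //; have [+ _] := sfh 1%N; apply.
have n2E : modC (toC z) ^+ (2 * s) = n2.
  by rewrite mulnC exprM -modCX modC_sqr.
have H k := wirtinger_second oD (C2 k) Dz.
have HB k : Re (dzbar (dz (fun w => (fh w 0 k)%:C)) z) = n2 * l z 0 k.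
  by have := dzbar_dz_fh Dz k; rewrite /coordC => ->; rewrite n2E.
have HA k : dz (dz (fun w => (fh w 0 k)%:C)) z =
   s.+1%:R * (s%:R * toC z ^+ s.-1 * d z 0 k + toC z ^+ s * dz (fun w => d w 0 k) z).
  have -> : dz (dz (fun w => (fh w 0 k)%:C)) z =
      dz (fun w => s.+1%:R * (toC w ^+ s * d w 0 k)) z.
    by apply: (@dz_on _ D) => // w Dw; have := dz_fh Dw k; rewrite /coordC mulrA.
  have dd := csmooth_diff Dz (csmooth_d k).
  by rewrite (dzZ _ (cdiffM (cdiff_toCX s z) dd)) (dzM (cdiff_toCX s z) dd) dz_toCX.
have HA1 k : Re (dz (dz (fun w => (fh w 0 k)%:C)) z) = A1 0 k.
  by rewrite HA natC_complex cRe_comb /A1 !mxE.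
have HA2 k : Im (dz (dz (fun w => (fh w 0 k)%:C)) z) = A2 0 k.
  by rewrite HA natC_complex cIm_comb /A2 !mxE.
split; apply/rowP => k; rewrite pp; have [h00 h11 h01 h10] := H k.
- by rewrite h00 HA1 HB [2 * (n2 * _)]mulrA [RHS]mxE; congr (_ + _); rewrite [RHS]mxE.
- rewrite h11 HA1 HB [2 * (n2 * _)]mulrA [RHS]mxE; congr (_ + _); rewrite [RHS]mxE //.
  by congr (- _); rewrite [RHS]mxE.
- by rewrite h01 HA2 [RHS]mxE; congr (- _); rewrite [RHS]mxE.
- by rewrite h10 HA2 [RHS]mxE; congr (- _); rewrite [RHS]mxE.
Qed.

Hypothesis Jneq0 : forall z, D z ->
  e1 z 0 k1 * e2 z 0 k2 - e1 z 0 k2 * e2 z 0 k1 != 0.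

Lemma csmooth_l k : csmooth D (fun z => (l z 0 k / c)%:C).
Proof.
apply: csmooth_real => j; apply: Ck_onM => //; first exact: Ck_on_coord.
exact: Ck_on_cst.
Qed.

Lemma csmooth_eq0 F : csmooth D F -> (forall z, D z -> z != 0 -> F z = 0) -> F 0 = 0.
Proof.
move=> [sR sI] F0.
have real (f : 'rV[R]_2 -> R^o) : smooth_on D f ->
    (forall z, D z -> z != 0 -> f z = 0) -> f 0 = 0.
  move=> sf f0; apply/eqP; apply: contraT => f00.
  have f0_gt0 : 0 < `|f 0| by rewrite normr_gt0.
  have [r r0 rf] := continuous_ball f0_gt0 (sf 0%N 0 D0).
  have [r' r'0 rD] := open_ball oD D0.
  pose t := Num.min r r' / 2.
  have m0 : 0 < Num.min r r' by rewrite lt_min r0.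
  have t0 : 0 < t by rewrite divr_gt0.
  have nt : `|t *: const_mx 1 : 'rV[R]_2| < Num.min r r'.
    apply: (@le_lt_trans _ _ t); last by rewrite /t ltr_pdivrMr // ltr_pMr // ltr1n.
    rewrite normrZ gtr0_norm // ler_piMr ?(ltW t0) //.
    rewrite [leLHS]/Num.Def.normr/= mx_normrE; apply/bigmax_le => // ij _.
    by rewrite mxE normr1.
  have tn0 : t *: const_mx 1 != 0 :> 'rV[R]_2.
    by apply/eqP => /rowP /(_ 0); rewrite !mxE mulr1 => t00; move: t0; rewrite t00 ltxx.
  move: nt; rewrite lt_min => /andP[nr nr'].
  have Dt : D (t *: const_mx 1) by apply: rD; rewrite sub0r normrN.
  have := rf (t *: const_mx 1); rewrite sub0r normrN => /(_ nr).
  by rewrite (f0 _ Dt tn0) subr0 ltxx.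
have RF : Re (F 0) = 0 by apply: (real (fun z => Re (F z))) => // z Dz z0; rewrite F0.
have IF : Im (F 0) = 0 by apply: (real (fun z => Im (F z))) => // z Dz z0; rewrite F0.
by move: RF IF; case: (F 0) => a b /= -> ->.
Qed.

Lemma real_complexM (a b : R) : (a * b)%:C = a%:C * b%:C.
Proof. exact: rmorphM. Qed.

Lemma real_complexV (a : R) : (a^-1)%:C = a%:C^-1.
Proof. exact: fmorphV. Qed.

Lemma real_complexB (a b : R) : (a - b)%:C = a%:C - b%:C.
Proof. exact: rmorphB. Qed.

Lemma real_complexX (a : R) k : (a ^+ k)%:C = a%:C ^+ k.
Proof. exact: rmorphXn. Qed.

Lemma modC_mulJ (x : R[i]) : (modC x ^+ 2)%:C = x * conjc x.
Proof. by rewrite modC_sqr add_Re2_Im2 sqr_normc. Qed.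

(** Off 0, divide dzbar dz f^ = |z|^(2s) l by (s+1) z^s, using |z|^2 = z conj(z). Both sides are
    smooth, so equality passes to 0 by continuity. *)
Lemma dzbar_d k z : D z ->
  dzbar (fun z => d z 0 k) z = conjc (toC z) ^+ s * (l z 0 k / c)%:C.
Proof.
have c0 : (s.+1%:R : R[i]) != 0 by rewrite pnatr_eq0.
have off z' : D z' -> z' != 0 ->
    dzbar (fun z => d z 0 k) z' = conjc (toC z') ^+ s * (l z' 0 k / c)%:C.
  move=> Dz z0; have dd := csmooth_diff Dz (csmooth_d k).
  have zs : toC z' ^+ s != 0 by rewrite expf_neq0 // toC_eq0.
  have := dzbar_dz_fh Dz k.
  have -> : dzbar (dz (coordC fh k)) z' =
      dzbar (fun w => s.+1%:R * (toC w ^+ s * d w 0 k)) z'.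
    by apply: (@dzbar_on _ D) => // w Dw; rewrite dz_fh // mulrA.
  rewrite (dzbarZ _ (cdiffM (cdiff_toCX s z') dd)) (dzbarM (cdiff_toCX s z') dd).
  rewrite dzbar_toCX mul0r add0r exprM real_complexM real_complexX modC_mulJ exprMn => h.
  apply: (mulfI c0); apply: (mulfI zs); rewrite mulrCA h -mulrA; congr (_ * _).
  rewrite mulrCA; congr (_ * _); rewrite natC_complex -real_complexM; congr (_%:C).
  by rewrite mulrC mulfVK // pnatr_eq0.
have [->|z0] := eqVneq z 0; last by move=> Dz; exact: off.
move=> _; apply/eqP; rewrite -subr_eq0; apply/eqP.
apply: (@csmooth_eq0 (fun z => dzbar (fun z => d z 0 k) z -
  conjc (toC z) ^+ s * (l z 0 k / c)%:C)); last first.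
  by move=> w Dw w0; rewrite off // subrr.
apply: csmoothD => //; first by apply: csmooth_dzbar => //; exact: csmooth_d.
apply: csmoothN => //; apply: csmoothM => //; last exact: csmooth_l.
apply: (@csmooth_ext _ D (fun w => conjc (toC w ^+ s))) => //.
  by move=> w _; rewrite rmorphXn.
by apply: csmooth_conj => //; exact: csmooth_toCX.
Qed.

Definition wd z k : R[i] := dz (fun w => d w 0 k) z.
Definition jac z : R := e1 z 0 k1 * e2 z 0 k2 - e1 z 0 k2 * e2 z 0 k1.
(** Cramer's rule: with [cX] and [cY], the vector X e1 + Y e2 agrees with dz d in the first two
    coordinates. The coefficients are complex, the vectors real. *)
Definition cX z : R[i] :=
  (wd z k1 * (e2 z 0 k2)%:C - wd z k2 * (e2 z 0 k1)%:C) * ((jac z)^-1)%:C.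
Definition cY z : R[i] :=
  (wd z k2 * (e1 z 0 k1)%:C - wd z k1 * (e1 z 0 k2)%:C) * ((jac z)^-1)%:C.

(* [cc k] is the value at the branch point of the k-th coefficient, where
   division by [toC z ^+ s] gives 0; away from 0 the result does not depend
   on [cc]. *)
Definition cU (cc : 'I_n -> R[i]) z (k : 'I_n) : R[i] :=
  if (2 <= k)%N then
    cc k + (wd z k - cc k * toC z ^+ s) / toC z ^+ s
    - cX z * ((e1 z 0 k)%:C / toC z ^+ s) - cY z * ((e2 z 0 k)%:C / toC z ^+ s)
  else 0.

Lemma ord_lt2 (k : 'I_n) : (2 <= k)%N = false -> k = k1 \/ k = k2.
Proof.
case: k => -[|[|//]] h _; [left|right]; exact: val_inj.
Qed.

Lemma oblique_algebra (K : fieldType) (w e f c z x y : K) : z != 0 ->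
  w = x * e + y * f + z * (c + (w - c * z) / z - x * (e / z) - y * (f / z)).
Proof. by move=> z0; field. Qed.

Lemma cramer1 (K : fieldType) (w w' a a' b b' : K) : a * b' - a' * b != 0 ->
  (w * b' - w' * b) * (a * b' - a' * b)^-1 * a +
  (w' * a - w * a') * (a * b' - a' * b)^-1 * b = w.
Proof. by move=> j0; field. Qed.

Lemma cramer2 (K : fieldType) (w w' a a' b b' : K) : a * b' - a' * b != 0 ->
  (w * b' - w' * b) * (a * b' - a' * b)^-1 * a' +
  (w' * a - w * a') * (a * b' - a' * b)^-1 * b' = w'.
Proof. by move=> j0; field. Qed.

(** For [2 <= k] this inverts the definition of [cU]; in the first two coordinates, where [cU] is 0,
    it is Cramer's rule. *)
Lemma cU_decomp cc z k : D z -> z != 0 ->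
  wd z k = cX z * (e1 z 0 k)%:C + cY z * (e2 z 0 k)%:C + toC z ^+ s * cU cc z k.
Proof.
move=> Dz z0; have zs : toC z ^+ s != 0 by rewrite expf_neq0 // toC_eq0.
rewrite /cU; case: ifP => [_|/ord_lt2 k12].
  exact: oblique_algebra.
rewrite mulr0 addr0 /cX /cY /jac real_complexV real_complexB !real_complexM.
have J : (e1 z 0 k1)%:C * (e2 z 0 k2)%:C - (e1 z 0 k2)%:C * (e2 z 0 k1)%:C != 0 :> R[i].
  by rewrite -!real_complexM -real_complexB fmorph_eq0 Jneq0.
by case: k12 => ->; [rewrite cramer1|rewrite cramer2].
Qed.

Definition u1 cc z : 'rV[R]_n := \row_k Re (cU cc z k).
Definition u2 cc z : 'rV[R]_n := \row_k Im (cU cc z k).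

Lemma v_decomp cc z : D z -> z != 0 ->
  v1 z = Re (cX z) *: e1 z + Re (cY z) *: e2 z + (zr z *: u1 cc z - zi z *: u2 cc z) /\
  v2 z = Im (cX z) *: e1 z + Im (cY z) *: e2 z + (zr z *: u2 cc z + zi z *: u1 cc z).
Proof.
move=> Dz z0; split; apply/rowP => k; rewrite [LHS]mxE -/(wd z k) (cU_decomp cc k Dz z0).
  rewrite !cReD [_ * (e1 z 0 k)%:C]mulrC [_ * (e2 z 0 k)%:C]mulrC !cReZ cReM !mxE.
  by rewrite [_ * Re (cX z)]mulrC [_ * Re (cY z)]mulrC.
rewrite !cImD [_ * (e1 z 0 k)%:C]mulrC [_ * (e2 z 0 k)%:C]mulrC !cImZ cImM !mxE.
by rewrite [_ * Im (cX z)]mulrC [_ * Im (cY z)]mulrC.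
Qed.

End BranchData.

(** * Vector-valued derivatives and metrics proportional to a Gram matrix *)

Section PdVector.
Variables (R : realType) (m n : nat) (D : set 'rV[R]_m).
Hypothesis oD : open D.

Lemma pd_dot (A B : 'rV[R]_m -> 'rV[R]_n) z k :
  differentiable A z -> differentiable B z ->
  pd k (fun w => dot (A w) (B w) : R^o) z = dot (pd k A z) (B z) + dot (pd k B z) (A z).
Proof.
move=> dA dB; rewrite pd_sum; last first.
  by move=> j; apply: differentiableM; exact: diff_coord.
rewrite -big_split; apply: eq_bigr => j _ /=.
by rewrite (pdM _ (diff_coord 0 j dA) (diff_coord 0 j dB)) !pd_coord // [A z 0 j * _]mulrC.
Qed.

Lemma diff_dot (A B : 'rV[R]_m -> 'rV[R]_n) z :
  differentiable A z -> differentiable B z ->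
  differentiable (fun w => dot (A w) (B w) : R^o) z.
Proof.
by move=> dA dB; apply: diff_sum => j; apply: differentiableM; exact: diff_coord.
Qed.

Lemma pd_swapV (f : 'rV[R]_m -> 'rV[R]_n) z i j : Ck_on 2 D f -> D z ->
  pd i (pd j f) z = pd j (pd i f) z.
Proof.
move=> Cf Dz; apply/rowP => k; have [df pf] := Cf.
have E a b : pd a (pd b f) z 0 k = pd a (pd b (fun w => f w 0 k : R^o)) z.
  have dpf : differentiable (pd b f) z by have [+ _] := pf b; apply.
  rewrite -(pd_coord 0 k a dpf); apply: (@pd_on _ _ _ D) => // w Dw.
  by rewrite (pd_coord 0 k b (df _ Dw)).
apply: etrans (E i j) (etrans _ (esym (E j i))).
exact: (pd_swap i j oD (Ck_on_coord 0 k oD Cf) Dz).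
Qed.

End PdVector.

Lemma combination_coord (K : comNzRingType) n (A : 'M[K]_2) (b : 'I_2 -> K)
    (F : 'I_2 -> 'rV[K]_n) (v : 'rV[K]_n) k :
  (v - \sum_i \sum_j (A i j * b i) *: F j) 0 k =
  v 0 k - \sum_i \sum_j A i j * b i * F j 0 k.
Proof.
rewrite !mxE summxE; congr (_ - _); apply: eq_bigr => i _; rewrite summxE.
by apply: eq_bigr => j _; rewrite mxE.
Qed.

Lemma mean_coord (K : comNzRingType) n a (A : 'M[K]_2)
    (S : 'I_2 -> 'I_2 -> 'rV[K]_n) k :
  (a *: \sum_i \sum_j A i j *: S i j) 0 k = a * \sum_i \sum_j A i j * S i j 0 k.
Proof.
rewrite mxE summxE; congr (_ * _); apply: eq_bigr => i _; rewrite summxE.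
by apply: eq_bigr => j _; rewrite mxE.
Qed.

(** Normal part of an expression of the form in [christoffel_row], with [b] and [b'] tangential. *)
Lemma perp_conformal (K : fieldType) n (a0 a1 w b b' g : 'rV[K]_n) (h x y m : K) :
  perp a0 a1 b = 0 -> perp a0 a1 b' = 0 ->
  perp a0 a1 (w + h *: (x *: b' + y *: b - m *: g)) =
  perp a0 a1 w - (m * h) *: perp a0 a1 g.
Proof.
move=> b0 b'0; rewrite perpD; congr (_ + _).
rewrite perpZ perpB perpD !perpZ b0 b'0 !scaler0 addr0 sub0r.
by rewrite scalerN scalerA mulrC.
Qed.

Section ImmersionAlgebra.
Variable K : fieldType.
Implicit Types x y w t g : K.

Lemma scaled_det_algebra x y w t :
  t * x * (t * y) - t * w * (t * w) = t ^+ 2 * (x * y - w ^+ 2).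
Proof. ring. Qed.

Lemma scaled_inv_algebra x t g : t != 0 -> g != 0 ->
  t * x / (t ^+ 2 * g) = x / (t * g).
Proof. by move=> t0 g0; field; rewrite t0 g0. Qed.

Lemma scaled_inv_algebraN x t g : t != 0 -> g != 0 ->
  - (t * x) / (t ^+ 2 * g) = - x / (t * g).
Proof. by move=> t0 g0; field; rewrite t0 g0. Qed.

Lemma normal_part_algebra E F H x y a b w t g : t != 0 -> g != 0 ->
  w - (H / (t * g) * (t * x) * a + - F / (t * g) * (t * x) * b +
       (- F / (t * g) * (t * y) * a + E / (t * g) * (t * y) * b)) =
  w - (H * x - F * y) / g * a - (E * y - F * x) / g * b.
Proof. by move=> t0 g0; field; rewrite t0 g0. Qed.

Lemma gauss_kronecker_algebra b00 b01 b10 b11 t g : t != 0 -> g != 0 ->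
  (t ^+ 2 * g)^-1 * (t * b00 * (t * b11) - t * b01 * (t * b10)) =
  (b00 * b11 - b01 * b10) / g.
Proof. by move=> t0 g0; field; rewrite t0 g0. Qed.

Lemma mean_curvature_algebra (n0 n1 n2 n3 t E F H : K) : (2 : K) != 0 ->
  t != 0 -> E * H - F ^+ 2 != 0 ->
  2^-1 * (H / (t * (E * H - F ^+ 2)) * (n0 - E * (2 * t)^-1 * n3) +
          - F / (t * (E * H - F ^+ 2)) * (n1 - F * (2 * t)^-1 * n3) +
         (- F / (t * (E * H - F ^+ 2)) * (n1 - F * (2 * t)^-1 * n3) +
          E / (t * (E * H - F ^+ 2)) * (n2 - H * (2 * t)^-1 * n3))) =
  (2 * t)^-1 * ((H * n0 - 2 * F * n1 + E * n2) / (E * H - F ^+ 2) - t^-1 * n3).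
Proof. by move=> t20 t0 g0; field; rewrite t0 t20 g0. Qed.

End ImmersionAlgebra.

Section ScaledGram.
Variables (K : fieldType) (n : nat) (g : 'M[K]_2) (F : 'I_2 -> 'rV[K]_n) (t : K).
Hypothesis gE : forall i j, g i j = t * dot (F i) (F j).
Hypothesis t0 : t != 0.
Hypothesis gram0 : gram_det (F 0) (F 1) != 0.

Lemma det_scaled_gram : \det g = t ^+ 2 * gram_det (F 0) (F 1).
Proof. by rewrite det2 !gE /gram_det (dotC (F 1)) scaled_det_algebra. Qed.

Lemma inv_scaled_gram : let d := t * gram_det (F 0) (F 1) in
  [/\ invmx g 0 0 = dot (F 1) (F 1) / d, invmx g 0 1 = - dot (F 0) (F 1) / d,
      invmx g 1 0 = - dot (F 0) (F 1) / d & invmx g 1 1 = dot (F 0) (F 0) / d].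
Proof.
have dn0 : \det g != 0 by rewrite det_scaled_gram mulf_neq0 // expf_neq0.
have [-> -> -> ->] := invmx2 dn0; rewrite det_scaled_gram !gE (dotC (F 1) (F 0)).
by split; [exact: scaled_inv_algebra|exact: scaled_inv_algebraN|
  exact: scaled_inv_algebraN|exact: scaled_inv_algebra].
Qed.

(** The factor [t] of the product cancels that of the inverse metric: conformal metrics have the
    same orthogonal projection. *)
Lemma normal_scaled_gram v :
  v - \sum_i \sum_j (invmx g i j * (t * dot v (F i))) *: F j = perp (F 0) (F 1) v.
Proof.
apply/rowP => k; rewrite combination_coord !sum2.
have [-> -> -> ->] := inv_scaled_gram; rewrite /perp !mxE.
exact: normal_part_algebra.
Qed.

Lemma gauss_kronecker_scaled (B : 'M[K]_2) (b : 'I_2 -> 'I_2 -> K) :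
  (forall i j, B i j = t * b i j) ->
  \det (invmx g *m B) = (b 0 0 * b 1 1 - b 0 1 * b 1 0) / gram_det (F 0) (F 1).
Proof.
move=> BE; rewrite det_mulmx det_inv det_scaled_gram [X in _ * X]det2 !BE.
exact: gauss_kronecker_algebra.
Qed.

Lemma mean_curvature_scaled (S N : 'I_2 -> 'I_2 -> 'rV[K]_n) (P : 'rV[K]_n) k :
  (2 : K) != 0 -> N 1 0 = N 0 1 ->
  (forall i j, S i j = N i j - (dot (F i) (F j) * (2 * t)^-1) *: P) ->
  (2^-1 *: \sum_i \sum_j invmx g i j *: S i j) 0 k =
  (2 * t)^-1 * ((dot (F 1) (F 1) * N 0 0 0 k - 2 * dot (F 0) (F 1) * N 0 1 0 k +
    dot (F 0) (F 0) * N 1 1 0 k) / gram_det (F 0) (F 1) - t^-1 * P 0 k).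
Proof.
move=> n2 sw SE; rewrite mean_coord !sum2.
have [-> -> -> ->] := inv_scaled_gram; rewrite !SE sw (dotC (F 1) (F 0)) !mxE.
exact: mean_curvature_algebra.
Qed.

End ScaledGram.

(** * From derivatives of the metric to the Gauss equation *)

Section SectionalAssembly.
Variable K : realFieldType.
Variables (lam lam0 lam1 lam00 lam01 lam11 E F G nu : K).
Variables (x00 x01 x11 y00 y01 y11 T1 T2 a0011 a0101 : K).
Variables (c000 c100 c001 c101 c011 c111 S01 S00 S11 : K).

Let t00_0 := x00 * E + y00 * F. Let t00_1 := x00 * F + y00 * G.
Let t01_0 := x01 * E + y01 * F. Let t01_1 := x01 * F + y01 * G.
Let t11_0 := x11 * E + y11 * F. Let t11_1 := x11 * F + y11 * G.

Let g00_0 := lam0 * E + lam * (t00_0 + t00_0).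
Let g00_1 := lam1 * E + lam * (t01_0 + t01_0).
Let g11_0 := lam0 * G + lam * (t01_1 + t01_1).
Let g11_1 := lam1 * G + lam * (t11_1 + t11_1).
Let g01_0 := lam0 * F + lam * (t00_1 + t01_0).
Let g01_1 := lam1 * F + lam * (t01_1 + t11_0).

Let W00 := (lam00 - x00 * lam0 - y00 * lam1) / lam - lam0 ^+ 2 / lam ^+ 2.
Let W01 := (lam01 - x01 * lam0 - y01 * lam1) / lam - lam0 * lam1 / lam ^+ 2.
Let W11 := (lam11 - x11 * lam0 - y11 * lam1) / lam - lam1 ^+ 2 / lam ^+ 2.

Hypothesis lam0_neq0 : lam != 0.
Hypothesis det_neq0 : E * G - F ^+ 2 != 0.
Hypothesis c000E : c000 = 2^-1 * (g00_0 + g00_0 - g00_0).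
Hypothesis c100E : c100 = 2^-1 * (g01_0 + g01_0 - g00_1).
Hypothesis c001E : c001 = 2^-1 * (g01_0 + g00_1 - g01_0).
Hypothesis c101E : c101 = 2^-1 * (g11_0 + g01_1 - g01_1).
Hypothesis c011E : c011 = 2^-1 * (g01_1 + g01_1 - g11_0).
Hypothesis c111E : c111 = 2^-1 * (g11_1 + g11_1 - g11_1).
Hypothesis S01E : S01 = lam01 * F + lam1 * (t00_1 + t01_0) +
  (lam0 * (t01_1 + t11_0) + lam * (T1 + a0101 + (a0011 + T2))).
Hypothesis S00E : S00 = lam00 * G + lam0 * (t01_1 + t01_1) +
  (lam0 * (t01_1 + t01_1) + lam * (T1 + a0101 + (a0101 + T1))).
Hypothesis S11E : S11 = lam11 * E + lam1 * (t01_0 + t01_0) +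
  (lam1 * (t01_0 + t01_0) + lam * (T2 + a0101 + (a0101 + T2))).
Hypothesis nuE : a0011 - a0101 = nu + (x00 * x11 - x01 ^+ 2) * E +
  (x00 * y11 + y00 * x11 - 2 * x01 * y01) * F + (y00 * y11 - y01 ^+ 2) * G.

(** [T1] and [T2] stand for products of third with first derivatives of the immersion. They cancel
    in S01 - S00/2 - S11/2, which retains lam (a0011 - a0101); [nuE] splits that difference into its
    normal part [nu] and tangential terms. *)
Lemma sectional_assembly : let dt := lam * E * (lam * G) - (lam * F) ^+ 2 in
  (S01 - S00 / 2 - S11 / 2 +
      (lam * G * (c001 ^+ 2 - c000 * c011)
       - lam * F * (2 * c001 * c101 - c000 * c111 - c100 * c011)
       + lam * E * (c101 ^+ 2 - c100 * c111)) / dt) / dt =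
  lam^-1 * (nu / (E * G - F ^+ 2) -
    (G * W00 - 2 * F * W01 + E * W11) / (2 * (E * G - F ^+ 2))).
Proof.
move=> dt; rewrite -(gauss_conformal_algebra lam0 lam1 lam00 lam01 lam11 nu x00 x01 x11 y00 y01 y11
  lam0_neq0 det_neq0).
have -> : dt = lam ^+ 2 * (E * G - F ^+ 2) by rewrite /dt; ring.
have S : S01 - S00 / 2 - S11 / 2 = lam01 * F + lam1 * (t00_1 + t01_0) + lam0 * (t01_1 + t11_0)
   - (lam00 * G + 2 * lam0 * (2 * t01_1)) / 2
   - (lam11 * E + 2 * lam1 * (2 * t01_0)) / 2 + lam * (a0011 - a0101).
  by rewrite S01E S00E S11E; field.
rewrite S nuE; congr ((_ + _) / _).
have d (x : K) : 2^-1 * (x + x - x) = x / 2 by field.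
have e (x y : K) : 2^-1 * (x + y - x) = y / 2 by field.
have f (x y : K) : 2^-1 * (x + x - y) = x - y / 2 by field.
have g (x y : K) : 2^-1 * (y + x - x) = y / 2 by field.
have m (x : K) : lam * (x + x) = lam * (2 * x) by ring.
rewrite c000E c100E c001E c101E c011E c111E !d e !f g.
rewrite /g00_0 /g00_1 /g11_0 /g11_1 !m -/g01_0 -/g01_1.
move: lam0_neq0 det_neq0; move: (E * G - F ^+ 2) => q l0 q0.
have fr (X Y Z : K) : (lam * G * X - lam * F * Y + lam * E * Z) / (lam ^+ 2 * q) =
  (G * X - F * Y + E * Z) / (lam * q) by field; rewrite q0 l0.
by rewrite fr.
Qed.

End SectionalAssembly.

Section SectionalAssemblyIndexed.
Variable K : realFieldType.
Variables (lam : K) (L : 'I_2 -> K) (LL B h x y g : 'I_2 -> 'I_2 -> K).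
Variables (T c : 'I_2 -> 'I_2 -> 'I_2 -> K).
Variables (Q N S th : 'I_2 -> 'I_2 -> 'I_2 -> 'I_2 -> K).
Let P k i j := L k * h i j + lam * (T k i j + T k j i).
Hypothesis lam_neq0 : lam != 0.
Hypothesis det_neq0 : h 0 0 * h 1 1 - h 0 1 ^+ 2 != 0.
Hypothesis gE : forall i j, g i j = lam * h i j.
Hypothesis hC : h 1 0 = h 0 1.
Hypothesis cE : forall m j k, c m j k = 2^-1 * (P j k m + P k j m - P m j k).
Hypothesis SE : forall m k i j, S m k i j = LL m k * h i j + L k * (T m i j + T m j i) +
  (L m * (T k i j + T k j i) + lam * (th m k i j + Q m j k i + (th m k j i + Q m i k j))).
Hypothesis T0E : forall i j, T i j 0 = x i j * h 0 0 + y i j * h 0 1.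
Hypothesis T1E : forall i j, T i j 1 = x i j * h 0 1 + y i j * h 1 1.
Hypothesis xC : x 1 0 = x 0 1.
Hypothesis yC : y 1 0 = y 0 1.
Hypothesis th1 : th 0 1 0 1 = th 0 0 1 1.
Hypothesis th2 : th 0 1 1 0 = th 1 1 0 0.
Hypothesis QE : forall i j k l, Q i j k l = N i j k l + x i j * x k l * h 0 0 +
  (x i j * y k l + y i j * x k l) * h 0 1 + y i j * y k l * h 1 1.
Hypothesis NC : forall k l, N 1 0 k l = N 0 1 k l.
Hypothesis NC' : forall k l, N k l 1 0 = N k l 0 1.
Hypothesis LLE : forall i j, LL i j = B i j + x i j * L 0 + y i j * L 1.
Let W i j := B i j / lam - L i * L j / lam ^+ 2.

Lemma sectional_assembly_indexed : let dt := g 0 0 * g 1 1 - g 0 1 ^+ 2 in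
  (S 0 1 0 1 - S 0 0 1 1 / 2 - S 1 1 0 0 / 2 +
      (g 1 1 * (c 0 0 1 ^+ 2 - c 0 0 0 * c 0 1 1)
       - g 0 1 * (2 * c 0 0 1 * c 1 0 1 - c 0 0 0 * c 1 1 1 - c 1 0 0 * c 0 1 1)
       + g 0 0 * (c 1 0 1 ^+ 2 - c 1 0 0 * c 1 1 1)) / dt) / dt =
  lam^-1 * ((N 0 0 1 1 - N 0 1 0 1) / (h 0 0 * h 1 1 - h 0 1 ^+ 2) -
    (h 1 1 * W 0 0 - 2 * h 0 1 * W 0 1 + h 0 0 * W 1 1) /
      (2 * (h 0 0 * h 1 1 - h 0 1 ^+ 2))).
Proof.
rewrite !gE.
have W00 : W 0 0 = (LL 0 0 - x 0 0 * L 0 - y 0 0 * L 1) / lam - L 0 ^+ 2 / lam ^+ 2.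
  by rewrite LLE /W; congr (_ / _ - _); ring.
have W01 : W 0 1 = (LL 0 1 - x 0 1 * L 0 - y 0 1 * L 1) / lam - L 0 * L 1 / lam ^+ 2.
  by rewrite LLE /W; congr (_ / _ - _); ring.
have W11 : W 1 1 = (LL 1 1 - x 1 1 * L 0 - y 1 1 * L 1) / lam - L 1 ^+ 2 / lam ^+ 2.
  by rewrite LLE /W; congr (_ / _ - _); ring.
rewrite W00 W01 W11.
apply: (@sectional_assembly K lam (L 0) (L 1) (LL 0 0) (LL 0 1) (LL 1 1) _ _ _ _
  (x 0 0) (x 0 1) (x 1 1) (y 0 0) (y 0 1) (y 1 1) (th 0 0 1 1) (th 1 1 0 0)
  (Q 0 0 1 1) (Q 0 1 0 1)) => //.
- by rewrite cE /P !T0E.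
- rewrite cE /P ?hC !T0E !T1E xC yC; ring.
- rewrite cE /P ?hC !T0E ?T1E ?xC ?yC; ring.
- rewrite cE /P ?hC !T0E !T1E ?xC ?yC; ring.
- rewrite cE /P ?hC !T0E !T1E ?xC ?yC; ring.
- by rewrite cE /P !T1E.
- rewrite SE !T0E !T1E th1 th2 ?xC ?yC !QE ?NC ?NC' ?xC ?yC; ring.
- rewrite SE !T1E !QE; ring.
- rewrite SE !T0E !QE ?NC ?NC' ?xC ?yC; ring.
- rewrite !QE; ring.
Qed.

End SectionalAssemblyIndexed.

Lemma perp_split (K : fieldType) n (a0 a1 v : 'rV[K]_n) : gram_det a0 a1 != 0 ->
  let x := (dot a1 a1 * dot v a0 - dot a0 a1 * dot v a1) / gram_det a0 a1 in
  let y := (dot a0 a0 * dot v a1 - dot a0 a1 * dot v a0) / gram_det a0 a1 in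
  [/\ v = perp a0 a1 v + x *: a0 + y *: a1,
      dot v a0 = x * dot a0 a0 + y * dot a0 a1 &
      dot v a1 = x * dot a0 a1 + y * dot a1 a1].
Proof.
move=> g0 x y; split.
- by rewrite /perp /x /y addrAC addrNK addrNK.
- by rewrite /x /y; move: g0; rewrite /gram_det => g0; field.
- by rewrite /x /y; move: g0; rewrite /gram_det => g0; field.
Qed.

Lemma dot_split_r (K : fieldType) n (a0 a1 u v : 'rV[K]_n) : gram_det a0 a1 != 0 ->
  let x v := (dot a1 a1 * dot v a0 - dot a0 a1 * dot v a1) / gram_det a0 a1 in
  let y v := (dot a0 a0 * dot v a1 - dot a0 a1 * dot v a0) / gram_det a0 a1 in
  dot u v = dot u (perp a0 a1 v) + (x v * dot u a0 + y v * dot u a1).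
Proof.
move=> g0 x y; have [h _ _] := perp_split v g0.
by apply: etrans (f_equal (dot u) h) _; rewrite !dotDr !dotZr addrA.
Qed.

Lemma dot_split (K : fieldType) n (a0 a1 u v : 'rV[K]_n) : gram_det a0 a1 != 0 ->
  let x v := (dot a1 a1 * dot v a0 - dot a0 a1 * dot v a1) / gram_det a0 a1 in
  let y v := (dot a0 a0 * dot v a1 - dot a0 a1 * dot v a0) / gram_det a0 a1 in
  dot u v = dot (perp a0 a1 u) (perp a0 a1 v) + x u * x v * dot a0 a0 +
    (x u * y v + y u * x v) * dot a0 a1 + y u * y v * dot a1 a1.
Proof.
move=> g0 x y; rewrite (dot_split_r u v g0) -/(x v) -/(y v).
have [_] := perp_split u g0; rewrite -/(x u) -/(y u) => h0 h1; rewrite h0 h1.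
have -> : dot u (perp a0 a1 v) = dot (perp a0 a1 u) (perp a0 a1 v).
  by rewrite [RHS]dot_perp_normal ?dot_perp1 ?dot_perp2.
by move: (x u) (y u) (x v) (y v) => a b c d; ring.
Qed.

(** * Gauss formula and Gauss equation of the immersion *)

Section ConformalImmersion.
Variables (R : realType) (n : nat) (i0 : 'I_n).
Variables (V : set 'rV[R]_n) (G : 'rV[R]_n -> 'M[R]_n).
Hypothesis oV : open V.
Hypothesis sG : smooth_on V G.
Hypothesis G_conf : forall w, V w -> G w = G w i0 i0 *: 1%:M.
Hypothesis Lam_gt0 : forall w, V w -> 0 < G w i0 i0.
Variables (D : set 'rV[R]_2) (f : 'rV[R]_2 -> 'rV[R]_n).
Hypothesis oD : open D.
Hypothesis sf : smooth_on D f.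
Hypothesis fV : forall z, D z -> V (f z).
Hypothesis immersion : forall z, D z -> gram_det (pd 0 f z) (pd 1 f z) != 0.

Local Notation lam := (lam i0 G f).
Local Notation grad z := (gradL i0 G (f z)).
Local Notation hess z := (hessL i0 G (f z)).
Local Notation f0 z := (pd 0 f z).
Local Notation f1 z := (pd 1 f z).
Local Notation perpf z := (perp (pd 0 f z) (pd 1 f z)).

Let df z : D z -> differentiable f z.
Proof. by move=> Dz; have [+ _] := sf 1%N; apply. Qed.
Let dpf i z : D z -> differentiable (pd i f) z.
Proof. by move=> Dz; have [_ /(_ i) [+ _]] := sf 2%N; apply. Qed.
Let dppf i j z : D z -> differentiable (pd i (pd j f)) z.
Proof. by move=> Dz; have [_ /(_ j) [_ /(_ i) [+ _]]] := sf 3%N; apply. Qed.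

Lemma lam_neq0 z : D z -> lam z != 0.
Proof. by move=> Dz; rewrite gt_eqF // Lam_gt0 //; exact: fV. Qed.

Lemma inner_lam z u v : D z -> inner (G (f z)) u v = lam z * dot u v.
Proof. by move=> Dz; rewrite (inner_conf G_conf _ _ (fV Dz)). Qed.

Lemma induced_metricE z i j : D z ->
  induced_metric G f z i j = lam z * dot (pd i f z) (pd j f z).
Proof. by move=> Dz; rewrite mxE inner_lam. Qed.

Lemma det_induced_metric z : D z ->
  \det (induced_metric G f z) = lam z ^+ 2 * gram_det (f0 z) (f1 z).
Proof.
move=> Dz; exact: (@det_scaled_gram _ _ _ (fun i => pd i f z) _
  (fun i j => induced_metricE i j Dz)).
Qed.

Lemma normal_partE z v : D z -> normal_part G f z v = perpf z v.
Proof.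
move=> Dz; apply: etrans (@normal_scaled_gram _ _ _ (fun i => pd i f z) _
  (fun i j => induced_metricE i j Dz) (lam_neq0 Dz) (immersion Dz) v).
by congr (_ - _); apply: eq_bigr => i _; apply: eq_bigr => j _; rewrite inner_lam.
Qed.

Lemma pullback_nablaE i j z : D z -> pullback_nabla G f i (pd j f) z =
  pd i (pd j f) z + (2 * lam z)^-1 *: (dot (grad z) (pd i f z) *: pd j f z +
    dot (grad z) (pd j f z) *: pd i f z - dot (pd i f z) (pd j f z) *: grad z).
Proof.
by move=> Dz; rewrite /pullback_nabla (christoffel_row oV sG G_conf Lam_gt0 _ _ (fV Dz)).
Qed.

(** Of the three terms of [pullback_nablaE] that contain the gradient of the conformal factor, two
    are tangential; the third is the correction seen here. *)
Lemma sffE i j z : D z -> second_fundamental_form G f i j z =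
  perpf z (pd i (pd j f) z) -
  (dot (pd i f z) (pd j f z) * (2 * lam z)^-1) *: perpf z (grad z).
Proof.
move=> Dz; rewrite /second_fundamental_form (normal_partE _ Dz) (pullback_nablaE _ _ Dz).
have g0 := immersion Dz.
apply: perp_conformal; first by case: (ord2 i) => ->; [exact: perp_e1|exact: perp_e2].
by case: (ord2 j) => ->; [exact: perp_e1|exact: perp_e2].
Qed.

Lemma gauss_kroneckerE z xi : D z -> dot xi (f0 z) = 0 -> dot xi (f1 z) = 0 ->
  let B i j := dot (pd i (pd j f) z) xi -
    dot (pd i f z) (pd j f z) * ((2 * lam z)^-1 * dot (grad z) xi) in
  gauss_kronecker G f z xi = (B 0 0 * B 1 1 - B 0 1 * B 1 0) / gram_det (f0 z) (f1 z).
Proof.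
move=> Dz x0 x1 B.
apply: (@gauss_kronecker_scaled _ _ _ (fun i => pd i f z) _
  (fun i j => induced_metricE i j Dz) (lam_neq0 Dz) (immersion Dz)) => i j.
rewrite mxE (inner_lam _ _ Dz) (sffE _ _ Dz) dotBl dotZl.
by rewrite (dot_perp_normal _ x0 x1) (dot_perp_normal _ x0 x1) -mulrA.
Qed.

Lemma mean_curvatureE z k : D z ->
  let E := dot (f0 z) (f0 z) in let F := dot (f0 z) (f1 z) in
  let H := dot (f1 z) (f1 z) in
  mean_curvature G f z 0 k = (2 * lam z)^-1 *
    ((H * perpf z (pd 0 (pd 0 f) z) 0 k - 2 * F * perpf z (pd 0 (pd 1 f) z) 0 k
      + E * perpf z (pd 1 (pd 1 f) z) 0 k) / gram_det (f0 z) (f1 z)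
     - (lam z)^-1 * perpf z (grad z) 0 k).
Proof.
move=> Dz E F H.
apply: (@mean_curvature_scaled _ _ _ (fun i => pd i f z) _
  (fun i j => induced_metricE i j Dz) (lam_neq0 Dz) (immersion Dz) _
  (fun i j => perpf z (pd i (pd j f) z))) => [||i j].
- by rewrite pnatr_eq0.
- exact: (f_equal (perp (pd 0 f z) (pd 1 f z)) (pd_swapV oD 1 0 (sf 2%N) Dz)).
- exact: sffE.
Qed.

Let gij i j w : R^o := lam w * dot (pd i f w) (pd j f w).

Let dlam w : D w -> differentiable lam w.
Proof. by move=> Dw; exact: (diff_lam i0 oV sG sf fV Dw). Qed.

Let dplam k w : D w -> differentiable (pd k lam) w.
Proof. by move=> Dw; exact: (diff_pd_lam i0 oV sG oD sf fV k Dw). Qed.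

Lemma pd_gij k i j w : D w -> pd k (gij i j) w =
  pd k lam w * dot (pd i f w) (pd j f w) +
  lam w * (dot (pd k (pd i f) w) (pd j f w) + dot (pd k (pd j f) w) (pd i f w)).
Proof.
move=> Dw; apply: etrans (pdM k (dlam Dw) (diff_dot (dpf i Dw) (dpf j Dw))) _.
exact: (f_equal (fun t => pd k lam w * dot (pd i f w) (pd j f w) + lam w * t)
  (pd_dot k (dpf i Dw) (dpf j Dw))).
Qed.

Lemma pd_pd_gij m k i j w : D w -> pd m (pd k (gij i j)) w =
  pd m (pd k lam) w * dot (pd i f w) (pd j f w) +
  pd k lam w * (dot (pd m (pd i f) w) (pd j f w) + dot (pd m (pd j f) w) (pd i f w)) +
  (pd m lam w * (dot (pd k (pd i f) w) (pd j f w) + dot (pd k (pd j f) w) (pd i f w)) +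
   lam w * (dot (pd m (pd k (pd i f)) w) (pd j f w) +
            dot (pd m (pd j f) w) (pd k (pd i f) w) +
            (dot (pd m (pd k (pd j f)) w) (pd i f w) +
             dot (pd m (pd i f) w) (pd k (pd j f) w)))).
Proof.
move=> Dw.
have dA := diff_dot (dppf k i Dw) (dpf j Dw).
have dB := diff_dot (dppf k j Dw) (dpf i Dw).
have dC := diff_dot (dpf i Dw) (dpf j Dw).
apply: etrans (pd_on m oD (pd_gij k i j) Dw) _.
apply: etrans (pdD m (differentiableM (dplam k Dw) dC)
  (differentiableM (dlam Dw) (differentiableD dA dB))) _.
apply: f_equal2.
  apply: etrans (pdM m (dplam k Dw) dC) _.
  exact: (f_equal (fun t => pd m (pd k lam) w * dot (pd i f w) (pd j f w) +
    pd k lam w * t) (pd_dot m (dpf i Dw) (dpf j Dw))).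
apply: etrans (pdM m (dlam Dw) (differentiableD dA dB)) _.
apply: (f_equal (fun t => pd m lam w *
  (dot (pd k (pd i f) w) (pd j f w) + dot (pd k (pd j f) w) (pd i f w)) + lam w * t)).
apply: etrans (pdD m dA dB) _.
exact (f_equal2 (fun s t : R => s + t)
  (pd_dot m (dppf k i Dw) (dpf j Dw)) (pd_dot m (dppf k j Dw) (dpf i Dw))).
Qed.

(** The covariant Hessian of log lam on the surface, for the metric induced by the Euclidean one.
    Keeping only the normal part of the second derivative of [f] accounts for the Christoffel
    terms. *)
Definition hess_term z i j : R :=
  (bil (hess z) (pd i f z) (pd j f z) + dot (grad z) (perpf z (pd i (pd j f) z))) / lam z
  - pd i lam z * pd j lam z / lam z ^+ 2.

(** This is Sec = (K - (1/2) Delta log lam) / lam, the curvature of lam times a metric. Here K and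
    the Laplacian Delta refer to the metric induced by the Euclidean one, and K is expressed by the
    Euclidean Gauss equation. *)
Lemma sectionalE z : D z ->
  let E := dot (f0 z) (f0 z) in let F := dot (f0 z) (f1 z) in
  let H := dot (f1 z) (f1 z) in let N i j := perpf z (pd i (pd j f) z) in
  sectional_curvature (induced_metric G f) z =
  (lam z)^-1 * ((dot (N 0 0) (N 1 1) - dot (N 0 1) (N 0 1)) / gram_det (f0 z) (f1 z) -
     (H * hess_term z 0 0 - 2 * F * hess_term z 0 1 + E * hess_term z 1 1) /
       (2 * gram_det (f0 z) (f1 z))).
Proof.
move=> Dz E F H N.
have gE i j w : D w -> gij i j w = induced_metric G f w i j.
  by move=> Dw; rewrite induced_metricE.
have pgE k i j w : D w ->
    pd k (gij i j) w = pd k (fun w => induced_metric G f w i j : R^o) w.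
  by move=> Dw; exact: (pd_on k oD (gE i j) Dw).
have ppgE m k i j w : D w ->
    pd m (pd k (gij i j)) w = pd m (pd k (fun w => induced_metric G f w i j : R^o)) w.
  by move=> Dw; exact: (pd_on m oD (pgE k i j) Dw).
have dgij i j w : D w -> differentiable (gij i j) w.
  by move=> Dw; exact: differentiableM (dlam Dw) (diff_dot (dpf i Dw) (dpf j Dw)).
have dpgij k i j w : D w -> differentiable (pd k (gij i j)) w.
  move=> Dw; apply: (@near_differentiable _ _ _ (fun w => pd k lam w * dot (pd i f w) (pd j f w) +
    lam w * (dot (pd k (pd i f) w) (pd j f w) + dot (pd k (pd j f) w) (pd i f w)) : R^o)).
    by apply: filterS (open_near oD Dw) => u Du; exact: esym (pd_gij k i j Du).
  exact: differentiableD
   (differentiableM (dplam k Dw) (diff_dot (dpf i Dw) (dpf j Dw)))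
   (differentiableM (dlam Dw) (differentiableD (diff_dot (dppf k i Dw) (dpf j Dw))
      (diff_dot (dppf k j Dw) (dpf i Dw)))).
have near_g i j w : D w -> \forall u \near w, gij i j u = induced_metric G f u i j.
  by move=> Dw; apply: filterS (open_near oD Dw) => u; exact: gE.
have near_pg k i j w : D w -> \forall u \near w,
    pd k (gij i j) u = pd k (fun w => induced_metric G f w i j : R^o) u.
  by move=> Dw; apply: filterS (open_near oD Dw) => u; exact: pgE.
have hs w : D w -> induced_metric G f w 0 1 = induced_metric G f w 1 0.
  move=> Dw; exact: etrans (induced_metricE 0 1 Dw)
    (etrans (f_equal (fun t => lam w * t) (dotC (pd 0 f w) (pd 1 f w)))
            (esym (induced_metricE 1 0 Dw))).
have hd i j w : D w -> differentiable (fun w => induced_metric G f w i j : R^o) w.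
  by move=> Dw; exact: near_differentiable (near_g i j w Dw) (dgij i j w Dw).
have hd2 k i j w : D w ->
    differentiable (pd k (fun w => induced_metric G f w i j : R^o)) w.
  by move=> Dw; exact: near_differentiable (near_pg k i j w Dw) (dpgij k i j w Dw).
have hdet w : D w -> \det (induced_metric G f w) != 0.
  move=> Dw; rewrite (det_induced_metric Dw) mulf_neq0 ?immersion //.
  by rewrite expf_neq0 // lam_neq0.
have dE k i j : pd k (fun w => induced_metric G f w i j : R^o) z =
    pd k lam z * dot (pd i f z) (pd j f z) +
    lam z * (dot (pd k (pd i f) z) (pd j f z) + dot (pd k (pd j f) z) (pd i f z)).
  exact: etrans (esym (pgE k i j z Dz)) (pd_gij k i j Dz).
have SEq m k i j : pd m (pd k (fun w => induced_metric G f w i j : R^o)) z =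
    pd m (pd k lam) z * dot (pd i f z) (pd j f z) +
    pd k lam z * (dot (pd m (pd i f) z) (pd j f z) + dot (pd m (pd j f) z) (pd i f z)) +
    (pd m lam z * (dot (pd k (pd i f) z) (pd j f z) + dot (pd k (pd j f) z) (pd i f z)) +
     lam z * (dot (pd m (pd k (pd i f)) z) (pd j f z) +
              dot (pd m (pd j f) z) (pd k (pd i f) z) +
              (dot (pd m (pd k (pd j f)) z) (pd i f z) +
               dot (pd m (pd i f) z) (pd k (pd j f) z)))).
  exact: etrans (esym (ppgE m k i j z Dz)) (pd_pd_gij m k i j Dz).
apply: etrans (sectional_metric oD hs hd hd2 hdet Dz) _.
have g0 := immersion Dz.
(* The tangential components of the second derivatives, that is, the Christoffel symbols of the
   metric induced by the Euclidean one. *)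
pose x i j := (dot (f1 z) (f1 z) * dot (pd i (pd j f) z) (f0 z) -
  dot (f0 z) (f1 z) * dot (pd i (pd j f) z) (f1 z)) / gram_det (f0 z) (f1 z).
pose y i j := (dot (f0 z) (f0 z) * dot (pd i (pd j f) z) (f1 z) -
  dot (f0 z) (f1 z) * dot (pd i (pd j f) z) (f0 z)) / gram_det (f0 z) (f1 z).
have sp0 i j : dot (pd i (pd j f) z) (f0 z) = x i j * dot (f0 z) (f0 z) +
    y i j * dot (f0 z) (f1 z).
  have [_ h _] := perp_split (pd i (pd j f) z) g0; exact h.
have sp1 i j : dot (pd i (pd j f) z) (f1 z) = x i j * dot (f0 z) (f1 z) +
    y i j * dot (f1 z) (f1 z).
  have [_ _ h] := perp_split (pd i (pd j f) z) g0; exact h.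
have sw := pd_swapV oD 1 0 (sf 2%N) Dz.
apply: (@sectional_assembly_indexed R (lam z) (fun i => pd i lam z)
  (fun i j => pd i (pd j lam) z)
  (fun i j => bil (hess z) (pd i f z) (pd j f z) + dot (grad z) (N i j))
  (fun i j => dot (pd i f z) (pd j f z)) x y
  (fun i j => induced_metric G f z i j)
  (fun k i j => dot (pd k (pd i f) z) (pd j f z))
  (fun m j k => christ1 (induced_metric G f) m j k z)
  (fun i j k l => dot (pd i (pd j f) z) (pd k (pd l f) z))
  (fun i j k l => dot (N i j) (N k l))
  (fun m k i j => pd m (pd k (fun w => induced_metric G f w i j : R^o)) z)
  (fun m k i j => dot (pd m (pd k (pd i f)) z) (pd j f z))).
- exact: lam_neq0.
- exact: g0.
- by move=> i j; exact: induced_metricE.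
- exact: dotC.
- by move=> m j k; rewrite /christ1 (dE j k m) (dE k j m) (dE m j k).
- exact: SEq.
- exact: sp0.
- exact: sp1.
- exact: (f_equal (fun v => (dot (f1 z) (f1 z) * dot v (f0 z) -
    dot (f0 z) (f1 z) * dot v (f1 z)) / gram_det (f0 z) (f1 z)) sw).
- exact: (f_equal (fun v => (dot (f0 z) (f0 z) * dot v (f1 z) -
    dot (f0 z) (f1 z) * dot v (f0 z)) / gram_det (f0 z) (f1 z)) sw).
(* Symmetry of third derivatives: here the two inner ones are exchanged, in the next item first the
   outer two and then the inner two. *)
- exact: (f_equal (fun v => dot v (f1 z))
    (pd_on 0 oD (fun w Dw => pd_swapV oD 1 0 (sf 2%N) Dw) Dz)).
- have sf1 : Ck_on 2 D (pd 1 f) by have [_] := sf 3%N; apply.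
  exact: (f_equal (fun v => dot v (f0 z)) (etrans (pd_swapV oD 0 1 sf1 Dz)
    (pd_on 1 oD (fun w Dw => pd_swapV oD 0 1 (sf 2%N) Dw) Dz))).
- move=> i j k l; exact: (dot_split _ _ g0).
- exact: (fun k l => f_equal (fun v => dot (perpf z v) (N k l)) sw).
- exact: (fun k l => f_equal (fun v => dot (N k l) (perpf z v)) sw).
- move=> i j; apply: etrans (pd_pd_lam i0 oV sG oD sf fV i j Dz) _.
  rewrite (pd_lam i0 oV sG sf fV 0 Dz) (pd_lam i0 oV sG sf fV 1 Dz).
  by rewrite -!addrA; apply: (f_equal (fun t => bil _ _ _ + t)); exact: (dot_split_r _ _ g0).
Qed.

End ConformalImmersion.

(** * Curvatures in terms of the branch data *)

Section Frame.
Variables (K : realFieldType) (n : nat) (a b c : K).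
Variables (e1 e2 u1 u2 v1 v2 l f0 f1 f00 f01 f11 : 'rV[K]_n).
Variables (s1 s2 x1 x2 y1 y2 : K).

Let n2 := a ^+ 2 + b ^+ 2.
Let p := dot e1 e1.
Let q := dot e1 e2.
Let r := dot e2 e2.
Local Notation P := (perp e1 e2).

Hypothesis n2_neq0 : n2 != 0.
Hypothesis c_neq0 : c != 0.
Hypothesis gram_neq0 : gram_det e1 e2 != 0.
Hypothesis f0E : f0 = (2 * c) *: (a *: e1 - b *: e2).
Hypothesis f1E : f1 = (- (2 * c)) *: (b *: e1 + a *: e2).
Let A1 := c *: (s1 *: e1 - s2 *: e2 + (a *: v1 - b *: v2)).
Let A2 := c *: (s1 *: e2 + s2 *: e1 + (a *: v2 + b *: v1)).
Hypothesis f00E : f00 = 2 *: A1 + (2 * n2) *: l.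
Hypothesis f11E : f11 = - (2 *: A1) + (2 * n2) *: l.
Hypothesis f01E : f01 = - (2 *: A2).
Hypothesis v1E : v1 = x1 *: e1 + y1 *: e2 + (a *: u1 - b *: u2).
Hypothesis v2E : v2 = x2 *: e1 + y2 *: e2 + (a *: u2 + b *: u1).

Lemma frame_E : dot f0 f0 = 4 * c ^+ 2 * (a ^+ 2 * p - 2 * a * b * q + b ^+ 2 * r).
Proof. rewrite f0E !dotE (dotC e2 e1) /p /q /r; ring. Qed.

Lemma frame_F : dot f0 f1 =
  4 * c ^+ 2 * (- a * b * p - (a ^+ 2 - b ^+ 2) * q + a * b * r).
Proof. rewrite f0E f1E !dotE (dotC e2 e1) /p /q /r; ring. Qed.

Lemma frame_G : dot f1 f1 = 4 * c ^+ 2 * (b ^+ 2 * p + 2 * a * b * q + a ^+ 2 * r).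
Proof. rewrite f1E !dotE (dotC e2 e1) /p /q /r; ring. Qed.

Lemma frame_det : gram_det f0 f1 = 16 * c ^+ 4 * n2 ^+ 2 * gram_det e1 e2.
Proof. by rewrite {1}/gram_det frame_E frame_F frame_G sym_det. Qed.

Lemma frame_det_neq0 : gram_det f0 f1 != 0.
Proof. by rewrite frame_det !mulf_neq0 ?expf_neq0 // pnatr_eq0. Qed.

(** As n2 is nonzero, [f0], [f1] span the same plane as [e1], [e2]. *)
Lemma frame_perp v : perp f0 f1 v = P v.
Proof.
have [vE _ _] : [/\ v = P v + ((r * dot v e1 - q * dot v e2) / gram_det e1 e2) *: e1
    + ((p * dot v e2 - q * dot v e1) / gram_det e1 e2) *: e2, True & True].
  by split => //; rewrite /perp /p /q /r addrAC addrNK addrNK.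
move: vE; set al := (_ / _); set be := (_ / _) => vE.
have N : 2 * c * n2 != 0 by rewrite !mulf_neq0 // pnatr_eq0.
(* The inverse of the change of frame, a rotation and reflection scaled by 2c |z|^s. *)
have e1E : e1 = (2 * c * n2)^-1 *: (a *: f0 - b *: f1).
  apply/rowP => k; rewrite f0E f1E !mxE.
  by move: n2_neq0; rewrite /n2 => n0; field; rewrite c_neq0 n0.
have e2E : e2 = - (2 * c * n2)^-1 *: (b *: f0 + a *: f1).
  apply/rowP => k; rewrite f0E f1E !mxE.
  by move: n2_neq0; rewrite /n2 => n0; field; rewrite c_neq0 n0.
have o1 := dot_perp1 gram_neq0 v; have o2 := dot_perp2 gram_neq0 v.
move: al be (P v) vE o1 o2 => al be w vE o1 o2.
apply: (@perp_unique _ _ _ _ frame_det_neq0 _ _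
   ((2 * c * n2)^-1 * (al * a - be * b)) ((2 * c * n2)^-1 * (- al * b - be * a))).
- apply: etrans vE _; rewrite -!addrA; congr (_ + _).
  rewrite {1}e1E {1}e2E; apply/rowP => k; rewrite !mxE.
  by move: (f0 0 k) (f1 0 k) (2 * c * n2)^-1 => F0 F1 h; ring.
- by rewrite f0E !dotE o1 o2 !mulr0 subr0 mulr0.
- by rewrite f1E !dotE o1 o2 !mulr0 addr0 mulr0.
Qed.

Let re2 := a ^+ 2 - b ^+ 2.
Let im2 := 2 * a * b.

(** With [PA2]: the normal part of dz dz f^ is c z^(2s) P u. One factor z^s is explicit in dz f^,
    the other comes from P (dz d) = z^s P u; [re2] and [im2] are the parts of z^(2s). *)
Let PA1 : P A1 = re2 *: (c *: P u1) - im2 *: (c *: P u2).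
Proof.
rewrite /A1 v1E v2E !(perpZ, perpD, perpB, perpN) !(perp_e1 gram_neq0) !(perp_e2 gram_neq0).
move: (P u1) (P u2) => U1 U2; apply/rowP => k; rewrite !mxE /re2 /im2. ring.
Qed.

Let PA2 : P A2 = re2 *: (c *: P u2) + im2 *: (c *: P u1).
Proof.
rewrite /A2 v1E v2E !(perpZ, perpD, perpB, perpN) !(perp_e1 gram_neq0) !(perp_e2 gram_neq0).
move: (P u1) (P u2) => U1 U2; apply/rowP => k; rewrite !mxE /re2 /im2. ring.
Qed.

Lemma frame_perp00 :
  P f00 = 2 *: (re2 *: (c *: P u1) - im2 *: (c *: P u2) + n2 *: P l).
Proof. by rewrite f00E perpD [P (2 *: A1)]perpZ [P (_ *: l)]perpZ PA1 [RHS]scalerDr [2 *: (n2 *: _)]scalerA. Qed.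

Lemma frame_perp11 :
  P f11 = 2 *: (- (re2 *: (c *: P u1) - im2 *: (c *: P u2)) + n2 *: P l).
Proof. by rewrite f11E perpD perpN [P (2 *: A1)]perpZ [P (_ *: l)]perpZ PA1 [RHS]scalerDr [2 *: - _]scalerN [2 *: (n2 *: _)]scalerA. Qed.

Lemma frame_perp01 :
  P f01 = - 2 *: (re2 *: (c *: P u2) + im2 *: (c *: P u1)).
Proof. by rewrite f01E perpN [P (2 *: A2)]perpZ PA2 [RHS]scaleNr. Qed.

Lemma frame_sym00 w : dot w (P f00) =
  sym00 a b (c * dot w (P u1)) (c * dot w (P u2)) (dot w (P l)).
Proof. by rewrite frame_perp00 !dotE. Qed.

Lemma frame_sym11 w : dot w (P f11) =
  sym11 a b (c * dot w (P u1)) (c * dot w (P u2)) (dot w (P l)).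
Proof. by rewrite frame_perp11 !dotE. Qed.

Lemma frame_sym01 w : dot w (P f01) =
  sym01 a b (c * dot w (P u1)) (c * dot w (P u2)) (dot w (P l)).
Proof. by rewrite frame_perp01 !dotE. Qed.

Lemma frame_mean k :
  (dot f1 f1 * P f00 0 k - 2 * dot f0 f1 * P f01 0 k + dot f0 f0 * P f11 0 k) /
    gram_det f0 f1 =
  ((p + r) * P l 0 k - (p - r) * (c * P u1 0 k) - 2 * q * (c * P u2 0 k)) /
    (2 * c ^+ 2 * gram_det e1 e2).
Proof.
have -> : P f00 0 k = sym00 a b (c * P u1 0 k) (c * P u2 0 k) (P l 0 k).
  by rewrite frame_perp00 !mxE.
have -> : P f11 0 k = sym11 a b (c * P u1 0 k) (c * P u2 0 k) (P l 0 k).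
  by rewrite frame_perp11 !mxE.
have -> : P f01 0 k = sym01 a b (c * P u1 0 k) (c * P u2 0 k) (P l 0 k).
  by rewrite frame_perp01 !mxE.
rewrite frame_E frame_F frame_G {1}/gram_det frame_E frame_F frame_G.
exact: sym_trace.
Qed.

(** The coefficient z^(2s) has modulus n2, so n2^2 factors out of the numerator and cancels against
    the Gram determinant. *)
Lemma frame_nu : (dot (P f00) (P f11) - dot (P f01) (P f01)) / gram_det f0 f1 =
  (dot (P l) (P l) - c ^+ 2 * (dot (P u1) (P u1) + dot (P u2) (P u2))) /
    (4 * c ^+ 4 * gram_det e1 e2).
Proof.
rewrite frame_perp00 frame_perp11 frame_perp01 frame_det.
move: (P u1) (P u2) (P l) => U1 U2 L; rewrite !dotE.
rewrite (dotC U2 U1) (dotC L U1) (dotC L U2).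
move: (dot U1 U1) (dot U1 U2) (dot U2 U2) (dot U1 L) (dot U2 L) (dot L L)
  (gram_det e1 e2) gram_neq0.
move=> w1 w2 w3 w4 w5 w6 w7 w70; move: n2_neq0; rewrite /re2 /im2 /n2 => n0.
by field; rewrite c_neq0 n0 w70.
Qed.

(** The Gram entries of [f0], [f1] have the shape [sym00], [sym01], [sym11] too, with coefficients
    c^2 (p - r), 2 c^2 q and c^2 (p + r). Subtracting a multiple of the metric therefore only shifts
    the three coefficients. *)
Lemma frame_det_quot xi g : dot xi e1 = 0 -> dot xi e2 = 0 ->
  let B f h := dot f xi - h * g in
  (B f00 (dot f0 f0) * B f11 (dot f1 f1) - B f01 (dot f0 f1) * B f01 (dot f0 f1)) /
    gram_det f0 f1 =
  ((dot l xi - c ^+ 2 * (p + r) * g) ^+ 2 -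
   ((c * dot u1 xi - c ^+ 2 * (p - r) * g) ^+ 2 +
    (c * dot u2 xi - c ^+ 2 * (2 * q) * g) ^+ 2)) / (4 * c ^+ 4 * gram_det e1 e2).
Proof.
move=> o1 o2 B.
have PX v : dot v xi = dot xi (P v) := etrans (esym (dot_perp_normal v o1 o2)) (dotC _ _).
set T1 := c * dot u1 xi - _; set T2 := c * dot u2 xi - _; set M := dot l xi - _.
have -> : B f00 (dot f0 f0) = sym00 a b T1 T2 M.
  rewrite /B PX frame_sym00 frame_E /T1 /T2 /M !PX /sym00.
  by move: (dot xi (P u1)) (dot xi (P u2)) (dot xi (P l)) => X Y Z; ring.
have -> : B f11 (dot f1 f1) = sym11 a b T1 T2 M.
  rewrite /B PX frame_sym11 frame_G /T1 /T2 /M !PX /sym11.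
  by move: (dot xi (P u1)) (dot xi (P u2)) (dot xi (P l)) => X Y Z; ring.
have -> : B f01 (dot f0 f1) = sym01 a b T1 T2 M.
  rewrite /B PX frame_sym01 frame_F /T1 /T2 !PX /sym01.
  by move: (dot xi (P u1)) (dot xi (P u2)) => X Y; ring.
rewrite -expr2 {1}/gram_det frame_E frame_F frame_G.
exact: sym_det_quot.
Qed.

End Frame.

Section CurvatureForms.
Variables (K : fieldType) (n : nat) (c lam : K) (e1 e2 u1 u2 l g : 'rV[K]_n).
Local Notation P := (perp e1 e2).
Let p := dot e1 e1.
Let q := dot e1 e2.
Let r := dot e2 e2.

(** In these three definitions [c] stands for s + 1, [g] for the gradient of the conformal factor
    and [u1], [u2] for the oblique components; z itself has disappeared. *)
Definition gauss_kronecker_form (xi : 'rV[K]_n) : K :=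
  let h := (2 * lam)^-1 * dot g xi in
  ((dot l xi - c ^+ 2 * (p + r) * h) ^+ 2 -
   ((c * dot u1 xi - c ^+ 2 * (p - r) * h) ^+ 2 +
    (c * dot u2 xi - c ^+ 2 * (2 * q) * h) ^+ 2)) / (4 * c ^+ 4 * gram_det e1 e2).

Definition mean_form k : K := (2 * lam)^-1 *
  (((p + r) * P l 0 k - (p - r) * (c * P u1 0 k) - 2 * q * (c * P u2 0 k)) /
    (2 * c ^+ 2 * gram_det e1 e2) - lam^-1 * P g 0 k).

(** [t1], [t2], [m] are the coefficients, in the sense of [sym00], of the Hessian of log lam. *)
Definition sectional_form (H : 'M[K]_n) : K :=
  let b11 := bil H e1 e1 in let b12 := bil H e1 e2 in let b22 := bil H e2 e2 in
  let g1 := dot g e1 in let g2 := dot g e2 in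
  let n1 := dot g (P u1) in let n2 := dot g (P u2) in let nl := dot g (P l) in
  let t1 := (c ^+ 2 * (b11 - b22) + c * n1) / lam - c ^+ 2 * (g1 ^+ 2 - g2 ^+ 2) / lam ^+ 2 in
  let t2 := (c ^+ 2 * (2 * b12) + c * n2) / lam - c ^+ 2 * (2 * (g1 * g2)) / lam ^+ 2 in
  let m := (c ^+ 2 * (b11 + b22) + nl) / lam - c ^+ 2 * (g1 ^+ 2 + g2 ^+ 2) / lam ^+ 2 in
  lam^-1 *
   ((dot (P l) (P l) - c ^+ 2 * (dot (P u1) (P u1) + dot (P u2) (P u2))) /
      (4 * c ^+ 4 * gram_det e1 e2)
    - ((p + r) * m - (p - r) * t1 - 2 * q * t2) / (4 * c ^+ 2 * gram_det e1 e2)).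

End CurvatureForms.

Section HessFrame.
Variables (K : realFieldType) (n : nat) (a b c lam : K) (H : 'M[K]_n).
Variables (e1 e2 f0 f1 g : 'rV[K]_n) (N00 N01 N11 n1 n2 nl : K).
Hypothesis H_sym : forall i j, H i j = H j i.
Hypothesis lam_neq0 : lam != 0.
Hypothesis c_neq0 : c != 0.
Hypothesis ab_neq0 : a ^+ 2 + b ^+ 2 != 0.
Hypothesis gram_neq0 : gram_det e1 e2 != 0.
Hypothesis f0E : f0 = (2 * c) *: (a *: e1 - b *: e2).
Hypothesis f1E : f1 = (- (2 * c)) *: (b *: e1 + a *: e2).
Hypothesis N00E : N00 = sym00 a b (c * n1) (c * n2) nl.
Hypothesis N01E : N01 = sym01 a b (c * n1) (c * n2) nl.
Hypothesis N11E : N11 = sym11 a b (c * n1) (c * n2) nl.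
Let p := dot e1 e1.
Let q := dot e1 e2.
Let r := dot e2 e2.
Let b11 := bil H e1 e1. Let b12 := bil H e1 e2. Let b22 := bil H e2 e2.
Let g1 := dot g e1. Let g2 := dot g e2.
Let t1 := (c ^+ 2 * (b11 - b22) + c * n1) / lam - c ^+ 2 * (g1 ^+ 2 - g2 ^+ 2) / lam ^+ 2.
Let t2 := (c ^+ 2 * (2 * b12) + c * n2) / lam - c ^+ 2 * (2 * (g1 * g2)) / lam ^+ 2.
Let m := (c ^+ 2 * (b11 + b22) + nl) / lam - c ^+ 2 * (g1 ^+ 2 + g2 ^+ 2) / lam ^+ 2.

(** The Hessian of the factor, the normal correction and the product of first derivatives each have
    the shape [sym00], [sym01], [sym11]. Their combination is again of this shape, and [sym_trace]
    evaluates its trace. *)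
Lemma hess_frame :
  (dot f1 f1 * ((bil H f0 f0 + N00) / lam - dot g f0 * dot g f0 / lam ^+ 2)
   - 2 * dot f0 f1 * ((bil H f0 f1 + N01) / lam - dot g f0 * dot g f1 / lam ^+ 2)
   + dot f0 f0 * ((bil H f1 f1 + N11) / lam - dot g f1 * dot g f1 / lam ^+ 2)) /
    (2 * gram_det f0 f1) =
  ((p + r) * m - (p - r) * t1 - 2 * q * t2) / (4 * c ^+ 2 * gram_det e1 e2).
Proof.
have b21 : bil H e2 e1 = b12 by apply: bilC.
have bilDr u v w : bil H u (v + w) = bil H u v + bil H u w.
  by rewrite bilC // bilDl !(bilC u).
have bilZr x u v : bil H u (x *: v) = x * bil H u v by rewrite bilC // bilZl (bilC u).
have F0 : f0 = (2 * c * a) *: e1 + (- (2 * c * b)) *: e2.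
  by rewrite f0E scalerDr scalerN !scalerA scaleNr.
have F1 : f1 = (- (2 * c * b)) *: e1 + (- (2 * c * a)) *: e2.
  by rewrite f1E scalerDr !scalerA !mulNr.
have H00 : bil H f0 f0 =
    sym00 a b (c ^+ 2 * (b11 - b22)) (c ^+ 2 * (2 * b12)) (c ^+ 2 * (b11 + b22)).
  rewrite F0 !bilDl !bilZl !bilDr !bilZr b21 /sym00 -/b11 -/b12 -/b22; ring.
have H01 : bil H f0 f1 =
    sym01 a b (c ^+ 2 * (b11 - b22)) (c ^+ 2 * (2 * b12)) (c ^+ 2 * (b11 + b22)).
  rewrite F0 F1 !bilDl !bilZl !bilDr !bilZr b21 /sym01 -/b11 -/b12 -/b22; ring.
have H11 : bil H f1 f1 =
    sym11 a b (c ^+ 2 * (b11 - b22)) (c ^+ 2 * (2 * b12)) (c ^+ 2 * (b11 + b22)).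
  rewrite F1 !bilDl !bilZl !bilDr !bilZr b21 /sym11 -/b11 -/b12 -/b22; ring.
have G0 : dot g f0 = 2 * c * (a * g1 - b * g2) by rewrite F0 !dotE /g1 /g2; ring.
have G1 : dot g f1 = - (2 * c * (b * g1 + a * g2)) by rewrite F1 !dotE /g1 /g2; ring.
have W00 : (bil H f0 f0 + N00) / lam - dot g f0 * dot g f0 / lam ^+ 2 = sym00 a b t1 t2 m.
  by rewrite H00 N00E G0 /sym00 /t1 /t2 /m; field.
have W01 : (bil H f0 f1 + N01) / lam - dot g f0 * dot g f1 / lam ^+ 2 = sym01 a b t1 t2 m.
  by rewrite H01 N01E G0 G1 /sym01 /t1 /t2 /m; field.
have W11 : (bil H f1 f1 + N11) / lam - dot g f1 * dot g f1 / lam ^+ 2 = sym11 a b t1 t2 m.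
  by rewrite H11 N11E G1 /sym11 /t1 /t2 /m; field.
rewrite W00 W01 W11.
have T := sym_trace t1 t2 m c_neq0 ab_neq0 gram_neq0.
have -> x : x / (2 * gram_det f0 f1) = 2^-1 * (x / gram_det f0 f1) :> K.
  by rewrite invfM mulrCA.
have -> : gram_det f0 f1 = dot f0 f0 * dot f1 f1 - dot f0 f1 ^+ 2 by [].
rewrite (frame_E f0E) (frame_F f0E f1E) (frame_G f1E) T.
move: gram_neq0; rewrite /gram_det -/p -/q -/r => w0.
by field; rewrite c_neq0 w0.
Qed.

End HessFrame.

(** * The curvatures as expressions without powers of z *)

Section FrameAssembly.
Variables (K : realFieldType) (n : nat) (a b c lam : K) (H : 'M[K]_n).
Variables (e1 e2 u1 u2 v1 v2 l g : 'rV[K]_n).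
Variables (s1 s2 x1 x2 y1 y2 : K).
Variables (F : 'I_2 -> 'rV[K]_n) (S : 'I_2 -> 'I_2 -> 'rV[K]_n) (L : 'I_2 -> K).
Let n2 := a ^+ 2 + b ^+ 2.
Hypothesis n2_neq0 : n2 != 0.
Hypothesis c_neq0 : c != 0.
Hypothesis gram_neq0 : gram_det e1 e2 != 0.
Hypothesis f0E : F 0 = (2 * c) *: (a *: e1 - b *: e2).
Hypothesis f1E : F 1 = (- (2 * c)) *: (b *: e1 + a *: e2).
Let A1 := c *: (s1 *: e1 - s2 *: e2 + (a *: v1 - b *: v2)).
Let A2 := c *: (s1 *: e2 + s2 *: e1 + (a *: v2 + b *: v1)).
Hypothesis f00E : S 0 0 = 2 *: A1 + (2 * n2) *: l.
Hypothesis f11E : S 1 1 = - (2 *: A1) + (2 * n2) *: l.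
Hypothesis f01E : S 0 1 = - (2 *: A2).
Hypothesis f10E : S 1 0 = - (2 *: A2).
Hypothesis v1E : v1 = x1 *: e1 + y1 *: e2 + (a *: u1 - b *: u2).
Hypothesis v2E : v2 = x2 *: e1 + y2 *: e2 + (a *: u2 + b *: u1).
Local Notation P := (perp e1 e2).
Let p := dot e1 e1.
Let q := dot e1 e2.
Let r := dot e2 e2.

Lemma assembly_gauss_kronecker xi : dot xi e1 = 0 -> dot xi e2 = 0 ->
  let B i j := dot (S i j) xi - dot (F i) (F j) * ((2 * lam)^-1 * dot g xi) in
  (B 0 0 * B 1 1 - B 0 1 * B 1 0) / gram_det (F 0) (F 1) =
  gauss_kronecker_form c lam e1 e2 u1 u2 l g xi.
Proof.
move=> o1 o2 B.
have -> : B 1 0 = B 0 1 by rewrite /B f10E f01E (dotC (F 1)).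
exact: (frame_det_quot n2_neq0 c_neq0 gram_neq0 f0E f1E f00E f11E f01E v1E v2E _ o1 o2).
Qed.

Lemma assembly_mean k : (2 * lam)^-1 *
  ((dot (F 1) (F 1) * perp (F 0) (F 1) (S 0 0) 0 k
    - 2 * dot (F 0) (F 1) * perp (F 0) (F 1) (S 0 1) 0 k
    + dot (F 0) (F 0) * perp (F 0) (F 1) (S 1 1) 0 k) / gram_det (F 0) (F 1)
   - lam^-1 * perp (F 0) (F 1) g 0 k) =
  mean_form c lam e1 e2 u1 u2 l g k.
Proof.
rewrite !(frame_perp n2_neq0 c_neq0 gram_neq0 f0E f1E).
by rewrite (frame_mean n2_neq0 c_neq0 gram_neq0 f0E f1E f00E f11E f01E v1E v2E).
Qed.

Hypothesis H_sym : forall i j, H i j = H j i.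
Hypothesis lam_neq0 : lam != 0.
Hypothesis LE : forall i, L i = dot g (F i).
Let T i j := (bil H (F i) (F j) + dot g (perp (F 0) (F 1) (S i j))) / lam
  - L i * L j / lam ^+ 2.
Let N i j := perp (F 0) (F 1) (S i j).

Lemma assembly_sectional :
  lam^-1 * ((dot (N 0 0) (N 1 1) - dot (N 0 1) (N 0 1)) / gram_det (F 0) (F 1) -
    (dot (F 1) (F 1) * T 0 0 - 2 * dot (F 0) (F 1) * T 0 1 + dot (F 0) (F 0) * T 1 1) /
      (2 * gram_det (F 0) (F 1))) =
  sectional_form c lam e1 e2 u1 u2 l g H.
Proof.
rewrite /N /T !LE !(frame_perp n2_neq0 c_neq0 gram_neq0 f0E f1E) /sectional_form.
congr (_ * (_ - _)).
  exact: (frame_nu n2_neq0 c_neq0 gram_neq0 f0E f1E f00E f11E f01E v1E v2E).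
exact: (hess_frame g H_sym lam_neq0 c_neq0 n2_neq0 gram_neq0 f0E f1E
  (frame_sym00 gram_neq0 f00E v1E v2E g) (frame_sym01 l gram_neq0 f01E v1E v2E g)
  (frame_sym11 gram_neq0 f11E v1E v2E g)).
Qed.

End FrameAssembly.

(** * Lipschitz regularity *)

Section LipschitzGeometry.
Variables (R : realType) (V : normedModType R) (n : nat) (z : V).
Implicit Types (u v w : V -> 'rV[R]_n) (f g : V -> R^o).

Lemma lipschitz_atX f k : lipschitz_at f z -> lipschitz_at (fun x => f x ^+ k : R^o) z.
Proof.
move=> lf; elim: k => [|k IH]; first exact: lipschitz_at_cst.
rewrite (_ : (fun x => _) = fun x => f x * f x ^+ k : R^o); first exact: lipschitz_atM.
by apply/funext => x; rewrite exprS.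
Qed.

Lemma lipschitz_at_dot u v : lipschitz_at u z -> lipschitz_at v z ->
  lipschitz_at (fun x => dot (u x) (v x) : R^o) z.
Proof.
by move=> lu lv; apply: lipschitz_at_sum => k; apply: lipschitz_atM; exact: lipschitz_at_coord.
Qed.

Lemma lipschitz_at_bil (H : V -> 'M[R]_n) u v :
  lipschitz_at H z -> lipschitz_at u z -> lipschitz_at v z ->
  lipschitz_at (fun x => bil (H x) (u x) (v x) : R^o) z.
Proof.
move=> lH lu lv; apply: lipschitz_at_sum => i; apply: lipschitz_at_sum => j.
by apply: lipschitz_atM; [apply: lipschitz_atM|]; exact: lipschitz_at_coord.
Qed.

Lemma lipschitz_at_gram_det u v : lipschitz_at u z -> lipschitz_at v z ->
  lipschitz_at (fun x => gram_det (u x) (v x) : R^o) z.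
Proof.
move=> lu lv; apply: lipschitz_atB; last by apply: lipschitz_atX; exact: lipschitz_at_dot.
by apply: lipschitz_atM; exact: lipschitz_at_dot.
Qed.

Lemma lipschitz_at_perp u v w : gram_det (u z) (v z) != 0 ->
  lipschitz_at u z -> lipschitz_at v z -> lipschitz_at w z ->
  lipschitz_at (fun x => perp (u x) (v x) (w x)) z.
Proof.
move=> g0 lu lv lw; have lV := @lipschitz_atV _ _ (fun x => gram_det (u x) (v x)) z g0 (lipschitz_at_gram_det lu lv).
have ld := lipschitz_at_dot.
apply: lipschitz_atB; [apply: lipschitz_atB => //|]; apply: lipschitz_atZ => //;
  apply: lipschitz_atM => //; apply: lipschitz_atB; apply: lipschitz_atM; exact: ld.
Qed.

Section Curvatures.
Variables (c : R) (l0 : V -> R^o) (e1 e2 u1 u2 l g : V -> 'rV[R]_n) (H : V -> 'M[R]_n).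
Hypothesis gram_neq0 : gram_det (e1 z) (e2 z) != 0.
Hypothesis l0_neq0 : l0 z != 0.
Hypothesis c_neq0 : c != 0.
Hypothesis Ll0 : lipschitz_at l0 z.
Hypothesis Le1 : lipschitz_at e1 z.
Hypothesis Le2 : lipschitz_at e2 z.
Hypothesis Lu1 : lipschitz_at u1 z.
Hypothesis Lu2 : lipschitz_at u2 z.
Hypothesis Ll : lipschitz_at l z.
Hypothesis Lg : lipschitz_at g z.
Hypothesis LH : lipschitz_at H z.

Let Lc (a : R) : lipschitz_at (fun=> a : R^o) z.
Proof. exact: lipschitz_at_cst. Qed.

Let Lden (a : R) : a != 0 ->
  lipschitz_at (fun x => (a * gram_det (e1 x) (e2 x))^-1 : R^o) z.
Proof.
move=> a0; apply: lipschitz_atV; first exact: mulf_neq0.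
by apply: lipschitz_atM => //; exact: lipschitz_at_gram_det.
Qed.

Let Lv k : lipschitz_at (fun x => (l0 x ^+ k)^-1 : R^o) z.
Proof. by apply: lipschitz_atV; [exact: expf_neq0|exact: lipschitz_atX]. Qed.

Let L2 : lipschitz_at (fun x => (2 * l0 x)^-1 : R^o) z.
Proof.
apply: lipschitz_atV; first by rewrite mulf_neq0 // pnatr_eq0.
exact: lipschitz_atM.
Qed.

Let four_neq0 k : 4 * c ^+ k != 0.
Proof. by rewrite mulf_neq0 ?expf_neq0 // pnatr_eq0. Qed.

Lemma lipschitz_gauss_kronecker xi : lipschitz_at xi z -> lipschitz_at (fun x =>
  gauss_kronecker_form c (l0 x) (e1 x) (e2 x) (u1 x) (u2 x) (l x) (g x) (xi x) : R^o) z.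
Proof.
move=> Lxi; have dl := @lipschitz_at_dot; apply: lipschitz_atM; last exact: Lden.
have Lh : lipschitz_at (fun x => (2 * l0 x)^-1 * dot (g x) (xi x) : R^o) z.
  by apply: lipschitz_atM => //; exact: dl.
apply: lipschitz_atB; last apply: lipschitz_atD; apply: lipschitz_atX;
  apply: lipschitz_atB.
- exact: dl.
- by apply: lipschitz_atM => //; apply: lipschitz_atM => //; apply: lipschitz_atD; exact: dl.
- by apply: lipschitz_atM => //; exact: dl.
- by apply: lipschitz_atM => //; apply: lipschitz_atM => //; apply: lipschitz_atB; exact: dl.
- by apply: lipschitz_atM => //; exact: dl.
- by apply: lipschitz_atM => //; apply: lipschitz_atM => //; apply: lipschitz_atM => //; exact: dl.
Qed.

Lemma lipschitz_mean k : lipschitz_at (fun x =>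
  mean_form c (l0 x) (e1 x) (e2 x) (u1 x) (u2 x) (l x) (g x) k : R^o) z.
Proof.
have dl := @lipschitz_at_dot.
have LP w : lipschitz_at w z -> lipschitz_at (fun x => perp (e1 x) (e2 x) (w x) 0 k : R^o) z.
  by move=> Lw; apply: lipschitz_at_coord; exact: lipschitz_at_perp.
apply: lipschitz_atM => //; apply: lipschitz_atB; apply: lipschitz_atM.
- apply: lipschitz_atB; first apply: lipschitz_atB.
  + by apply: lipschitz_atM; [apply: lipschitz_atD; exact: dl|exact: LP].
  + apply: lipschitz_atM; [by apply: lipschitz_atB; exact: dl|].
    by apply: lipschitz_atM => //; exact: LP.
  + apply: lipschitz_atM; [by apply: lipschitz_atM => //; exact: dl|].
    by apply: lipschitz_atM => //; exact: LP.
- by apply: Lden; rewrite mulf_neq0 ?expf_neq0 // pnatr_eq0.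
- exact: lipschitz_atV.
- exact: LP.
Qed.

Lemma lipschitz_sectional : lipschitz_at (fun x =>
  sectional_form c (l0 x) (e1 x) (e2 x) (u1 x) (u2 x) (l x) (g x) (H x) : R^o) z.
Proof.
have dl := @lipschitz_at_dot.
have LP w : lipschitz_at w z -> lipschitz_at (fun x => perp (e1 x) (e2 x) (w x)) z.
  by move=> Lw; exact: lipschitz_at_perp.
have LN w : lipschitz_at w z -> lipschitz_at (fun x => dot (g x) (perp (e1 x) (e2 x) (w x)) : R^o) z.
  by move=> Lw; apply: dl => //; exact: LP.
have LL w : lipschitz_at w z -> lipschitz_at (fun x =>
    dot (perp (e1 x) (e2 x) (w x)) (perp (e1 x) (e2 x) (w x)) : R^o) z.
  by move=> Lw; apply: dl; exact: LP.
have Lb v w : lipschitz_at v z -> lipschitz_at w z -> lipschitz_at (fun x => bil (H x) (v x) (w x) : R^o) z.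
  by move=> *; exact: lipschitz_at_bil.
have Li := lipschitz_atV l0_neq0 Ll0.
have Lt (A B C : V -> R^o) : lipschitz_at A z -> lipschitz_at B z -> lipschitz_at C z ->
  lipschitz_at (fun x => (c ^+ 2 * A x + B x) / l0 x - c ^+ 2 * C x / l0 x ^+ 2 : R^o) z.
  move=> LA LB LC; apply: lipschitz_atB; apply: lipschitz_atM => //.
    by apply: lipschitz_atD => //; exact: lipschitz_atM.
  exact: lipschitz_atM.
have Lg1 := lipschitz_atX 2 (dl _ _ Lg Le1).
have Lg2 := lipschitz_atX 2 (dl _ _ Lg Le2).
apply: lipschitz_atM => //; apply: lipschitz_atB; apply: lipschitz_atM.
- apply: lipschitz_atB; first exact: LL.
  by apply: lipschitz_atM => //; apply: lipschitz_atD; exact: LL.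
- exact: Lden.
- apply: lipschitz_atB; first apply: lipschitz_atB; apply: lipschitz_atM.
  + by apply: lipschitz_atD; exact: dl.
  + by apply: Lt; [apply: lipschitz_atD; exact: Lb|exact: LN|exact: lipschitz_atD].
  + by apply: lipschitz_atB; exact: dl.
  + apply: Lt; [by apply: lipschitz_atB; exact: Lb| |exact: lipschitz_atB].
    by apply: lipschitz_atM => //; exact: LN.
  + by apply: lipschitz_atM => //; exact: dl.
  + apply: Lt; [by apply: lipschitz_atM => //; exact: Lb| |].
      by apply: lipschitz_atM => //; exact: LN.
    by apply: lipschitz_atM => //; apply: lipschitz_atM; exact: dl.
- exact: Lden.
Qed.

End Curvatures.
End LipschitzGeometry.

Section ComplexLipschitz.
Variable R : realType.
Implicit Types (F G : 'rV[R]_2 -> R[i]) (z : 'rV[R]_2) (D : set 'rV[R]_2).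
Local Notation Re := (@complex.Re R).
Local Notation Im := (@complex.Im R).

Lemma clipschitz_at_cst c z : clipschitz_at (fun=> c) z.
Proof. by split; exact: lipschitz_at_cst. Qed.

Lemma clipschitz_atD F G z : clipschitz_at F z -> clipschitz_at G z ->
  clipschitz_at (fun w => F w + G w) z.
Proof.
move=> [aF bF] [aG bG]; split.
  by under eq_fun do rewrite cReD; exact: lipschitz_atD.
by under eq_fun do rewrite cImD; exact: lipschitz_atD.
Qed.

Lemma clipschitz_atN F z : clipschitz_at F z -> clipschitz_at (fun w => - F w) z.
Proof.
move=> [aF bF]; split.
  by under eq_fun do rewrite cReN; exact: lipschitz_atN.
by under eq_fun do rewrite cImN; exact: lipschitz_atN.
Qed.

Lemma clipschitz_atB F G z : clipschitz_at F z -> clipschitz_at G z ->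
  clipschitz_at (fun w => F w - G w) z.
Proof. by move=> cF cG; apply: clipschitz_atD => //; exact: clipschitz_atN. Qed.

Lemma clipschitz_atM F G z : clipschitz_at F z -> clipschitz_at G z ->
  clipschitz_at (fun w => F w * G w) z.
Proof.
move=> [aF bF] [aG bG]; split.
  by under eq_fun do rewrite cReM; apply: lipschitz_atB; exact: lipschitz_atM.
by under eq_fun do rewrite cImM; apply: lipschitz_atD; exact: lipschitz_atM.
Qed.

Lemma clipschitz_at_conj F z : clipschitz_at F z -> clipschitz_at (fun w => conjc (F w)) z.
Proof.
move=> [aF bF]; split; first by under eq_fun do rewrite cReJ.
by under eq_fun do rewrite cImJ; exact: lipschitz_atN.
Qed.

Lemma clipschitz_at_real (f : 'rV[R]_2 -> R^o) z : lipschitz_at f z ->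
  clipschitz_at (fun w => (f w)%:C) z.
Proof. by move=> lf; split => //; exact: lipschitz_at_cst. Qed.

(** Reduces complex to real inverses. As the inverse of 0 is 0, the identity has no exception and
    can be used under a binder. *)
Lemma complex_inv (x : R[i]) : x^-1 = conjc x * ((Re x ^+ 2 + Im x ^+ 2)^-1)%:C.
Proof.
have [->|x0] := eqVneq x 0; first by rewrite conjc0 mul0r invr0.
apply: (mulfI x0); rewrite divff // mulrA -modC_mulJ -modC_sqr -real_complexM.
by rewrite mulfV // expf_neq0 // modC_eq0.
Qed.

Lemma clipschitz_atV F z : F z != 0 -> clipschitz_at F z ->
  clipschitz_at (fun w => (F w)^-1) z.
Proof.
move=> F0 cF; under eq_fun do rewrite complex_inv.
apply: clipschitz_atM; first exact: clipschitz_at_conj.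
move: cF => [aF bF]; apply: clipschitz_at_real; apply: lipschitz_atV.
  by rewrite -modC_sqr expf_neq0 // modC_eq0.
by apply: lipschitz_atD; exact: lipschitz_atX.
Qed.

Lemma csmooth_clipschitz D F z : open D -> D z -> csmooth D F -> clipschitz_at F z.
Proof. by move=> oD Dz [sR sI]; split; apply: C1_lipschitz oD Dz _; [exact: (sR 1%N)|exact: (sI 1%N)]. Qed.

Lemma clipschitz_quot_on D F s z : open D -> D 0 -> D z -> csmooth D F -> F 0 = 0 ->
  flat s (dz F) -> flat s (dzbar F) -> clipschitz_at (fun w => F w / toC w ^+ s) z.
Proof.
move=> oD D0 Dz sF F0 f1 f2; have [->|z0] := eqVneq z 0.
  exact: clipschitz_quot oD D0 sF F0 f1 f2.
apply: clipschitz_atM; first exact: csmooth_clipschitz sF.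
apply: clipschitz_atV; first by rewrite expf_neq0 // toC_eq0.
exact: csmooth_clipschitz (csmooth_toCX s oD).
Qed.

End ComplexLipschitz.

(** * Lipschitz continuity of the oblique components *)

Section BranchLipschitz.
Variables (R : realType) (n : nat) (hn : (3 <= n)%N) (s : nat).
Variable D : set 'rV[R]_2.
Variables (d : 'rV[R]_2 -> 'rV[R[i]]_n) (l : 'rV[R]_2 -> 'rV[R]_n).
Local Notation Re := (@complex.Re R).
Local Notation Im := (@complex.Im R).
Local Notation k1 := (first hn).
Local Notation k2 := (second hn).

Hypothesis oD : open D.
Hypothesis D0 : D 0.
Hypothesis sdR : smooth_on D (fun z => map_mx Re (d z)).
Hypothesis sdI : smooth_on D (fun z => map_mx Im (d z)).
Hypothesis sl : smooth_on D l.
Hypothesis Jneq0 : forall z, D z -> jac hn d z != 0.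

Local Notation c := (s.+1%:R : R).
Local Notation dk k := (fun z => d z 0 k).
Local Notation Lk k := (fun z => (l z 0 k / c)%:C).

Let sd k : csmooth D (dk k). Proof. exact: csmooth_d. Qed.
Let sL k : csmooth D (Lk k). Proof. exact: csmooth_l. Qed.
Hypothesis dbar : forall k w, D w -> dzbar (dk k) w = conjc (toC w) ^+ s * Lk k w.

Lemma dzbar_wd k w : D w -> dzbar (dz (dk k)) w = conjc (toC w) ^+ s * dz (Lk k) w.
Proof. by move=> Dw; exact: (@iter_dzbar _ D (dk k) (Lk k) s 1 w oD (sd k) (sL k) (@dbar k) Dw). Qed.

Lemma flat_dzbar_conj F G : csmooth D G ->
  (forall w, D w -> dzbar F w = conjc (toC w) ^+ s * G w) -> flat s (dzbar F).
Proof.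
move=> sG FG; have [r r0 rD] := open_ball oD D0.
apply: (flat_near r0 (F := fun w => conjc (toC w ^+ s) * G w)).
  by move=> w wr; rewrite FG ?rmorphXn //; apply: rD; rewrite sub0r normrN.
apply: (@flatW _ (s + 0)); first by rewrite addn0.
apply: flatM; first exact/flat_conj/flat_toCX.
exact: csmooth_flat oD D0 sG.
Qed.

Section Coordinate.
Variable k : 'I_n.
Hypothesis vanish : forall j, (j <= s)%N -> iter j (@dz R) (dk k) 0 = 0.

(** The conjugate is included because [e1] and [e2] are the real and imaginary parts of [d], whereas
    the divisor z^s is complex. Conjugation exchanges dz and dzbar, and both derivatives of d_k have
    order [s]. *)
Lemma clipschitz_d_quot z : D z ->
  clipschitz_at (fun w => d w 0 k / toC w ^+ s) z /\
  clipschitz_at (fun w => conjc (d w 0 k) / toC w ^+ s) z.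
Proof.
move=> Dz; have d0 : d 0 0 k = 0 by exact: (vanish (leq0n s)).
have fd : flat s (dz (dk k)).
  have := @flat_iter _ D (dk k) (Lk k) s s.+1 oD D0 (sd k) (sL k) (@dbar k) (leqnn _) vanish 1%N isT.
  by rewrite subSS subn0.
have fb : flat s (dzbar (dk k)) := flat_dzbar_conj (sL k) (@dbar k).
split; first exact: clipschitz_quot_on oD D0 Dz (sd k) d0 fd fb.
have [r r0 rD] := open_ball oD D0.
apply: (clipschitz_quot_on oD D0 Dz); first exact: csmooth_conj.
- by rewrite d0 conjc0.
- apply: (flat_near r0 (F := fun w => conjc (dzbar (dk k) w))); last exact: flat_conj.
  move=> w wr; rewrite dz_conj //; apply: csmooth_diff (sd k).
  by apply: rD; rewrite sub0r normrN.
- apply: (flat_near r0 (F := fun w => conjc (dz (dk k) w))); last exact: flat_conj.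
  move=> w wr.
  have Dw : D w by apply: rD; rewrite sub0r normrN.
  have dw := csmooth_diff Dw (sd k).
  have e : (fun w => conjc (conjc (d w 0 k))) = dk k by apply/funext => v; exact: conjcK.
  by have := dz_conj (cdiff_conj dw); rewrite e => ->; rewrite conjcK.
Qed.

Lemma clipschitz_e_quot z : D z ->
  clipschitz_at (fun w => (e1 d w 0 k)%:C / toC w ^+ s) z /\
  clipschitz_at (fun w => (e2 d w 0 k)%:C / toC w ^+ s) z.
Proof.
move=> Dz; have [h1 h2] := clipschitz_d_quot Dz.
have two : (2 : R[i]) != 0 by rewrite pnatr_eq0.
split.
  have := clipschitz_atM (clipschitz_at_cst 2^-1 z) (clipschitz_atD h1 h2).
  congr (clipschitz_at _ z); apply/funext => w; rewrite -mulrDl mulrA mxE; congr (_ / _).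
  apply: (mulfI two); rewrite mulrA mulfV // mul1r natC_complex -real_complexM.
  by case: (d w 0 k) => a b /=; apply/eqP; rewrite eq_complex /= subrr eqxx andbT; apply/eqP; ring.
have := clipschitz_atM (clipschitz_at_cst (2^-1 * - 'i%C) z) (clipschitz_atB h1 h2).
congr (clipschitz_at _ z); apply/funext => w; rewrite -mulrBl mulrA mxE; congr (_ / _).
apply: (mulfI two); rewrite mulrA mulrA mulfV // mul1r natC_complex -real_complexM.
by case: (d w 0 k) => a b /=; apply/eqP; rewrite eq_complex /=; apply/andP; split; apply/eqP; ring.
Qed.

(** dz d_k has one order less than d_k and in general starts with cc z^s. Without this monomial it
    has order s + 1 and [clipschitz_quot] applies; [cU] restores the limit by adding [cc]. *)
Lemma clipschitz_wd_quot : exists cc, forall z, D z ->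
  clipschitz_at (fun w => (wd d w k - cc * toC w ^+ s) / toC w ^+ s) z.
Proof.
have sG : csmooth D (dz (dk k)) := csmooth_dz oD (sd k).
have sK : csmooth D (dz (Lk k)) := csmooth_dz oD (sL k).
have van j : (j < s)%N -> iter j (@dz R) (dz (dk k)) 0 = 0.
  by move=> js; rewrite -iterSr; exact: vanish.
have [cc _ [f1 f2 [sH HL]]] :=
  flat_leading oD D0 sG sK (@dzbar_wd k) (leqnn s) van.
exists cc => z Dz; apply: (clipschitz_quot_on oD D0 Dz sH) => //.
  have [r /andP[r0 _] [C C0 /(_ 0)]] := f1; rewrite normr0 expr0n mulr0 => /(_ r0) h.
  by apply/eqP; rewrite -modC_eq0 eq_le h modC_ge0.
exact: flat_dzbar_conj HL.
Qed.

End Coordinate.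

Lemma lipschitz_e z k : D z -> lipschitz_at (fun w => e1 d w 0 k : R^o) z /\
  lipschitz_at (fun w => e2 d w 0 k : R^o) z.
Proof.
by move=> Dz; split; apply: C1_lipschitz oD Dz _; apply: Ck_on_coord.
Qed.

Lemma lipschitz_jacV z : D z -> lipschitz_at (fun w => (jac hn d w)^-1 : R^o) z.
Proof.
move=> Dz; apply: lipschitz_atV; first exact: Jneq0.
have le k := lipschitz_e k Dz.
by apply: lipschitz_atB; apply: lipschitz_atM; [case: (le k1)|case: (le k2)|case: (le k2)|case: (le k1)].
Qed.

Lemma clipschitz_cX z : D z -> clipschitz_at (cX hn d) z.
Proof.
move=> Dz; have sw k : clipschitz_at (fun w => wd d w k) z.
  by apply: csmooth_clipschitz oD Dz _; exact: csmooth_dz.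
apply: clipschitz_atM; last exact/clipschitz_at_real/lipschitz_jacV.
have le k := lipschitz_e k Dz.
by apply: clipschitz_atB; apply: clipschitz_atM => //; apply: clipschitz_at_real;
  [case: (le k2)|case: (le k1)].
Qed.

Lemma clipschitz_cY z : D z -> clipschitz_at (cY hn d) z.
Proof.
move=> Dz; have sw k : clipschitz_at (fun w => wd d w k) z.
  by apply: csmooth_clipschitz oD Dz _; exact: csmooth_dz.
apply: clipschitz_atM; last exact/clipschitz_at_real/lipschitz_jacV.
have le k := lipschitz_e k Dz.
by apply: clipschitz_atB; apply: clipschitz_atM => //; apply: clipschitz_at_real;
  [case: (le k1)|case: (le k2)].
Qed.

Hypothesis vanish : forall k : 'I_n, (2 <= k)%N ->
  forall j, (j <= s)%N -> iter j (@dz R) (dk k) 0 = 0.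

Lemma lipschitz_u : exists cc, forall z, D z ->
  lipschitz_at (u1 hn s d cc) z /\ lipschitz_at (u2 hn s d cc) z.
Proof.
(* A coefficient is only required for [2 <= k]; in the first two coordinates 0 is a placeholder. *)
have H (k : 'I_n) : exists cc : R[i], (2 <= k)%N -> forall z, D z ->
    clipschitz_at (fun w => (wd d w k - cc * toC w ^+ s) / toC w ^+ s) z.
  have [k2|_] := boolP (2 <= k)%N; last by exists 0.
  by have [cc h] := clipschitz_wd_quot (vanish k2); exists cc.
have [cc ccP] := choice H; exists cc => z Dz.
have lX := clipschitz_cX Dz; have lY := clipschitz_cY Dz.
have lU k : clipschitz_at (fun w => cU hn s d cc w k) z.
  rewrite /cU; move: (@vanish k) (ccP k); case: (2 <= k)%N => [/(_ isT) van /(_ isT) cck|_ _];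
    last exact: clipschitz_at_cst.
  have [q1 q2] := clipschitz_e_quot van Dz.
  apply: clipschitz_atB; first apply: clipschitz_atB; first apply: clipschitz_atD.
  - exact: clipschitz_at_cst.
  - exact: cck.
  - exact: clipschitz_atM.
  - exact: clipschitz_atM.
split; apply: lipschitz_at_mx => i k; under eq_fun do rewrite mxE.
  by have [] := lU k.
by have [] := lU k.
Qed.

End BranchLipschitz.

(** * Blow-up *)

Lemma lipschitz_at_bounded (R : realType) (V W : normedModType R) (F : V -> W) z :
  lipschitz_at F z -> exists2 C : R, 0 < C & \forall w \near z, `|F w| <= C.
Proof. by move=> lF; exact/continuous_bounded_near/lipschitz_at_continuous. Qed.

(** To be read with t = |z| and [q] the modulus of a quotient by z^s. Half of a t^m absorbs the
    remainder C t^(m+1), and the other half exceeds T (2t)^s for small t because m < s. The 2 is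
    that of [modC_normr]. *)
Lemma quotient_bound (K : realFieldType) (a C T t q : K) m s : 0 < a -> 0 <= C ->
  0 < T -> 0 < t -> t <= 1 -> (m < s)%N ->
  C * t <= a / 2 -> 2 ^+ s * T * t <= a / 2 ->
  a * t ^+ m <= q * (2 * t) ^+ s + C * t ^+ m.+1 -> T <= q.
Proof.
move=> a0 C0 T0 t0 t1 ms Ct Tt h.
have tm : 0 < t ^+ m by exact: exprn_gt0.
have h1 : C * t ^+ m.+1 <= a / 2 * t ^+ m by rewrite exprS mulrA ler_wpM2r // ltW.
have h2 : a / 2 * t ^+ m <= q * (2 * t) ^+ s.
  by move: h h1; move: (C * _) (q * _) (t ^+ m) => x y w; lra.
have ts : t ^+ s <= t * t ^+ m.
  by rewrite -exprS; apply: ler_wiXn2l => //; exact: ltW.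
have ts0 : 0 < (2 * t) ^+ s by rewrite exprn_gt0 // mulr_gt0.
rewrite -(ler_pM2r ts0); apply: le_trans h2; rewrite exprMn mulrA [T * _]mulrC.
have p0 : 0 <= 2 ^+ s * T by rewrite mulr_ge0 ?exprn_ge0 // ltW.
apply: le_trans (ler_wpM2l p0 ts) _.
by rewrite mulrA ler_wpM2r // ltW.
Qed.

Section BlowUpQuotient.
Variable R : realType.
Implicit Types (F G : 'rV[R]_2 -> R[i]) (z : 'rV[R]_2).

Lemma flatN k F : flat k F -> flat k (fun w => - F w).
Proof.
move=> [r r0 [C C0 CF]]; exists r => //; exists C => // z zr.
by rewrite modCN; exact: CF.
Qed.

Lemma clipschitz_flat F : clipschitz_at F 0 -> flat 0 F.
Proof. by move=> [aF bF]; apply: flat_cont; exact: lipschitz_at_continuous. Qed.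

Lemma quotient_blowup (a : R[i]) F m s : a != 0 -> (m < s)%N -> flat m.+1 F ->
  forall T : R, \forall z \near (0 : 'rV[R]_2), z != 0 ->
    T <= modC ((a * toC z ^+ m + F z) / toC z ^+ s).
Proof.
move=> a0 ms [r /andP[r0 r1] [C C0 CF]] T.
(* [quotient_bound] needs a positive threshold. *)
pose T' := Num.max T 1.
have T'0 : 0 < T' by rewrite lt_max ltr01 orbT.
have am : 0 < modC a by rewrite modC_gt0.
pose e := Num.min r (Num.min (modC a / 2 / (C + 1)) (modC a / 2 / (2 ^+ s * T'))).
have C1 : 0 < C + 1 by rewrite ltr_wpDl.
have p0 : 0 < 2 ^+ s * T' by rewrite mulr_gt0 // exprn_gt0.
have e0 : 0 < e by rewrite !lt_min r0 !divr_gt0.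
have : nbhs (0 : 'rV[R]_2) (ball (0 : 'rV[R]_2) e) by exact: nbhsx_ballx.
apply: filterS => z; rewrite -ball_normE /= sub0r normrN !lt_min.
move=> /and3P[zr z1 z2] z0.
have nz : 0 < `|z| by rewrite normr_gt0.
have le_T : T <= T' by rewrite le_max lexx.
apply: le_trans le_T _.
apply: (@quotient_bound _ (modC a) C T' `|z| _ m s) => //.
- exact: le_trans (ltW zr) r1.
- move: z1; rewrite ltr_pdivlMr // mulrDr mulr1 => z1.
  by rewrite mulrC; move: z1 nz; move: (`|z| * C) (`|z|) => x y; lra.
- by move: z2; rewrite ltr_pdivlMr // mulrC => /ltW.
have zs : 0 < modC (toC z) ^+ s by rewrite exprn_gt0 // modC_gt0 toC_eq0.
rewrite modCM modCV modCX.
have h : modC a * `|z| ^+ m <= modC (a * toC z ^+ m + F z) + C * `|z| ^+ m.+1.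
  apply: (@le_trans _ _ (modC (a * toC z ^+ m))).
    rewrite modCM modCX; apply: ler_wpM2l; first exact: modC_ge0.
    by apply: lerXn2r; rewrite ?nnegrE ?modC_ge0 // normr_modC.
  rewrite -{1}(addrK (F z) (a * toC z ^+ m)); apply: le_trans (modCD _ _) _.
  by rewrite modCN lerD2l; exact: CF.
apply: le_trans h _; rewrite lerD2r -mulrA ler_peMr ?modC_ge0 //.
rewrite mulrC ler_pdivlMr // mul1r; apply: lerXn2r; rewrite ?nnegrE ?modC_ge0 ?mulr_ge0 //.
exact: modC_normr.
Qed.

End BlowUpQuotient.

(** The two coordinates in which the vector vanishes determine [g] and [h], which are thereby
    eliminated. *)
Lemma oblique_coord (K : fieldType) (x1 x2 a1 a2 b1 b2 a b x g h y : K) :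
  a1 * b2 - a2 * b1 != 0 ->
  0 = x1 + g * a1 + h * b1 -> 0 = x2 + g * a2 + h * b2 -> y = x + g * a + h * b ->
  y = x + (a2 * b - b2 * a) / (a1 * b2 - a2 * b1) * x1
        + (b1 * a - a1 * b) / (a1 * b2 - a2 * b1) * x2.
Proof.
move=> J0 E1 E2 ->.
have X1 : x1 = - (g * a1 + h * b1) by apply/eqP; rewrite -subr_eq0 opprK addrA -E1.
have X2 : x2 = - (g * a2 + h * b2) by apply/eqP; rewrite -subr_eq0 opprK addrA -E2.
by rewrite X1 X2; field.
Qed.

Lemma sqr_sum3_le (K : realFieldType) (x y w A B N : K) :
  x ^+ 2 <= N -> y ^+ 2 <= N -> w ^+ 2 <= N ->
  (x + A * y + B * w) ^+ 2 <= 3 * (1 + A ^+ 2 + B ^+ 2) * N.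
Proof.
move=> hx hy hw.
have h : (x + A * y + B * w) ^+ 2 <= 3 * (x ^+ 2 + (A * y) ^+ 2 + (B * w) ^+ 2).
  move: (A * y) (B * w) => p q.
  have := sqr_ge0 (x - p); have := sqr_ge0 (x - q); have := sqr_ge0 (p - q).
  rewrite !expr2; lra.
apply: le_trans h _; rewrite -mulrA ler_wpM2l //.
rewrite !mulrDl mul1r !exprMn; apply: lerD; first apply: lerD => //.
  by apply: ler_wpM2l => //; exact: sqr_ge0.
by apply: ler_wpM2l => //; exact: sqr_ge0.
Qed.

Section BranchBlowUp.
Variables (R : realType) (n : nat) (hn : (3 <= n)%N) (s : nat).
Variable D : set 'rV[R]_2.
Variables (d : 'rV[R]_2 -> 'rV[R[i]]_n) (l : 'rV[R]_2 -> 'rV[R]_n).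
Local Notation Re := (@complex.Re R).
Local Notation Im := (@complex.Im R).
Local Notation k1 := (first hn).
Local Notation k2 := (second hn).

Hypothesis oD : open D.
Hypothesis D0 : D 0.
Hypothesis sdR : smooth_on D (fun z => map_mx Re (d z)).
Hypothesis sdI : smooth_on D (fun z => map_mx Im (d z)).
Hypothesis sl : smooth_on D l.
Hypothesis Jneq0 : forall z, D z -> jac hn d z != 0.

Local Notation c := (s.+1%:R : R).
Local Notation dk k := (fun z => d z 0 k).
Local Notation Lk k := (fun z => (l z 0 k / c)%:C).

Hypothesis dbar : forall k w, D w -> dzbar (dk k) w = conjc (toC w) ^+ s * Lk k w.

Local Notation e1 := (e1 d).
Local Notation e2 := (e2 d).
Local Notation P z := (perp (e1 z) (e2 z)).
Local Notation U1 := (u1 hn s d (fun=> 0)).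
Local Notation U2 := (u2 hn s d (fun=> 0)).

Variables (k : 'I_n) (m : nat).
Hypothesis k_ge2 : (2 <= k)%N.
Hypothesis m_lt : (m < s)%N.
Hypothesis vanish : forall j, (j <= m)%N -> iter j (@dz R) (dk k) 0 = 0.
Hypothesis leading : iter m.+1 (@dz R) (dk k) 0 <> 0.

(** dz d_k equals a (m+1) z^m up to order m + 1. The terms with [cX] and [cY] also have order m + 1,
    since d_k does and the coefficients are bounded; so the monomial governs the quotient by z^s. *)
Lemma cU_blowup (T : R) : \forall z \near (0 : 'rV[R]_2), z != 0 ->
  T <= modC (cU hn s d (fun=> 0) z k).
Proof.
have sd := csmooth_d oD sdR sdI k; have sL := csmooth_l s oD sl k.
have ms : (m.+1 <= s)%N by [].
have [a aE [_ f2 [sH HL]]] := flat_leading oD D0 sd sL (@dbar k) ms vanish.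
have a0 : a != 0 by apply/eqP => a0; apply: leading; rewrite -aE a0 mul0r.
have fd : flat m.+1 (dk k).
  exact: (@flat_iter _ D (dk k) (Lk k) s m.+1 oD D0 sd sL (@dbar k) (ltnW ms) vanish 0%N isT).
have fe1 : flat m.+1 (fun w => (e1 w 0 k)%:C).
  move: fd => [r r0 [C C0 CF]]; exists r => //; exists C => // z /CF.
  by apply: le_trans; rewrite mxE -{1}[Re _]/(Re (Re (d z 0 k))%:C);
    apply: le_trans (modC_le _) _; rewrite /= normr0 addr0; exact: modC_Re.
have fe2 : flat m.+1 (fun w => (e2 w 0 k)%:C).
  move: fd => [r r0 [C C0 CF]]; exists r => //; exists C => // z /CF.
  by apply: le_trans; rewrite mxE;
    apply: le_trans (modC_le _) _; rewrite /= normr0 addr0; exact: modC_Im.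
have fX := clipschitz_flat (clipschitz_cX oD sdR sdI Jneq0 D0).
have fY := clipschitz_flat (clipschitz_cY oD sdR sdI Jneq0 D0).
set H := fun w => _ in f2 sH HL.
pose F w := dz H w - cX hn d w * (e1 w 0 k)%:C - cY hn d w * (e2 w 0 k)%:C.
have fF : flat m.+1 F.
  apply: flatD; last by apply: flatN; exact: (flatM fY fe2).
  by apply: flatD => //; apply: flatN; exact: (flatM fX fe1).
have aa : a * m.+1%:R != 0 by rewrite mulf_neq0 // pnatr_eq0.
have near_D : \forall z \near (0 : 'rV[R]_2), D z by exact: open_near.
have := quotient_blowup aa m_lt fF T; apply: filterS2 near_D => z Dz h z0; move: (h z0); congr (_ <= modC _).
have dd : cdiff (dk k) z := csmooth_diff Dz sd.
have E : dz H z = wd d z k - a * (m.+1%:R * toC z ^+ m).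
  rewrite /H dzD //; last first.
    by rewrite -[X in cdiff X _]/(fun w => _); under eq_fun do rewrite -mulNr; exact: cdiffM (cdiff_cst _ _) (cdiff_toCX _ _).
  under [in X in _ + X]eq_fun do rewrite -mulNr.
  by rewrite dzZ ?dz_toCX ?mulNr //; exact: cdiff_toCX.
rewrite /cU k_ge2 /F E add0r mul0r subr0 !mulrA.
by rewrite -!mulrBl; congr (_ / _); rewrite addrA addrA; congr (_ - _ - _); rewrite addrC subrK.
Qed.

Let A z : R := (e1 z 0 k2 * e2 z 0 k - e2 z 0 k2 * e1 z 0 k) / jac hn d z.
Let B z : R := (e2 z 0 k1 * e1 z 0 k - e1 z 0 k1 * e2 z 0 k) / jac hn d z.

(** The difference of [u] and its projection is a combination of [e1] and [e2]. As the first two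
    coordinates of [u] vanish, they express that combination through those of the projection; [A]
    and [B] are the resulting coefficients. *)
Lemma oblique_le z (u : 'rV[R]_n) : D z -> u 0 k1 = 0 -> u 0 k2 = 0 ->
  u 0 k ^+ 2 <= 3 * (1 + A z ^+ 2 + B z ^+ 2) * dot (P z u) (P z u).
Proof.
move=> Dz u1 u2.
pose g := (dot (e2 z) (e2 z) * dot u (e1 z) - dot (e1 z) (e2 z) * dot u (e2 z)) / gram_det (e1 z) (e2 z).
pose h := (dot (e1 z) (e1 z) * dot u (e2 z) - dot (e1 z) (e2 z) * dot u (e1 z)) / gram_det (e1 z) (e2 z).
have uE i : u 0 i = P z u 0 i + g * e1 z 0 i + h * e2 z 0 i.
  have -> : P z u = u - g *: e1 z - h *: e2 z by [].
  by rewrite !mxE; ring.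
have E1 := uE k1; have E2 := uE k2; have E := uE k.
rewrite u1 in E1; rewrite u2 in E2.
rewrite (oblique_coord (Jneq0 Dz) E1 E2 E).
by apply: sqr_sum3_le; exact: sqr_le_dot.
Qed.

Lemma normal_blowup (T : R) : \forall z \near (0 : 'rV[R]_2), z != 0 ->
  T <= dot (P z (U1 z)) (P z (U1 z)) + dot (P z (U2 z)) (P z (U2 z)).
Proof.
have le i := lipschitz_e oD sdR sdI i D0.
have lJ := lipschitz_jacV oD sdR sdI Jneq0 D0.
have lA : lipschitz_at (fun z => A z : R^o) 0.
  apply: lipschitz_atM => //; apply: lipschitz_atB; apply: lipschitz_atM;
  by [case: (le k2)|case: (le k)].
have lB : lipschitz_at (fun z => B z : R^o) 0.
  apply: lipschitz_atM => //; apply: lipschitz_atB; apply: lipschitz_atM;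
  by [case: (le k1)|case: (le k)].
have lC : lipschitz_at (fun z => 3 * (1 + A z ^+ 2 + B z ^+ 2) : R^o) 0.
  apply: lipschitz_atM; first exact: lipschitz_at_cst.
  apply: lipschitz_atD; last exact: lipschitz_atX.
  by apply: lipschitz_atD; [exact: lipschitz_at_cst|exact: lipschitz_atX].
have [C C0 near_C] := lipschitz_at_bounded lC.
(* [C] compensates the factor in [oblique_le]; a threshold of at least 1 lets a bound for the
   modulus serve for its square. *)
pose T' := Num.max (C * T) 1.
have near_D : \forall z \near (0 : 'rV[R]_2), D z by exact: open_near.
have := cU_blowup T'; have := near_C.
apply: filterS3 near_D => z Dz Cz h0 z0; have h := h0 z0.
have nU (i : 'I_n) : (2 <= i)%N = false -> U1 z 0 i = 0 /\ U2 z 0 i = 0.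
  by move=> i2; rewrite !mxE /cU i2.
have [a1 a2] := nU k1 erefl; have [b1 b2] := nU k2 erefl.
have h1 := oblique_le Dz a1 b1; have h2 := oblique_le Dz a2 b2.
have N := modC_sqr (cU hn s d (fun=> 0) z k).
have U1E : U1 z 0 k = Re (cU hn s d (fun=> 0) z k) by rewrite mxE.
have U2E : U2 z 0 k = Im (cU hn s d (fun=> 0) z k) by rewrite mxE.
rewrite -U1E -U2E in N.
have T1 : 1 <= T' by rewrite le_max lexx orbT.
have CT : C * T <= T' by rewrite le_max lexx.
have M : T' <= modC (cU hn s d (fun=> 0) z k) ^+ 2.
  have h' := h; apply: (le_trans h'); rewrite expr2 ler_peMr ?modC_ge0 //; exact: le_trans T1 h'.
rewrite N in M.
have CC : 3 * (1 + A z ^+ 2 + B z ^+ 2) <= C by exact: le_trans (ler_norm _) Cz.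
have d1 := dot_ge0 (P z (U1 z)); have d2 := dot_ge0 (P z (U2 z)).
rewrite -(ler_pM2l C0); apply: le_trans CT _; apply: le_trans M _.
rewrite mulrDr; apply: lerD.
  by apply: le_trans h1 _; exact: ler_wpM2r.
by apply: le_trans h2 _; exact: ler_wpM2r.
Qed.

End BranchBlowUp.

(** * Orthonormal normal frames, and the dependence of the curvatures on u *)

Section NormalFrame.
Variables (K : fieldType) (n : nat) (e1 e2 : 'rV[K]_n) (lam : K).
Variable xi : 'I_(n - 2) -> 'rV[K]_n.
Hypothesis gram_neq0 : gram_det e1 e2 != 0.
Hypothesis lam_neq0 : lam != 0.
Hypothesis xi_e1 : forall j, dot (xi j) e1 = 0.
Hypothesis xi_e2 : forall j, dot (xi j) e2 = 0.
Hypothesis xi_orth : forall i j, lam * dot (xi i) (xi j) = (i == j)%:R.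

Lemma mulmx_tr_dot m1 m2 (A : 'M[K]_(m1, n)) (B : 'M[K]_(m2, n)) i j :
  (A *m B^T) i j = dot (row i A) (row j B).
Proof. by rewrite mxE; apply: eq_bigr => k _; rewrite !mxE. Qed.

Lemma dot_suml (I : finType) (a : I -> K) (v : I -> 'rV[K]_n) w :
  dot (\sum_j a j *: v j) w = \sum_j a j * dot (v j) w.
Proof.
rewrite /dot; under eq_bigr do rewrite summxE mulr_suml.
rewrite exchange_big; apply: eq_bigr => j _; rewrite mulr_sumr.
by apply: eq_bigr => k _; rewrite mxE mulrA.
Qed.

(** A dimension count: the frame is independent by orthonormality, so its span has dimension n - 2,
    which is that of the orthogonal complement of [e1], [e2]. *)
Lemma normal_frame_span v : dot v e1 = 0 -> dot v e2 = 0 ->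
  v = \sum_j (lam * dot v (xi j)) *: xi j.
Proof.
move=> v1 v2.
pose E : 'M[K]_(2, n) := \matrix_(i < 2) (if i == 0 then e1 else e2).
pose X : 'M[K]_(n - 2, n) := \matrix_(j < n - 2) xi j.
have rE : \rank E^T = 2%N.
  apply/eqP; rewrite eqn_leq rank_leq_col /=.
  have u : E *m E^T \in unitmx.
    rewrite unitmxE det2 !mulmx_tr_dot !rowK /= unitfE (dotC e2 e1) -expr2.
    exact: gram_neq0.
  by rewrite -[leqLHS](mxrank_unit u) mxrankM_maxr.
have kerP (w : 'rV[K]_n) : dot w e1 = 0 -> dot w e2 = 0 -> (w <= kermx E^T)%MS.
  move=> w1 w2; apply/sub_kermxP/rowP => i; rewrite mulmx_tr_dot rowK [RHS]mxE.
  by have -> : row 0 w = w by [apply/rowP => k; rewrite mxE]; case: eqP.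
have XX : X *m X^T = lam^-1%:M.
  apply/matrixP => i j; rewrite mulmx_tr_dot !rowK !mxE.
  by apply: (mulfI lam_neq0); rewrite xi_orth mulrnAr mulfV.
have rX : \rank X = (n - 2)%N.
  apply/eqP; rewrite eqn_leq rank_leq_row /=.
  have u : X *m X^T \in unitmx by rewrite XX unitmxE det_scalar unitrX // unitfE invr_neq0.
  by rewrite -[leqLHS](mxrank_unit u) mxrankM_maxl.
have XK : (X <= kermx E^T)%MS.
  by apply/row_subP => j; rewrite rowK; exact: kerP.
have KX : (kermx E^T <= X)%MS.
  by rewrite -(geq_leqif (mxrank_leqif_sup XK)) mxrank_ker rE rX.
have /submxP [a vE] := submx_trans (kerP v v1 v2) KX.
have vsum : v = \sum_j a 0 j *: xi j.
  rewrite vE mulmx_sum_row; apply: eq_bigr => j _; by rewrite rowK.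
rewrite {1}vsum; apply: eq_bigr => i _; congr (_ *: _).
rewrite vsum dot_suml.
rewrite mulr_sumr (bigD1 i) //= big1 ?addr0 => [|j ji].
  by rewrite mulrCA xi_orth eqxx mulr1.
by rewrite mulrCA xi_orth (negbTE ji) mulr0.
Qed.

Lemma normal_frame_parseval v w : dot v e1 = 0 -> dot v e2 = 0 ->
  \sum_j dot v (xi j) * dot w (xi j) = lam^-1 * dot v w.
Proof.
move=> v1 v2; rewrite {2}(normal_frame_span v1 v2) dot_suml mulr_sumr.
apply: eq_bigr => j _; by rewrite !mulrA mulVf // mul1r (dotC w).
Qed.

Lemma dot_perp_perp v w : dot v (perp e1 e2 w) = dot (perp e1 e2 v) (perp e1 e2 w).
Proof.
by rewrite [RHS]dot_perp_normal //; [exact: dot_perp1|exact: dot_perp2].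
Qed.

Variables (c : K) (u1 u2 l g : 'rV[K]_n).
Local Notation P := (perp e1 e2).
Local Notation p := (dot e1 e1).
Local Notation q := (dot e1 e2).
Local Notation r := (dot e2 e2).
Hypothesis c_neq0 : c != 0.
Hypothesis two_neq0 : (2 : K) != 0.

(** The curvature as a quadratic polynomial in the normal parts of [u1], [u2]: value at u = 0,
    linear terms, and a multiple of the squared norm. *)
Lemma sectional_form_split (H : 'M[K]_n) :
  sectional_form c lam e1 e2 u1 u2 l g H =
  sectional_form c lam e1 e2 0 0 l g H
  + dot (((p - r) / (4 * c * gram_det e1 e2 * lam ^+ 2)) *: g) (P u1)
  + dot ((2 * q / (4 * c * gram_det e1 e2 * lam ^+ 2)) *: g) (P u2)
  - (4 * c ^+ 2 * gram_det e1 e2 * lam)^-1 * (dot (P u1) (P u1) + dot (P u2) (P u2)).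
Proof.
have P0 : P 0 = 0 by have := perpZ e1 e2 0 0; rewrite !scale0r.
have D0 v : dot v (0 : 'rV[K]_n) = 0 by have := dotZr 0 (0 : 'rV[K]_n) v; rewrite scale0r mul0r.
rewrite /sectional_form P0 !D0 !dotZl.
move: (bil H e1 e1) (bil H e1 e2) (bil H e2 e2) (dot g e1) (dot g e2) (dot g (P u1))
  (dot g (P u2)) (dot g (P l)) (dot (P l) (P l)) (dot (P u1) (P u1)) (dot (P u2) (P u2)).
move: p q r (gram_det e1 e2) gram_neq0 => a b e D D0'.
move=> x1 x2 x3 x4 x5 x6 x7 x8 x9 x10 x11.
have four : (4 : K) != 0 by rewrite (natrM K 2 2) mulf_neq0.
by field; rewrite lam_neq0 D0' c_neq0 four.
Qed.

Lemma gauss_kronecker_form_split x :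
  gauss_kronecker_form c lam e1 e2 u1 u2 l g x =
  gauss_kronecker_form c lam e1 e2 0 0 l g x
  + (p - r) / (4 * c * gram_det e1 e2 * lam) * (dot u1 x * dot g x)
  + 2 * q / (4 * c * gram_det e1 e2 * lam) * (dot u2 x * dot g x)
  - (4 * c ^+ 2 * gram_det e1 e2)^-1 * (dot u1 x * dot u1 x + dot u2 x * dot u2 x).
Proof.
have D0 : dot 0 x = 0 by have := dotZl 0 (0 : 'rV[K]_n) x; rewrite scale0r mul0r.
rewrite /gauss_kronecker_form !D0.
move: (dot u1 x) (dot u2 x) (dot g x) (dot l x) => x1 x2 x3 x4.
move: p q r (gram_det e1 e2) gram_neq0 => a b e D D0'.
have four : (4 : K) != 0 by rewrite (natrM K 2 2) mulf_neq0.
by field; rewrite lam_neq0 D0' c_neq0 four.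
Qed.

(** By Parseval the terms in [u1], [u2] are exactly those of [sectional_form_split]. This agrees
    with the Gauss equation: Sec minus the sum of the Gauss-Kronecker curvatures is a sectional
    curvature of the ambient space. *)
Lemma sum_gauss_kronecker_form_split :
  \sum_j gauss_kronecker_form c lam e1 e2 u1 u2 l g (xi j) =
  \sum_j gauss_kronecker_form c lam e1 e2 0 0 l g (xi j)
  + dot (((p - r) / (4 * c * gram_det e1 e2 * lam ^+ 2)) *: g) (P u1)
  + dot ((2 * q / (4 * c * gram_det e1 e2 * lam ^+ 2)) *: g) (P u2)
  - (4 * c ^+ 2 * gram_det e1 e2 * lam)^-1 * (dot (P u1) (P u1) + dot (P u2) (P u2)).
Proof.
under eq_bigr do rewrite gauss_kronecker_form_split.
rewrite big_split /= big_split /= big_split /= sumrN -!mulr_sumr big_split /=.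
have S u w : \sum_j dot u (xi j) * dot w (xi j) = lam^-1 * dot w (P u).
  rewrite (dotC w) -normal_frame_parseval; [|exact: dot_perp1|exact: dot_perp2].
  by apply: eq_bigr => j _; rewrite dot_perp_normal.
rewrite !S (dot_perp_perp u1 u1) (dot_perp_perp u2 u2) !dotZl.
move: (\sum_j gauss_kronecker_form _ _ _ _ _ _ _ _ _) => sm.
move: (dot g (P u1)) (dot g (P u2)) (dot (P u1) (P u1)) (dot (P u2) (P u2)).
move: p q r (gram_det e1 e2) gram_neq0 => a b e D D0' x1 x2 x3 x4.
have four : (4 : K) != 0 by rewrite (natrM K 2 2) mulf_neq0.
by field; rewrite lam_neq0 D0' c_neq0 four.
Qed.

End NormalFrame.

(** * Quadratic expressions dominated by a negative term *)

Lemma young_dot (K : realFieldType) n (u v : 'rV[K]_n) (t : K) : 0 < t ->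
  dot u v <= t / 2 * dot v v + (2 * t)^-1 * dot u u.
Proof.
move=> t0; have := dot_ge0 (t *: v - u); rewrite !dotE (dotC v u) => h.
have {h} : 2 * t * dot u v <= t ^+ 2 * dot v v + dot u u.
  by move: h; move: (dot u v) (dot v v) (dot u u) => x y w; rewrite !expr2; lra.
move=> h; have t2 : 0 < 2 * t by rewrite mulr_gt0.
rewrite -(ler_pM2l t2); apply: le_trans h _; rewrite le_eqVlt; apply/orP; left; apply/eqP.
by move: (dot v v) (dot u u) => x y; field; rewrite gt_eqF.
Qed.

Section QuadraticBlowUp.
Variables (R : realType) (V : normedModType R) (n : nat) (z : V) (Q : set V).
Variables (al om F : V -> R^o) (be ga w1 w2 : V -> 'rV[R]_n).
Hypothesis Lal : lipschitz_at al z.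
Hypothesis Lom : lipschitz_at om z.
Hypothesis Lbe : lipschitz_at be z.
Hypothesis Lga : lipschitz_at ga z.
Hypothesis om_neq0 : om z != 0.
Hypothesis om_gt0 : \forall x \near z, 0 < om x.
Hypothesis FE : \forall x \near z, Q x -> F x =
  al x + dot (be x) (w1 x) + dot (ga x) (w2 x)
  - om x * (dot (w1 x) (w1 x) + dot (w2 x) (w2 x)).
Hypothesis blowup : forall T : R, \forall x \near z, Q x ->
  T <= dot (w1 x) (w1 x) + dot (w2 x) (w2 x).

(** The inequality of [young_dot] lets half of the quadratic term absorb the linear ones. What is
    shown is -F >= |T|, so F tends to minus infinity. *)
Lemma quadratic_blowup (T : R) : \forall x \near z, Q x -> T <= `|F x|.
Proof.
have LV := lipschitz_atV om_neq0 Lom.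
have [Mo Mo0 bo] := lipschitz_at_bounded LV.
(* A positive lower bound of [om] near [z], as [Mo] bounds its inverse. *)
pose t := Mo^-1.
have t0 : 0 < t by rewrite invr_gt0.
have LB : lipschitz_at (fun x => dot (be x) (be x) + dot (ga x) (ga x) : R^o) z.
  by apply: lipschitz_atD; exact: lipschitz_at_dot.
have [Ma Ma0 ba] := lipschitz_at_bounded Lal.
have [Mb Mb0 bb] := lipschitz_at_bounded LB.
(* Chosen such that (t/2) S exceeds |T| by the bounds of [al] and of the remainders in
   [young_dot]. *)
pose S := 2 / t * (`|T| + Ma + (2 * t)^-1 * Mb).
have FF : Filter (nbhs z) by exact: nbhs_filter.
have B1 := @filterI _ _ FF _ _ bo ba.
have B2 := @filterI _ _ FF _ _ bb om_gt0.
have B3 := @filterI _ _ FF _ _ FE (blowup S).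
have := @filterI _ _ FF _ _ (@filterI _ _ FF _ _ B1 B2) B3; apply: filterS => x.
move=> [[[/= hbo hba] [/= hbb o0]] [FxE Wx]] Qx.
rewrite FxE //; have {}Wx := Wx Qx.
have ot : t <= om x.
  rewrite /t -[om x]invrK lef_pV2 ?posrE ?invr_gt0 //.
  exact: le_trans (ler_norm _) hbo.
have y1 := young_dot (be x) (w1 x) t0; have y2 := young_dot (ga x) (w2 x) t0.
have ha := le_trans (ler_norm _) hba; have hb := le_trans (ler_norm _) hbb.
have W0 : 0 <= dot (w1 x) (w1 x) + dot (w2 x) (w2 x) by rewrite addr_ge0 // dot_ge0.
have oW : t * (dot (w1 x) (w1 x) + dot (w2 x) (w2 x)) <=
    om x * (dot (w1 x) (w1 x) + dot (w2 x) (w2 x)) by rewrite ler_wpM2r.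
have S1 : `|T| + Ma + (2 * t)^-1 * Mb <=
    t / 2 * (dot (w1 x) (w1 x) + dot (w2 x) (w2 x)).
  have t2 : 0 < t / 2 by rewrite divr_gt0.
  apply: le_trans (ler_wpM2l (ltW t2) Wx).
  by rewrite /S mulrA le_eqVlt; apply/orP; left; apply/eqP;
    move: (_ + _ + _) => y; field; rewrite gt_eqF.
have hb2 : (2 * t)^-1 * (dot (be x) (be x) + dot (ga x) (ga x)) <= (2 * t)^-1 * Mb.
  by rewrite ler_wpM2l // invr_ge0 mulr_ge0 // ltW.
rewrite -normrN; apply: le_trans (ler_norm _); apply: le_trans (ler_norm T) _.
move: oW S1 hb2 y1 y2 ha.
move: (dot (be x) (w1 x)) (dot (ga x) (w2 x)) (dot (w1 x) (w1 x)) (dot (w2 x) (w2 x))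
  (dot (be x) (be x)) (dot (ga x) (ga x)) (al x) (om x) (`|T|) ((2 * t)^-1)
  => x1 x2 x3 x4 x5 x6 a o N v.
rewrite !mulrDr; move: (v * x5) (v * x6) (o * x3) (o * x4) (v * Mb) => p1 p2 p3 p4 p5.
rewrite [t / 2 * x3]mulrAC [t / 2 * x4]mulrAC; move: (t * x3) (t * x4) => p6 p7.
lra.
Qed.

End QuadraticBlowUp.

(** * Extension and blow-up of the curvatures *)

Section BranchCurvature.
Variables (R : realType) (n : nat) (hn : (3 <= n)%N) (s : nat).
Variables (V : set 'rV[R]_n) (G : 'rV[R]_n -> 'M[R]_n).
Variables (D : set 'rV[R]_2) (fh : 'rV[R]_2 -> 'rV[R]_n).
Variables (d : 'rV[R]_2 -> 'rV[R[i]]_n) (l : 'rV[R]_2 -> 'rV[R]_n).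
Local Notation Re := (@complex.Re R).
Local Notation Im := (@complex.Im R).
Local Notation k1 := (first hn).
Local Notation k2 := (second hn).

Hypothesis oV : open V.
Hypothesis sG : smooth_on V G.
Hypothesis G_conf : forall w, V w -> G w = G w k1 k1 *: 1%:M.
Hypothesis Lam_gt0 : forall w, V w -> 0 < G w k1 k1.
Hypothesis oD : open D.
Hypothesis D0 : D 0.
Hypothesis sfh : smooth_on D fh.
Hypothesis fV : forall z, D z -> V (fh z).
Hypothesis sdR : smooth_on D (fun z => map_mx Re (d z)).
Hypothesis sdI : smooth_on D (fun z => map_mx Im (d z)).
Hypothesis sl : smooth_on D l.
Hypothesis dz_fh : forall z, D z -> forall k,
  dz (coordC fh k) z = s.+1%:R * toC z ^+ s * d z 0 k.
Hypothesis dzbar_dz_fh : forall z, D z -> forall k,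
  dzbar (dz (coordC fh k)) z = (modC (toC z) ^+ (2 * s) * l z 0 k)%:C.
Hypothesis Jneq0 : forall z, D z ->
  e1 d z 0 k1 * e2 d z 0 k2 - e1 d z 0 k2 * e2 d z 0 k1 != 0.

Local Notation c := (s.+1%:R : R).
Local Notation lamz := (lam k1 G fh).
Local Notation grad z := (gradL k1 G (fh z)).
Local Notation hess z := (hessL k1 G (fh z)).
Local Notation e1 := (e1 d).
Local Notation e2 := (e2 d).
Local Notation P z := (perp (e1 z) (e2 z)).
Local Notation Dl z := (gram_det (e1 z) (e2 z)).
Local Notation U1 := (u1 hn s d).
Local Notation U2 := (u2 hn s d).

Lemma gram_e_gt0 z : D z -> 0 < Dl z.
Proof. by move=> Dz; exact: gram_det_gt0 (Jneq0 Dz). Qed.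

Lemma gram_e_neq0 z : D z -> Dl z != 0.
Proof. by move=> Dz; rewrite gt_eqF // gram_e_gt0. Qed.

Lemma zs_neq0 (z : 'rV[R]_2) : z != 0 -> zr s z ^+ 2 + zi s z ^+ 2 != 0.
Proof.
by move=> z0; rewrite -modC_sqr expf_neq0 // modC_eq0 expf_neq0 // toC_eq0.
Qed.

Let c_neq0 : c != 0. Proof. by rewrite pnatr_eq0. Qed.

(** The formulas for immersions are applied on the punctured set; [Kext], [Hext] and [Sext] are then
    defined on all of [D]. *)
Let D' : set 'rV[R]_2 := D `&` [set z | z != 0].

Let oD' : open D'.
Proof.
apply: openI => //.
have -> : [set z : 'rV[R]_2 | z != 0] = ~` [set 0].
  by apply/seteqP; split=> z /= /eqP.
exact/closed_openC/accessible_closed_set1/hausdorff_accessible/norm_hausdorff.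
Qed.

Let sfh' : smooth_on D' fh.
Proof. by move=> k; apply: Ck_on_subset (sfh k) => z []. Qed.
Let fV' z : D' z -> V (fh z). Proof. by move=> [Dz _]; exact: fV. Qed.
Let imm' z : D' z -> gram_det (pd 0 fh z) (pd 1 fh z) != 0.
Proof.
move=> [Dz z0]; exact: frame_det_neq0 (zs_neq0 z0) c_neq0 (gram_e_neq0 Dz)
  (pd0_fh sfh dz_fh Dz) (pd1_fh sfh dz_fh Dz).
Qed.

Definition Kext cc z (xi : 'rV[R]_n) : R :=
  gauss_kronecker_form c (lamz z) (e1 z) (e2 z) (U1 cc z) (U2 cc z) (l z) (grad z) xi.

Lemma KextE cc z xi : D z -> z != 0 -> dot xi (e1 z) = 0 -> dot xi (e2 z) = 0 ->
  gauss_kronecker G fh z xi = Kext cc z xi.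
Proof.
move=> Dz z0 o1 o2.
have h0 := pd0_fh sfh dz_fh Dz; have h1 := pd1_fh sfh dz_fh Dz.
have [[t1 t2] [h00 h11 h01 h10] _] := second_fh oD sfh sdR sdI dz_fh dzbar_dz_fh Dz.
have [hv1 hv2] := v_decomp s Jneq0 cc Dz z0.
have x0 : dot xi (pd 0 fh z) = 0 by rewrite h0 dotZr dotBr !dotZr o1 o2 !mulr0 subr0 mulr0.
have x1 : dot xi (pd 1 fh z) = 0 by rewrite h1 dotZr dotDr !dotZr o1 o2 !mulr0 addr0 mulr0.
apply: etrans (gauss_kroneckerE oV sG G_conf Lam_gt0 fV' imm' (conj Dz z0) x0 x1) _.
exact: (@assembly_gauss_kronecker _ _ _ _ _ (lamz z) _ _ _ _ _ _ _ (grad z) _ _ _ _ _ _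
  (fun i => pd i fh z) (fun i j => pd i (pd j fh) z) (zs_neq0 z0) c_neq0
  (gram_e_neq0 Dz) h0 h1 h00 h11 h01 h10 hv1 hv2 _ o1 o2).
Qed.

Definition Hext cc z : 'rV[R]_n := \row_k
  mean_form c (lamz z) (e1 z) (e2 z) (U1 cc z) (U2 cc z) (l z) (grad z) k.

Lemma HextE cc z : D z -> z != 0 -> mean_curvature G fh z = Hext cc z.
Proof.
move=> Dz z0; apply/rowP => k; rewrite [RHS]mxE.
have h0 := pd0_fh sfh dz_fh Dz; have h1 := pd1_fh sfh dz_fh Dz.
have [[t1 t2] [h00 h11 h01 h10] _] := second_fh oD sfh sdR sdI dz_fh dzbar_dz_fh Dz.
have [hv1 hv2] := v_decomp s Jneq0 cc Dz z0.
apply: etrans (mean_curvatureE oV sG G_conf Lam_gt0 oD' sfh' fV' imm' k (conj Dz z0)) _.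
exact: (@assembly_mean _ _ _ _ _ (lamz z) _ _ _ _ _ _ _ (grad z) _ _ _ _ _ _
  (fun i => pd i fh z) (fun i j => pd i (pd j fh) z) (zs_neq0 z0) c_neq0
  (gram_e_neq0 Dz) h0 h1 h00 h11 h01 hv1 hv2).
Qed.

Definition Sext cc z : R :=
  sectional_form c (lamz z) (e1 z) (e2 z) (U1 cc z) (U2 cc z) (l z) (grad z) (hess z).

Lemma SextE cc z : D z -> z != 0 ->
  sectional_curvature (induced_metric G fh) z = Sext cc z.
Proof.
move=> Dz z0.
have h0 := pd0_fh sfh dz_fh Dz; have h1 := pd1_fh sfh dz_fh Dz.
have [[t1 t2] [h00 h11 h01 h10] _] := second_fh oD sfh sdR sdI dz_fh dzbar_dz_fh Dz.
have [hv1 hv2] := v_decomp s Jneq0 cc Dz z0.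
have hs i j := @hessL_sym _ _ k1 _ _ oV sG _ i j (fV Dz).
have l0 := lam_neq0 Lam_gt0 fV Dz.
apply: etrans (sectionalE oV sG G_conf Lam_gt0 oD' sfh' fV' imm' (conj Dz z0)) _.
exact: (@assembly_sectional _ _ _ _ _ _ _ _ _ _ _ _ _ _ _ _ _ _ _ _ _
  (fun i => pd i fh z) (fun i j => pd i (pd j fh) z) (fun i => pd i lamz z)
  (zs_neq0 z0) c_neq0
  (gram_e_neq0 Dz) h0 h1 h00 h11 h01 hv1 hv2 hs l0
  (fun i => pd_lam k1 oV sG sfh fV i Dz)).
Qed.

Lemma lipschitz_fh z : D z -> lipschitz_at fh z.
Proof.
move=> Dz; apply: lipschitz_at_mx => i k; rewrite (ord1 i).
by apply: C1_lipschitz oD Dz _; apply: Ck_on_coord => //; exact: (sfh 1%N).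
Qed.

Lemma lipschitz_lam z : D z -> lipschitz_at lamz z.
Proof.
move=> Dz; apply: (@lipschitz_at_comp _ _ _ _ fh (fun w => G w k1 k1 : R^o) z (lipschitz_fh Dz)).
exact: C1_lipschitz oV (fV Dz) (smooth_Lam k1 oV sG 1%N).
Qed.

Lemma lipschitz_grad z : D z -> lipschitz_at (fun w => grad w) z.
Proof.
move=> Dz; apply: (@lipschitz_at_comp _ _ _ _ fh (gradL k1 G) z (lipschitz_fh Dz)).
apply: lipschitz_at_mx => i k; under eq_fun do rewrite mxE.
have [_ +] := smooth_Lam k1 oV sG 2%N; move=> /(_ k).
exact: C1_lipschitz oV (fV Dz).
Qed.

Lemma lipschitz_hess z : D z -> lipschitz_at (fun w => hess w) z.
Proof.
move=> Dz; apply: (@lipschitz_at_comp _ _ _ _ fh (hessL k1 G) z (lipschitz_fh Dz)).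
apply: lipschitz_at_mx => i k; under eq_fun do rewrite mxE.
have [_ /(_ k) [_ +]] := smooth_Lam k1 oV sG 3%N; move=> /(_ i).
exact: C1_lipschitz oV (fV Dz).
Qed.

Lemma lipschitz_e1 z : D z -> lipschitz_at e1 z.
Proof.
move=> Dz; apply: lipschitz_at_mx => i k.
by apply: C1_lipschitz oD Dz _; apply: Ck_on_coord => //; exact: (sdR 1%N).
Qed.

Lemma lipschitz_e2 z : D z -> lipschitz_at e2 z.
Proof.
move=> Dz; apply: lipschitz_at_mx => i k.
by apply: C1_lipschitz oD Dz _; apply: Ck_on_coord => //; exact: (sdI 1%N).
Qed.

Lemma lipschitz_l z : D z -> lipschitz_at l z.
Proof.
move=> Dz; apply: lipschitz_at_mx => i k.
by apply: C1_lipschitz oD Dz _; apply: Ck_on_coord => //; exact: (sl 1%N).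
Qed.

Section Extension.
Variables (cc : 'I_n -> R[i]) (z : 'rV[R]_2).
Hypothesis Dz : D z.
Hypothesis Lu1 : lipschitz_at (U1 cc) z.
Hypothesis Lu2 : lipschitz_at (U2 cc) z.

Let g0 := gram_e_neq0 Dz.
Let l0 := lam_neq0 Lam_gt0 fV Dz.

Lemma lipschitz_Kext xi : lipschitz_at xi z ->
  lipschitz_at (fun w => Kext cc w (xi w) : R^o) z.
Proof.
exact: (lipschitz_gauss_kronecker g0 l0 c_neq0 (lipschitz_lam Dz) (lipschitz_e1 Dz)
  (lipschitz_e2 Dz) Lu1 Lu2 (lipschitz_l Dz) (lipschitz_grad Dz)).
Qed.

Lemma lipschitz_Hext : lipschitz_at (Hext cc) z.
Proof.
apply: lipschitz_at_mx => i k; under eq_fun do rewrite mxE.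
exact: (lipschitz_mean g0 l0 c_neq0 (lipschitz_lam Dz) (lipschitz_e1 Dz)
  (lipschitz_e2 Dz) Lu1 Lu2 (lipschitz_l Dz) (lipschitz_grad Dz)).
Qed.

Lemma lipschitz_Sext : lipschitz_at (Sext cc : 'rV[R]_2 -> R^o) z.
Proof.
exact: (lipschitz_sectional g0 l0 c_neq0 (lipschitz_lam Dz) (lipschitz_e1 Dz)
  (lipschitz_e2 Dz) Lu1 Lu2 (lipschitz_l Dz) (lipschitz_grad Dz) (lipschitz_hess Dz)).
Qed.

End Extension.

Section BlowUp.
Variables (k : 'I_n) (m : nat).
Hypothesis k_ge2 : (2 <= k)%N.
Hypothesis m_lt : (m < s)%N.
Hypothesis vanish : forall j, (j <= m)%N -> iter j (@dz R) (fun z => d z 0 k) 0 = 0.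
Hypothesis leading : iter m.+1 (@dz R) (fun z => d z 0 k) 0 <> 0.

Let g0 := gram_e_neq0 D0.
Let l0 := lam_neq0 Lam_gt0 fV D0.
Let Llam := lipschitz_lam D0.
Let Le1 := lipschitz_e1 D0.
Let Le2 := lipschitz_e2 D0.
Let Ll := lipschitz_l D0.
Let Lgrad := lipschitz_grad D0.
Let Lhess := lipschitz_hess D0.

(** Coefficients of the quadratic and linear terms in the splittings, common to the sectional
    curvature and the sum of Gauss-Kronecker curvatures. *)
Let om z : R^o := (4 * c ^+ 2 * Dl z * lamz z)^-1.
Let be z : 'rV[R]_n :=
  ((dot (e1 z) (e1 z) - dot (e2 z) (e2 z)) / (4 * c * Dl z * lamz z ^+ 2)) *: grad z.
Let ga z : 'rV[R]_n :=
  (2 * dot (e1 z) (e2 z) / (4 * c * Dl z * lamz z ^+ 2)) *: grad z.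

Let Lom : lipschitz_at om 0.
Proof.
apply: lipschitz_atV; first by rewrite !mulf_neq0 ?expf_neq0 // pnatr_eq0.
apply: lipschitz_atM => //; apply: lipschitz_atM; first exact: lipschitz_at_cst.
exact: lipschitz_at_gram_det.
Qed.

Let Lden : lipschitz_at (fun z => (4 * c * Dl z * lamz z ^+ 2)^-1 : R^o) 0.
Proof.
apply: lipschitz_atV; first by rewrite !mulf_neq0 ?expf_neq0 // pnatr_eq0.
apply: lipschitz_atM; last exact: lipschitz_atX.
apply: lipschitz_atM; first exact: lipschitz_at_cst.
exact: lipschitz_at_gram_det.
Qed.

Let Lbe : lipschitz_at be 0.
Proof.
apply: lipschitz_atZ => //; apply: lipschitz_atM => //.
by apply: lipschitz_atB; exact: lipschitz_at_dot.
Qed.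

Let Lga : lipschitz_at ga 0.
Proof.
apply: lipschitz_atZ => //; apply: lipschitz_atM => //.
by apply: lipschitz_atM; [exact: lipschitz_at_cst|exact: lipschitz_at_dot].
Qed.

Let om_gt0 z : D z -> 0 < om z.
Proof.
move=> Dz; have := gram_e_gt0 Dz; have := Lam_gt0 (fV Dz) => h1 h2.
by rewrite invr_gt0 !mulr_gt0 // ?exprn_gt0 ?ltr0n.
Qed.

Let om_near : \forall z \near (0 : 'rV[R]_2), 0 < om z.
Proof. by have := open_near oD D0; apply: filterS => z; exact: om_gt0. Qed.

Let om_neq0 : om 0 != 0.
Proof. by rewrite gt_eqF // om_gt0. Qed.

Let blowup : forall T : R, \forall z \near (0 : 'rV[R]_2), z != 0 ->
  T <= dot (P z (U1 (fun=> 0) z)) (P z (U1 (fun=> 0) z)) +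
       dot (P z (U2 (fun=> 0) z)) (P z (U2 (fun=> 0) z)).
Proof.
have dbar i w : D w -> _ := dzbar_d oD D0 sdR sdI sl dz_fh dzbar_dz_fh i (z := w).
exact: (normal_blowup oD D0 sdR sdI sl Jneq0 dbar k_ge2 m_lt vanish leading).
Qed.

Lemma sectional_blowup (T : R) : \forall z \near (0 : 'rV[R]_2), z != 0 ->
  T <= `|sectional_curvature (induced_metric G fh) z|.
Proof.
have Lal := lipschitz_sectional g0 l0 c_neq0 Llam Le1 Le2
  (lipschitz_at_cst (0 : 'rV[R]_n) _) (lipschitz_at_cst (0 : 'rV[R]_n) _) Ll Lgrad Lhess.
apply: (quadratic_blowup (Q := [set z | z != 0]) (z := 0)
  (F := sectional_curvature (induced_metric G fh) : 'rV[R]_2 -> R^o)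
  Lal Lom Lbe Lga om_neq0 om_near _ blowup).
have := open_near oD D0; apply: filterS => z Dz z0.
apply: etrans (SextE _ Dz z0) _.
apply: sectional_form_split; first exact: (gram_e_neq0 Dz).
- exact: (lam_neq0 Lam_gt0 fV Dz).
- exact: c_neq0.
- by rewrite pnatr_eq0.
Qed.

Variable xi : 'I_(n - 2) -> 'rV[R]_2 -> 'rV[R]_n.
Hypothesis Lxi : forall j, lipschitz_at (xi j) 0.
Hypothesis xi_e1 : forall z, D z -> forall j, dot (xi j z) (e1 z) = 0.
Hypothesis xi_e2 : forall z, D z -> forall j, dot (xi j z) (e2 z) = 0.
Hypothesis xi_orth : forall z, D z -> forall i j,
  lamz z * dot (xi i z) (xi j z) = (i == j)%:R.

Lemma gauss_kronecker_blowup (T : R) : \forall z \near (0 : 'rV[R]_2), z != 0 ->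
  T <= `|\sum_j gauss_kronecker G fh z (xi j z)|.
Proof.
have Lal : lipschitz_at (fun z => \sum_j gauss_kronecker_form c (lamz z) (e1 z) (e2 z)
    0 0 (l z) (grad z) (xi j z) : R^o) 0.
  apply: lipschitz_at_sum => j.
  exact: (lipschitz_gauss_kronecker g0 l0 c_neq0 Llam Le1 Le2
  (lipschitz_at_cst (0 : 'rV[R]_n) _) (lipschitz_at_cst (0 : 'rV[R]_n) _) Ll Lgrad (Lxi j)).
apply: (quadratic_blowup (Q := [set z | z != 0]) (z := 0)
  (F := fun z => \sum_j gauss_kronecker G fh z (xi j z) : R^o)
  Lal Lom Lbe Lga om_neq0 om_near _ blowup).
have := open_near oD D0; apply: filterS => z Dz z0.
have KE j := KextE (fun=> 0) Dz z0 (xi_e1 Dz j) (xi_e2 Dz j).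
apply: etrans (eq_bigr _ (fun j _ => KE j)) _.
apply: sum_gauss_kronecker_form_split.
- exact: (gram_e_neq0 Dz).
- exact: (lam_neq0 Lam_gt0 fV Dz).
- exact: xi_e1.
- exact: xi_e2.
- exact: xi_orth.
- exact: c_neq0.
- by rewrite pnatr_eq0.
Qed.

End BlowUp.

End BranchCurvature.

(** * Charts and index *)

Section ChartLemmas.
Variables (R : realType) (M : manifold R 2) (x : chart R M 2) (p : M).
Variable W : set M.
Hypothesis oW : open W.
Hypothesis Wx : W `<=` chart_dom x.

Lemma chart_invK z : (x @` W) z -> x (chart_inv x z) = z.
Proof. by move=> [q Wq <-]; rewrite chart_mapK //; exact: Wx. Qed.

Lemma chart_image_open : open (x @` W).
Proof.
rewrite openE => _ [q Wq <-]; have Dz : (x @` chart_dom x) (x q) by exists q => //; exact: Wx.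
have nD := open_near (chart_img_open (c := x)) Dz.
have nW : nbhs (x q) (chart_inv x @^-1` W).
  by apply: (chart_inv_continuous Dz); rewrite chart_mapK; [exact: open_nbhs_nbhs|exact: Wx].
apply: filterS2 nD nW => w [q' Uq' <-]; rewrite /= chart_mapK // => Wq'.
by exists q'.
Qed.

(** The extension takes at [p] the value that [E] has at x(p). Read in the chart it is [E] again. *)
Lemma chart_extension (V : normedModType R) (F : M -> V) (E : 'rV[R]_2 -> V) :
  (forall q, W q -> q <> p -> E (x q) = F q) ->
  (forall z, (x @` W) z -> lipschitz_at E z) -> C01loc_extension x p W F.
Proof.
move=> EF LE; exists (E \o x) => // z Wz.
have [B nB [k k0 kB]] := LE z Wz; exists B => //.
have BW : (B `&` x @` W) z by split => //; exact: nbhs_singleton.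
(* The filter has to be proper, which the point (z, z) ensures. *)
apply: (@klipschitzW _ _ _ k).
  exact: (@globally_properfilter _ _ (z, z)).
move=> [a b] /= [[Ba Wa] [Bb Wb]]; rewrite !chart_invK //; exact: kB.
Qed.

Hypothesis Wp : W p.
Hypothesis x0 : x p = 0.

(** The chart is continuous at [p] and injective, so punctured neighbourhoods of 0 pull back to
    punctured neighbourhoods of [p]. *)
Lemma chart_blowup (F : M -> R) (E : 'rV[R]_2 -> R) :
  (forall q, W q -> F q = E (x q)) ->
  (forall T : R, \forall z \near (0 : 'rV[R]_2), z != 0 -> T <= E z) ->
  F q @[q --> p^'] --> +oo.
Proof.
move=> FE BE; apply/cvgryPge => T.
have cx := chart_map_continuous (Wx Wp).
have nE : nbhs p (x @^-1` [set z | z != 0 -> T <= E z]) by apply: cx; rewrite x0; exact: BE.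
have nW : nbhs p W by exact: open_nbhs_nbhs.
rewrite /dnbhs near_withinE; near=> q => qp.
have Wq : W q by near: q.
have Eq : x q != 0 -> T <= E (x q) by near: q.
rewrite FE //; apply: Eq; apply: contra_neq qp => xq.
by rewrite -(chart_mapK (Wx Wq)) xq -x0 chart_mapK //; exact: Wx.
Unshelve. all: end_near. Qed.

End ChartLemmas.

Lemma det_block_scalar (K : fieldType) (a b c d : K) :
  \det (block_mx a%:M b%:M c%:M d%:M : 'M[K]_(1 + 1)) = a * d - b * c.
Proof.
pose A := block_mx a%:M b%:M c%:M d%:M : 'M[K]_(1 + 1).
have o0 : (0 : 'I_2) = lshift 1 (0 : 'I_1) by exact: val_inj.
have o1 : (1 : 'I_2) = rshift 1 (0 : 'I_1) by exact: val_inj.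
have sc (x : K) : (x%:M : 'M[K]_1) 0 0 = x by rewrite mxE eqxx mulr1n.
have A00 : A 0 0 = a by rewrite o0 [LHS]block_mxEul sc.
have A01 : A 0 1 = b by rewrite o0 o1 [LHS]block_mxEur sc.
have A10 : A 1 0 = c by rewrite o0 o1 [LHS]block_mxEdl sc.
have A11 : A 1 1 = d by rewrite o1 [LHS]block_mxEdr sc.
by have := det2 A; rewrite A00 A01 A10 A11.
Qed.

(** * The index and the vanishing order of d *)

Section Index.
Variables (R : realType) (n s : nat) (D : set 'rV[R]_2).
Variables (fh : 'rV[R]_2 -> 'rV[R]_n) (d : 'rV[R]_2 -> 'rV[R[i]]_n).
Hypothesis oD : open D.
Hypothesis D0 : D 0.
Hypothesis sd : forall k, csmooth D (fun z => d z 0 k).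
Hypothesis dz_fh : forall z, D z -> forall k,
  dz (coordC fh k) z = s.+1%:R * toC z ^+ s * d z 0 k.

Lemma iter_dzZ (a : R[i]) F j z : csmooth D F -> D z ->
  iter j (@dz R) (fun w => a * F w) z = a * iter j (@dz R) F z.
Proof.
move=> sF; elim: j z => [|j IH] z Dz //=.
by rewrite (dz_on oD IH Dz) dzZ //; apply: (csmooth_diff Dz); exact: csmooth_iter_dz.
Qed.

(** One derivative turns f^_k into (s+1) z^s d_k, and at 0 another [s] of them are spent on z^s. So
    orders of f^_k and d_k differ by s + 1. *)
Lemma iter_dz_fh k j : iter j.+1 (@dz R) (coordC fh k) 0 =
  (j ^_ s)%:R * (s.+1%:R * iter (j - s) (@dz R) (fun z => d z 0 k) 0).
Proof.
have sG : csmooth D (fun w => s.+1%:R * d w 0 k).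
  by apply: csmoothM => //; exact: csmooth_cst.
rewrite iterSr (@iter_dz_on _ D _ (fun w => toC w ^+ s * (s.+1%:R * d w 0 k))) //.
  by rewrite (iter_dz_toCXM s j oD D0 sG) iter_dzZ.
by move=> w Dw; rewrite dz_fh // mulrCA mulrA.
Qed.

Lemma iter_dz_fh_eq0 k j :
  (iter (j + s).+1 (@dz R) (coordC fh k) 0 == 0) =
  (iter j (@dz R) (fun z => d z 0 k) 0 == 0).
Proof.
rewrite iter_dz_fh addnK mulf_eq0 mulf_eq0 !pnatr_eq0 /=.
by rewrite (_ : ((j + s) ^_ s == 0)%N = false) //; apply/negbTE;
  rewrite -lt0n ffact_gt0 leq_addl.
Qed.

Local Notation I := {k : 'I_n | (2 <= k)%N}.
Local Notation ord_fh := (zord (fun k : I => coordC fh (sval k))).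

Lemma zord_ge (N : nat) : (N%:R%:E <= ord_fh)%E -> forall j (k : 'I_n), (2 <= k)%N ->
  (1 <= j)%N -> (j < N)%N -> iter j (@dz R) (coordC fh k) 0 = 0.
Proof.
move=> Nle j k k2 j1 jN; apply/eqP; apply: contraTT Nle => /eqP h.
rewrite -ltNge; apply: (@le_lt_trans _ _ (j%:R%:E)); last by rewrite lte_fin ltr_nat.
by apply: ereal_inf_lbound; exists j => //; split => //; exists (exist _ k k2).
Qed.

(** An infimum below [N] yields some order below [N] with a nonzero derivative; the least one is
    selected. *)
Lemma zord_lt (N : nat) : (ord_fh < N%:R%:E)%E ->
  exists j, [/\ (1 <= j < N)%N,
    exists2 k : 'I_n, (2 <= k)%N & iter j (@dz R) (coordC fh k) 0 <> 0 &
    forall i (k : 'I_n), (2 <= k)%N -> (1 <= i < j)%N -> iter i (@dz R) (coordC fh k) 0 = 0].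
Proof.
move=> /ereal_inf_lt [_ [j0 [j01 j0P] <-]]; rewrite lte_fin ltr_nat => j0N.
pose A j := (1 <= j)%N && `[< exists k : I, iter j (@dz R) (coordC fh (sval k)) 0 <> 0 >].
have exA : exists j, A j by exists j0; rewrite /A j01; exact/asboolP.
have [j /andP[j1 /asboolP [[k k2] /= jk]] jmin] := find_ex_minn exA.
exists j; split.
- rewrite j1 (leq_ltn_trans _ j0N) //; apply: jmin; rewrite /A j01; exact/asboolP.
- by exists k.
- move=> i k' k'2 /andP[i1 ij]; apply: contrapT => h.
  suff : (j <= i)%N by rewrite leqNgt ij.
  by apply: jmin; rewrite /A i1; apply/asboolP; exists (exist _ k' k'2).
Qed.

(** The hypothesis makes all orders below 2s + 2 vanish, and for [j <= s] the order (j + s) + 1 is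
    at most 2s + 1. *)
Lemma branch_index_ge : (((2 * s + 1)%:R : R)%:E <= ord_fh - 1)%E ->
  forall k : 'I_n, (2 <= k)%N -> forall j, (j <= s)%N ->
  iter j (@dz R) (fun z => d z 0 k) 0 = 0.
Proof.
move=> h k k2 j js; apply/eqP; rewrite -iter_dz_fh_eq0; apply/eqP.
apply: (@zord_ge (2 * s + 2)) => //; last by lia.
move: h; case: ord_fh => [r||]; [|by move=> _; rewrite leey|by []].
by rewrite -EFinB !lee_fin lerBrDr natr1 addn1 addn2.
Qed.

(** The least order exceeds s because of z^s, and s + 1 because d_k vanishes at 0. Written as m + s
    + 2 and compared with 2s + 2, it gives m < s. *)
Lemma branch_index_lt : (forall k : 'I_n, (2 <= k)%N -> d 0 0 k = 0) ->
  (ord_fh - 1 < ((2 * s + 1)%:R : R)%:E)%E ->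
  exists m (k : 'I_n), [/\ (2 <= k)%N, (m < s)%N,
    forall j, (j <= m)%N -> iter j (@dz R) (fun z => d z 0 k) 0 = 0 &
    iter m.+1 (@dz R) (fun z => d z 0 k) 0 <> 0].
Proof.
move=> d0 h.
have /zord_lt [j0 [/andP[j01 jN] [k k2 jk] jmin]] : (ord_fh < (2 * s + 2)%:R%:E)%E.
  move: h; case: ord_fh => [r||]; [|by []|by move=> _; rewrite ltNyr].
  by rewrite -EFinB !lte_fin ltrBlDr natr1 addn1 addn2.
case: j0 j01 jN jk jmin => // j _ jN jk jmin.
have sj : (s <= j)%N.
  rewrite leqNgt; apply/negP => js; apply: jk.
  by rewrite iter_dz_fh ffact_small // mul0r.
move: jk jN jmin; rewrite -(subnK sj); move: (j - s)%N => [|m] jk jN jmin.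
  by move/eqP: jk; rewrite iter_dz_fh_eq0 /= d0 ?eqxx.
exists m, k; split; [exact: k2|lia| |].
  move=> i im; apply/eqP; rewrite -iter_dz_fh_eq0; apply/eqP; apply: jmin => //.
  by rewrite /= ltnS ltn_add2r.
by move/eqP: jk; rewrite iter_dz_fh_eq0 => /eqP.
Qed.

End Index.

(** The limits oo are expressed by absolute values, and a local section is one over an arbitrary
    open part [W] of U. The proof works on the image [D] of the chart, with 0 in place of [p]. *)
Theorem theorem5 (R : realType) (n : nat) (hn : (3 <= n)%N)
    (M : manifold R 2) (N : manifold R n) (gN : riemannian_metric N)
    (f : M -> N) (hf : smooth_map f) (p : M) (s : nat)
    (hp : branch_point hn f p s)
    (x : chart R M 2) (y : chart R N n)
    (d : 'rV[R]_2 -> 'rV[R[i]]_n) (l : 'rV[R]_2 -> 'rV[R]_n)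
    (hxy : regular_branch_coordinates hn f p s x y d l)
    (hy : conformal_chart gN y) :
  let U := chart_dom x in
  let G := gram gN y in
  let fh := local_expr f x y in
  let Sec (q : M) : R^o := sectional_curvature (induced_metric G fh) (x q) in
  let H (q : M) := mean_curvature G fh (x q) in
  let K (xi : M -> 'rV[R]_n) (q : M) : R^o :=
    gauss_kronecker G fh (x q) (xi q) in
  let iota := branch_index f x y in
  ((((2 * s + 1)%:R : R)%:E <= iota)%E ->
     [/\ C01loc_extension x p U Sec,
         C01loc_extension x p U H &
         forall (W : set M) (xi : M -> 'rV[R]_n),
           open W -> W `<=` U ->
           smooth_normal_section gN f x y d W xi ->
           C01loc_extension x p W (K xi)]) /\
  ((iota < ((2 * s + 1)%:R : R)%:E)%E ->
     (`|Sec q| @[q --> p^'] --> +oo) /\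
     forall xi : 'I_(n - 2) -> M -> 'rV[R]_n,
       smooth_normal_frame gN f x y d U xi ->
       `|\sum_(j < n - 2) K (xi j) q| @[q --> p^'] --> +oo).
Proof.
move=> U G fh Sec H K iota.
have [] := hxy; set D := chart_img x => [] [[cx cy] Up fUV x0 _] [sdR sdI sl] dzfh Jdet.
move=> [d1' [d2' [_ _ d0 _ _]]].
have oD : open D := chart_img_open (c := x).
have oV : open (chart_img y) := chart_img_open (c := y).
have oU : open U := chart_dom_open x.
have UU : U `<=` chart_dom x by [].
have D0 : D 0 by exists p.
have DU q : U q -> D (x q) by exists q.
have sfh : smooth_on D fh.
  have := hf.2 x y cx cy; rewrite (_ : _ `&` _ = chart_dom x) //.
  by apply/seteqP; split => [q []//|q Uq]; split => //; apply: fUV; exists q.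
have fV z : D z -> chart_img y (fh z).
  move=> [q Uq <-]; exists (f q); first by apply: fUV; exists q.
  by rewrite /fh /local_expr chart_mapK.
have sG : smooth_on (chart_img y) G by exact: gram_smooth.
have [rho [_ rho0 rhoG]] := hy.
(* In conformal coordinates the metric is the identity matrix divided by [rho]. *)
have GE w : chart_img y w -> exists2 r, 0 < r & G w = r *: 1%:M.
  move=> [q Vq <-]; exists (rho q)^-1; first by rewrite invr_gt0 rho0.
  by rewrite (rhoG q Vq) scalerA mulVf ?scale1r // gt_eqF ?rho0.
pose k1 := first hn; pose k2 := second hn.
have Gk w r : G w = r *: 1%:M -> G w k1 k1 = r by move=> ->; rewrite !mxE eqxx mulr1.
have G_conf w : chart_img y w -> G w = G w k1 k1 *: 1%:M.
  by move=> /GE [r _ Gr]; rewrite (Gk w r Gr).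
have Lam_gt0 w : chart_img y w -> 0 < G w k1 k1.
  by move=> /GE [r r0 Gr]; rewrite (Gk w r Gr).
have dz_fh z : D z -> forall k, dz (coordC fh k) z = s.+1%:R * toC z ^+ s * d z 0 k.
  by move=> Dz k; have [] := dzfh z Dz k.
have dzbar_dz_fh z : D z -> forall k,
    dzbar (dz (coordC fh k)) z = (modC (toC z) ^+ (2 * s) * l z 0 k)%:C.
  by move=> Dz k; have [] := dzfh z Dz k.
have Jneq0 z : D z -> e1 d z 0 k1 * e2 d z 0 k2 - e1 d z 0 k2 * e2 d z 0 k1 != 0.
  move=> /Jdet; rewrite det_block_scalar /e1 /e2 !mxE; apply: contra_neq.
  move: (complex.Re _) (complex.Im _) (complex.Re _) (complex.Im _) => a b a' b' h.
  (* The determinant in the definition of regular branch coordinates is -4 times this minor. *)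
  by rewrite -(mulr0 (-4)) -h; ring.
have inner0 z v u : D z -> inner (G (fh z)) v u = 0 -> dot v u = 0.
  move=> Dz; rewrite (inner_conf G_conf _ _ (fV z Dz)) => /eqP.
  by rewrite mulf_eq0 (gt_eqF (Lam_gt0 _ (fV z Dz))) => /eqP.
(* [e1] and [e2] are the rows of the tangent fiber, and the positive conformal factor does not
   affect orthogonality. *)
have normal_dot z v : D z -> normal_fiber G fh d z v -> dot v (e1 d z) = 0 /\ dot v (e2 d z) = 0.
  move=> Dz nv; have := submx_refl (tangent_fiber d z).
  rewrite {1}/tangent_fiber col_mx_sub => /andP[t1 t2].
  by split; apply: inner0 Dz _; exact: nv.
have xK q : U q -> q <> p -> x q != 0.
  move=> Uq qp; apply/eqP => xq; apply: qp.
  by rewrite -(chart_mapK Uq) xq -x0 chart_mapK.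
have sdk k : csmooth D (fun z => d z 0 k) := csmooth_d oD sdR sdI k.
split=> hi.
  have van := branch_index_ge oD D0 sdk dz_fh hi.
  have dbar i w : D w -> _ := dzbar_d oD D0 sdR sdI sl dz_fh dzbar_dz_fh i (z := w).
  have [cc ccP] := lipschitz_u oD D0 sdR sdI sl Jneq0 dbar van.
  split.
  - apply: (@chart_extension _ _ x p U UU R^o Sec (Sext hn s G fh d l cc)).
      move=> q Uq qp; apply: esym.
      exact: (SextE oV sG G_conf Lam_gt0 oD sfh fV sdR sdI dz_fh dzbar_dz_fh Jneq0 cc (DU q Uq) (xK q Uq qp)).
    move=> z Dz; have [L1 L2] := ccP z Dz.
    exact: (lipschitz_Sext oV sG Lam_gt0 oD sfh fV sdR sdI sl Jneq0 Dz L1 L2).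
  - apply: (@chart_extension _ _ x p U UU _ H (Hext hn s G fh d l cc)).
      move=> q Uq qp; apply: esym.
      exact: (HextE oV sG G_conf Lam_gt0 oD sfh fV sdR sdI dz_fh dzbar_dz_fh Jneq0 cc (DU q Uq) (xK q Uq qp)).
    move=> z Dz; have [L1 L2] := ccP z Dz.
    exact: (lipschitz_Hext oV sG Lam_gt0 oD sfh fV sdR sdI sl Jneq0 Dz L1 L2).
  - move=> W xi oW WU [sxi nxi].
    apply: (@chart_extension _ _ x p W WU R^o (K xi)
      (fun z => Kext hn s G fh d l cc z (xi (chart_inv x z)))).
      move=> q Wq qp; apply: esym; have Uq := WU q Wq; have Dq := DU q Uq.
      have [xi1 xi2] := normal_dot (x q) (xi q) Dq (nxi q Wq).
      rewrite chart_mapK //.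
      exact: (KextE oV sG G_conf Lam_gt0 oD sfh fV sdR sdI dz_fh dzbar_dz_fh Jneq0 cc Dq (xK q Uq qp) xi1 xi2).
    move=> z Wz; have Dz : D z by have [q /WU Uq <-] := Wz; exact: DU.
    have [L1 L2] := ccP z Dz.
    apply: (lipschitz_Kext oV sG Lam_gt0 oD sfh fV sdR sdI sl Jneq0 Dz L1 L2).
    apply: lipschitz_at_mx => i k; rewrite (ord1 i).
    apply: C1_lipschitz (chart_image_open oW WU) Wz _.
    by apply: Ck_on_coord; [exact: chart_image_open|exact: (sxi 1%N)].
have [m [k [k_ge2 m_lt van lead]]] := branch_index_lt oD D0 sdk dz_fh d0 hi.
split.
  apply: (chart_blowup oU UU Up x0
    (E := fun z => `|sectional_curvature (induced_metric G fh) z|)) => //.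
  exact: (sectional_blowup oV sG G_conf Lam_gt0 oD D0 sfh fV sdR sdI sl dz_fh dzbar_dz_fh
    Jneq0 k_ge2 m_lt van lead).
move=> xi [nxi oxi].
apply: (chart_blowup oU UU Up x0
  (E := fun z => `|\sum_j gauss_kronecker G fh z (xi j (chart_inv x z))|)).
  by move=> q Uq; congr (`|_|); apply: eq_bigr => j _; rewrite /K chart_mapK.
apply: (gauss_kronecker_blowup oV sG G_conf Lam_gt0 oD D0 sfh fV sdR sdI sl dz_fh dzbar_dz_fh
    Jneq0 k_ge2 m_lt van lead).
- move=> j; apply: lipschitz_at_mx => i i'; rewrite (ord1 i).
  apply: (C1_lipschitz oD D0).
  by have [sxi _] := nxi j; apply: (Ck_on_coord _ _ oD); exact: (sxi 1%N).
- move=> z Dz j; have [q Uq zq] := Dz; have [_ /(_ q Uq)] := nxi j.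
  by rewrite -zq chart_mapK // => /(normal_dot _ _ (DU q Uq)) [].
- move=> z Dz j; have [q Uq zq] := Dz; have [_ /(_ q Uq)] := nxi j.
  by rewrite -zq chart_mapK // => /(normal_dot _ _ (DU q Uq)) [].
- move=> z [q Uq <-] i j; rewrite -(oxi q Uq i j) chart_mapK //.
  have E : fh (x q) = y (f q) by rewrite /fh /local_expr chart_mapK.
  rewrite -E; apply: esym.
  exact: (inner_conf G_conf (xi i q) (xi j q) (fV _ (DU q Uq))).
Qed.
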